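(* Let $N\ge5$, let $\Omega\subset\mathbb{R}^N$ be a bounded domain containing the origin, and let $D\ge\sup_{x\in\Omega}|x|$. Then for all $u\in C_0^\infty(\Omega)$ $$\int_\Omega(\Delta u)^2dx\ \ge\ \Big(\frac{N(N-4)}{4}\Big)^2\int_\Omega\frac{u^2}{|x|^4}dx+\Big(1+\frac{N(N-4)}{8}\Big)\sum_{i=1}^\infty\int_\Omega\frac{u^2}{|x|^4}X_1^2X_2^2\cdots X_i^2\,dx.$$ Moreover, for each $k=1,2,\dots$, the constant $1+\frac{N(N-4)}{8}$ is the best constant for the corresponding $k$-improved Rellich inequality, that is, $$1+\frac{N(N-4)}{8}=\inf_{u\in C_0^\infty(\Omega),\,u\ne0}\frac{\displaystyle\int_\Omega(\Delta u)^2dx-\Big(\frac{N(N-4)}{4}\Big)^2\int_\Omega\frac{u^2}{|x|^4}dx-\Big(1+\frac{N(N-4)}{8}\Big)\sum_{i=1}^{k-1}\int_\Omega\frac{u^2}{|x|^4}X_1^2\cdots X_i^2\,dx}{\displaystyle\int_\Omega\frac{u^2}{|x|^4}X_1^2X_2^2\cdots X_k^2\,dx}.$$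
   Context: $X_1(t)=(1-\log t)^{-1}$ and $X_k(t)=X_1(X_{k-1}(t))$, $k=2,3,\dots$, for $t\in(0,1]$; in the integrals $X_i$ stands for $X_i(|x|/D)$. For $k=1$ the sum $\sum_{i=1}^{k-1}$ is empty. *)

(* Defs.v *)
From HB Require Import structures.
From mathcomp Require Import all_boot all_order all_algebra.
From mathcomp Require Import all_classical all_reals all_analysis.

Set Implicit Arguments.
Unset Strict Implicit.
Unset Printing Implicit Defensive.

Import Order.TTheory GRing.Theory Num.Theory.
Import numFieldNormedType.Exports.

Local Open Scope classical_set_scope.
Local Open Scope ring_scope.

(* R^n is the type 'rV[R]_n, whose library topology is the usual one.  It
   carries no sigma-algebra in the library; we equip it with the one generated
   by the coordinate maps, i.e. the product (hence Borel) sigma-algebra, as the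
   library does for n-tuples. *)
Definition measure_rV_display : measure_display.
Proof. exact: (measure_tuple_display default_measure_display). Qed.

Section measurable_rV.
Context {R : realType} {n : nat}.

Definition rV_coord (i : 'I_n) (x : 'rV[R]_n) : measurableTypeR R := x 0 i.

Let rV_set0 : g_sigma_preimage rV_coord set0.
Proof. exact: sigma_algebra0. Qed.

Let rV_setC A : g_sigma_preimage rV_coord A -> g_sigma_preimage rV_coord (~` A).
Proof. exact: sigma_algebraC. Qed.

Let rV_bigcup (F : (set 'rV[R]_n)^nat) :
  (forall i, g_sigma_preimage rV_coord (F i)) ->
  g_sigma_preimage rV_coord (\bigcup_i (F i)).
Proof. exact: sigma_algebra_bigcup. Qed.

HB.instance Definition _ := @isMeasurable.Build measure_rV_display
  'rV[R]_n (g_sigma_preimage rV_coord) rV_set0 rV_setC rV_bigcup.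

Lemma measurable_rV_coord (i : 'I_n) :
  measurable_fun [set: 'rV[R]_n] (rV_coord i).
Proof.
move=> _ Y mY; rewrite setTI; apply: sub_sigma_algebra => /=.
rewrite -bigcup_seq/=; exists i => /=; first by rewrite mem_index_enum.
by exists Y => //; rewrite setTI.
Qed.

Lemma measurable_fun_rV d (T : measurableType d) (f : T -> 'rV[R]_n) :
  (forall i, measurable_fun [set: T] (rV_coord i \o f)) ->
  measurable_fun [set: T] f.
Proof.
move=> mf; suff H : g_sigma_preimage (fun i => rV_coord i \o f) `<=` measurable.
  move: H; rewrite g_sigma_preimage_comp => H _ A mA.
  by apply: H; exists A.
apply: smallest_sub; first exact: sigma_algebra_measurable.
apply: (big_ind (fun S => S `<=` measurable)) => //.
- by move=> A B hA hB C [/hA|/hB].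
- by move=> i _ _ [B mB <-]; exact: mf.
Qed.

End measurable_rV.

(* Lebesgue measure on R^n, as the n-fold product of the Lebesgue measure on
   the line: R^0 is a point of mass 1, and R^(n+1) is R x R^n. *)
Section lebesgue_rV.
Context {R : realType}.

Definition rV_cons n (p : measurableTypeR R * 'rV[R]_n) : 'rV[R]_n.+1 :=
  @row_mx _ 1 1 n (const_mx p.1) p.2.

Definition rV_uncons n (x : 'rV[R]_n.+1) : measurableTypeR R * 'rV[R]_n :=
  (x 0 ord0, \row_j x 0 (lift ord0 j)).

Lemma rV_consK n : cancel (@rV_cons n) (@rV_uncons n).
Proof.
move=> [a v]; rewrite /rV_uncons /rV_cons /=; congr pair.
  have -> : ord0 = lshift n (ord0 : 'I_1) by exact: val_inj.
  by rewrite (@row_mxEl _ 1 1 n) mxE.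
apply/rowP => j; rewrite mxE.
have -> : lift ord0 j = rshift 1 j by exact: val_inj.
by rewrite (@row_mxEr _ 1 1 n).
Qed.

Lemma measurable_rV_cons n :
  measurable_fun [set: measurableTypeR R * 'rV[R]_n] (@rV_cons n).
Proof.
apply: measurable_fun_rV => i.
have [j -> | j ->] := @split_ordP 1 n i.
- rewrite (_ : _ \o _ = fst) ?measurable_fst//.
  by apply/funext => p; rewrite /rV_coord /= (@row_mxEl _ 1 1 n) mxE.
- rewrite (_ : _ \o _ = rV_coord j \o snd); last first.
    by apply/funext => p; rewrite /rV_coord /= (@row_mxEr _ 1 1 n).
  by apply: measurableT_comp => //; exact: measurable_rV_coord.
Qed.

Lemma measurable_rV_uncons n : measurable_fun setT (@rV_uncons n).
Proof.
apply/measurable_fun_pairP; split => /=.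
  exact: (measurable_rV_coord ord0).
apply: measurable_fun_rV => j.
rewrite (_ : _ \o _ = rV_coord (lift ord0 j)); last first.
  by apply/funext => x; rewrite /rV_coord /= mxE.
exact: measurable_rV_coord.
Qed.

Section step.
Variables (n : nat) (mu : {sigma_finite_measure set 'rV[R]_n -> \bar R}).

Definition rV_product : set 'rV[R]_n.+1 -> \bar R :=
  pushforward (lebesgue_measure \x mu)%E (@rV_cons n).

Let rV_product0 : rV_product set0 = 0%E.
Proof. by rewrite /rV_product /pushforward preimage_set0 measure0. Qed.

Let rV_product_ge0 A : (0 <= rV_product A)%E.
Proof. by rewrite /rV_product /pushforward; exact: measure_ge0. Qed.

Let rV_product_sigma_additive : semi_sigma_additive rV_product.
Proof.
move=> F mF tF mUF; rewrite /rV_product /pushforward preimage_bigcup.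
have mpre A : measurable A -> measurable (@rV_cons n @^-1` A).
  by move=> mA; rewrite -[X in measurable X]setTI; exact: measurable_rV_cons.
apply: measure_semi_sigma_additive.
- by move=> k; apply: mpre; exact: mF.
- apply/trivIsetP => i j _ _ ij; rewrite -preimage_setI.
  by move/trivIsetP : tF => /(_ _ _ Logic.I Logic.I ij) ->; rewrite preimage_set0.
- by rewrite -preimage_bigcup; exact: mpre.
Qed.

HB.instance Definition _ := isMeasure.Build _ _ _ rV_product
  rV_product0 rV_product_ge0 rV_product_sigma_additive.

Let rV_product_sigma_finite : sigma_finite setT rV_product.
Proof.
have /sigma_finiteP[F [FT ndF Foo]] := sigma_finiteT (@lebesgue_measure R).
have /sigma_finiteP[G [GT ndG Goo]] := sigma_finiteT mu.
exists (fun k => @rV_uncons n @^-1` (F k `*` G k)).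
  apply/esym; rewrite -subTset => x _.
  have [i _ Fi] : (\bigcup_i F i) (rV_uncons x).1 by rewrite -FT.
  have [j _ Gj] : (\bigcup_i G i) (rV_uncons x).2 by rewrite -GT.
  exists (maxn i j) => //; split.
    by move: Fi; exact/subsetPset/ndF/leq_maxl.
  by move: Gj; exact/subsetPset/ndG/leq_maxr.
move=> k; have [mF Fk] := Foo k; have [mG Gk] := Goo k; split.
  by rewrite -[X in measurable X]setTI; apply: measurable_rV_uncons => //;
     exact: measurableX.
rewrite /rV_product /pushforward -comp_preimage.
rewrite (_ : _ \o _ = id); last by apply/funext => x /=; rewrite rV_consK.
by rewrite preimage_id product_measure1E// lte_mul_pinfty// ge0_fin_numE.
Qed.

HB.instance Definition _ := Measure_isSigmaFinite.Build _ _ _ rV_product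
  rV_product_sigma_finite.

End step.

Fixpoint lebesgue_rV n : {sigma_finite_measure set 'rV[R]_n -> \bar R} :=
  match n with
  | 0 => \d_(0 : 'rV[R]_0)
  | n'.+1 => rV_product (lebesgue_rV n')
  end.

End lebesgue_rV.

(* The library norm on 'rV[R]_n is the sup norm; |x| is the Euclidean one. *)
Definition enorm {R : realType} n (x : 'rV[R]_n) : R :=
  Num.sqrt (\sum_(i < n) x 0 i ^+ 2).

Section test_functions.
Context {R : realType} {n : nat}.
Implicit Types (u : 'rV[R]_n -> R) (Omega : set 'rV[R]_n).

Definition partial (i : 'I_n) u : 'rV[R]_n -> R :=
  fun x => 'D_(delta_mx 0 i) u x.

Definition laplacian u : 'rV[R]_n -> R :=
  fun x => \sum_(i < n) partial i (partial i u) x.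

(* C^oo: every iterated partial derivative, along any list of coordinates,
   exists and is continuous.  Existence has to be required separately, since
   'D is a total operator. *)
Definition smooth u : Prop :=
  forall s : seq 'I_n,
    continuous (foldr partial u s) /\
    forall (i : 'I_n) x, derivable (foldr partial u s) x (delta_mx 0 i).

(* An element of C_0^oo(Omega) is represented by its extension by 0 to R^n. *)
Definition test_function Omega u : Prop :=
  let supp := closure [set x | u x != 0] in
  [/\ smooth u, compact supp & supp `<=` Omega].

End test_functions.

Definition Xlog1 {R : realType} (t : R) : R := (1 - ln t)^-1.

(* Xlog 0 is the identity and is never used. *)
Definition Xlog {R : realType} (k : nat) (t : R) : R := iter k Xlog1 t.

Section integrals.
Context {R : realType} {N : nat}.
Variables (Omega : set 'rV[R]_N) (D : R).
Implicit Types u : 'rV[R]_N -> R.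
Local Open Scope ereal_scope.

(* The integrands below are nonnegative and these integrals take values in
   [0, +oo].  The quotients take the value 0 at the origin and ln is 0 there,
   which is immaterial for the integrals when N > 0. *)
Definition bilaplace_energy u : \bar R :=
  \int[lebesgue_rV N]_(x in Omega) ((laplacian u x) ^+ 2)%:E.

Definition rellich_term u : \bar R :=
  \int[lebesgue_rV N]_(x in Omega) (u x ^+ 2 / enorm x ^+ 4)%:E.

Definition log_term (i : nat) u : \bar R :=
  \int[lebesgue_rV N]_(x in Omega)
    (u x ^+ 2 / enorm x ^+ 4 *
     \prod_(1 <= j < i.+1) Xlog j (enorm x / D) ^+ 2)%:E.

End integrals.

(* Main.v *)
(* Write r = |x|, s = ln (r / D), P_k = X_1 ... X_k, S = P_1 + ... + P_m,
   V = P_1^2 + ... + P_m^2, b = (N - 4) / 2, a = N (N - 4) / 4, so that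
   c = 1 + a / 2.  As functions of s one has P_k' = P_k (P_1 + ... + P_k) and
   S' = (S^2 + V) / 2.  Put Y = (x . grad u) / r^2 and h = b + S / 2.
   Integrating the divergence of an explicit vector field gives
     int (Delta u)^2 = a^2 int u^2 / r^4 + c sum_(i <= m) int u^2 P_i^2 / r^4
       + int (Delta u - 2 Y + (a - 2 b) u / r^2)^2
       + 2 a int (|grad u|^2 / r^2 - Y^2) + (4 + 2 a) int (Y + h u / r^2)^2,
   and the last three integrands are nonnegative; the inequality follows as m
   tends to infinity.  The field is O(r^-3) at the origin, which is harmless for
   N >= 5: its divergence is integrable, and almost every line parallel to a
   coordinate axis avoids the origin.

   For the sharpness take u = r^-b P_k^(-1/2) g (1 / (L X_(k+1))) with g a smooth
   bump on [1, 2].  The first two factors annihilate Y + h u / r^2 for m = k, so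
   the last three integrals only see P_k / L, P_k^2 and V and are bounded by a
   small multiple of the integral I (g^2 + g'^2 + g''^2), where I q is the
   integral of r^-N P_k q (1 / (L X_(k+1))), while int u^2 P_k^2 / r^4 = I (g^2).
   No polar coordinates are needed to compare the two: for a suitable constant C,
   g^2 + g'^2 + g''^2 - C g^2 is the derivative of a function supported in [1, 2],
   so that I of it is the integral of a divergence and vanishes. *)
Require Import Defs.
From HB Require Import structures.
From mathcomp Require Import all_boot all_order all_algebra.
From mathcomp Require Import all_classical all_reals all_analysis.
From mathcomp Require Import measurable_realfun ring lra.
Import Order.TTheory GRing.Theory Num.Theory.
Import numFieldNormedType.Exports.
Local Open Scope classical_set_scope.
Local Open Scope ring_scope.

(** * Lebesgue measure on R^n *)

(** The constants come from a Riccati equation. With y = x / r^2 and rho = r^-2, the square (Y + h u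
    rho)^2 minus the divergence of y rho h u^2 is Y^2 - (2 b h + h' - h^2) u^2 rho^2, a Hardy
    inequality for the radial derivative. The choice of h makes the bracket b^2 + V / 4, and the
    weight 4 + 2 a turns V / 4 into c V. As a - 2 b = b^2, the first square costs b^4, and (4 + 2 a)
    b^2 - b^4 = a^2. The singularity shapes the rest. No ball is removed around the origin: each d_i
    F_i is integrated by itself along the lines parallel to the i-th axis. Hence every d_i F_i, of
    order r^-4, has to be integrable, not only their sum, and this is shown by comparison with a
    product of functions of one coordinate. When D equals the supremum of |x|, the ratio |x| / D
    still stays below 1 on Omega, because an open set does not attain that supremum away from 0. All
    the calculus in s can therefore be confined to s < 0. *)

Section measurability_rV.
Context {R : realType} {n : nat}.
Implicit Types A B : set 'rV[R]_n.

Lemma rV_ballP (x y : 'rV[R]_n) (e : R) : 0 < e ->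
  ball x e y <-> forall i, `|x 0 i - y 0 i| < e.
Proof.
move=> e0; split=> [xy i|xy].
  by case: xy => _ /(_ 0 i).
by split => // i j; rewrite ord1; exact: xy.
Qed.

(** The sigma-algebra is generated by the coordinates, so openness has to be reduced to countably
    many coordinate conditions: an open set is the union of the boxes with rational centre and
    radius 1 / (k + 1) that it contains. *)
Lemma open_measurable_rV A : open A -> measurable A.
Proof.
move=> oA.
pose B (p : 'rV[rat]_n * nat) : set 'rV[R]_n :=
  [set x | forall i, `|ratr (p.1 0 i) - x 0 i| < p.2.+1%:R^-1].
have -> : A = \bigcup_(p in [set p | B p `<=` A]) B p.
  rewrite eqEsubset; split => [x Ax|x [p pA px]]; last exact: pA.
  have /nbhs_ballP[e /= e0 eA] : nbhs x A by exact: open_nbhs_nbhs.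
  have e20 : 0 < e / 2 by rewrite divr_gt0.
  have [k _ /(_ k (leqnn k)) /= ke2] := near_infty_natSinv_lt (PosNum e20).
  have ke : 2 * k.+1%:R^-1 < e by rewrite mulrC -ltr_pdivlMr.
  have k0 : 0 < k.+1%:R^-1 :> R by rewrite invr_gt0.
  have rq i : exists q : rat, `|ratr q - x 0 i| < k.+1%:R^-1.
    have : x 0 i - k.+1%:R^-1 < x 0 i + k.+1%:R^-1 by rewrite ltrD2l (lt_trans _ k0)// oppr_lt0.
    move=> /rat_in_itvoo[q]; rewrite in_itv /= => /andP[q1 q2].
    by exists q; rewrite ltr_norml ltrBrDl q1 ltrBlDl q2.
  exists (\row_i (sval (cid (rq i))), k); last first.
    by move=> i /=; rewrite mxE; exact: (svalP (cid (rq i))).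
  move=> y /= By; apply: eA; apply/rV_ballP => // i.
  have := By i; rewrite /= mxE; case: cid => q /= qx qy.
  apply: le_lt_trans ke; rewrite mulr2n mulrDl mul1r.
  have -> : x 0 i - y 0 i = (ratr q - y 0 i) - (ratr q - x 0 i) by ring.
  by apply: le_trans (ler_normB _ _) _; rewrite lerD// ltW.
rewrite bigcup_mkcond; apply: countable_bigcupT_measurable => [|p].
  exact: countableP.
case: ifPn => // _.
rewrite (_ : B p = \bigcap_(i in [set: 'I_n])
   (rV_coord i @^-1` (ball (ratr (p.1 0 i) : R) p.2.+1%:R^-1))); last first.
  by apply/seteqP; split => x /= => [H i _|H i]; exact: H.
apply: fin_bigcap_measurable => // i _.
rewrite -[X in measurable X]setTI; apply: measurable_rV_coord => //.
apply: open_measurable; exact: ball_open.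
Qed.

Lemma measurable_fun_continuous_on (U : set 'rV[R]_n) (f : 'rV[R]_n -> R) :
  open U -> {in U, continuous f} -> measurable_fun U f.
Proof.
move=> oU cf mU; apply: (measurability _ (RGenOpens.measurableE R)).
move=> _ [_ [a [b ->] <-]]; apply: open_measurable_rV.
rewrite openE => x [Ux fx]; rewrite /interior.
near=> y; split; first by near: y; exact: open_nbhs_nbhs.
by near: y; apply: (cf x); rewrite ?inE//; exact: open_nbhs_nbhs.
Unshelve. all: by end_near. Qed.

(** The integrands are continuous off the origin only; a single point is closed, hence measurable,
    and may carry any value. *)
Lemma measurable_fun_continuous_off0 (f : 'rV[R]_n -> R) :
  (forall x : 'rV[R]_n, x != 0 -> {for x, continuous f}) -> measurable_fun setT f.
Proof.
move=> cf.
have m0 : measurable [set (0 : 'rV[R]_n)].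
  rewrite -[X in measurable X]setCK; apply: measurableC; apply: open_measurable_rV.
  by rewrite openC; exact/accessible_closed_set1/hausdorff_accessible/norm_hausdorff.
rewrite -(setUv [set (0 : 'rV[R]_n)]); apply/measurable_funU => //; first exact: measurableC.
split; first exact: measurable_fun_set1.
apply: measurable_fun_continuous_on.
  by rewrite openC; exact/accessible_closed_set1/hausdorff_accessible/norm_hausdorff.
by move=> x; rewrite inE => /eqP; exact: cf.
Qed.

End measurability_rV.

Section fubini_rV.
Context {R : realType}.
Local Open Scope ereal_scope.

Lemma ge0_integral_rVS n (f : 'rV[R]_n.+1 -> \bar R) :
  measurable_fun setT f -> (forall x, 0 <= f x) ->
  \int[lebesgue_rV n.+1]_x f x =
  \int[lebesgue_measure]_t \int[lebesgue_rV n]_y f (rV_cons (t, y)).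
Proof.
move=> mf f0.
have := ge0_integral_pushforward (@measurable_rV_cons R n)
  (lebesgue_measure \x lebesgue_rV n)%E measurableT mf (fun y _ => f0 y).
rewrite preimage_setT => fE.
transitivity (\int[(lebesgue_measure \x lebesgue_rV n)%E]_z f (rV_cons z)).
  rewrite -[RHS]fE.
  apply: eq_measure_integral; first exact: measurable_rV_cons.
  by move=> mc A mA _.
rewrite fubini_tonelli1//.
by apply: measurableT_comp => //; exact: measurable_rV_cons.
Qed.

Lemma integrable_rVS n (f : 'rV[R]_n.+1 -> \bar R) :
  (lebesgue_rV n.+1).-integrable setT f ->
  (lebesgue_measure \x lebesgue_rV n).-integrable setT (fun z => f (rV_cons z)).
Proof.
move=> /integrableP[mf foo]; apply/integrableP; split.
  by apply: measurableT_comp => //; exact: measurable_rV_cons.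
rewrite fubini_tonelli1//=.
- have := ge0_integral_rVS _ (fun x => `|f x|) (measurableT_comp (@abse_measurable _ _) mf) (fun x => abse_ge0 _).
  by move=> <-.
- apply: measurableT_comp => //.
  by apply: measurableT_comp => //; exact: measurable_rV_cons.
Qed.

Lemma integral_rVS n (f : 'rV[R]_n.+1 -> \bar R) :
  (lebesgue_rV n.+1).-integrable setT f ->
  \int[lebesgue_rV n.+1]_x f x =
  \int[lebesgue_measure]_t \int[lebesgue_rV n]_y f (rV_cons (t, y)).
Proof.
move=> fi; have mf : measurable_fun setT f by case/integrableP : fi.
rewrite integralE ge0_integral_rVS//; last exact: measurable_funepos.
rewrite ge0_integral_rVS//; last exact: measurable_funeneg.
have fi' := integrable_rVS _ _ fi.
have mf' : measurable_fun setT (fun z => f (@rV_cons R n z)) by case/integrableP : fi'.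
transitivity (\int[(lebesgue_measure \x lebesgue_rV n)%E]_z f (rV_cons z)); last first.
  by rewrite -(integral12_prod_meas1 fi').
rewrite [RHS]integralE !fubini_tonelli1//.
- by congr (_ - _); apply: eq_integral => t _; apply: eq_integral => y _; rewrite ?funeposE ?funenegE.
- exact: measurable_funeneg.
- exact: measurable_funepos.
Qed.

End fubini_rV.

(** * Integrals of products of one-variable functions *)

Section product_integrable.
Context {R : realType}.
Local Open Scope ereal_scope.

Lemma measurable_rV_prod n (g : nat -> R -> R) :
  (forall k, measurable_fun setT (g k)) ->
  measurable_fun setT (fun x : 'rV[R]_n => \prod_(i < n) g i (x ord0 i))%R.
Proof.
move=> mg; apply: measurable_prod => i _.
by apply: (measurableT_comp (mg i)); exact: (measurable_rV_coord i).
Qed.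

(** The factors are indexed by [nat] rather than ['I_n], so that the induction can pass to the
    shifted family. Null hyperplanes, boxes of positive volume and integrable product weights all
    come from this formula. *)
Lemma ge0_integral_rV_prod n (g : nat -> R -> R) :
  (forall k, measurable_fun setT (g k)) -> (forall k t, 0 <= g k t)%R ->
  \int[lebesgue_rV n]_x (\prod_(i < n) g i (x ord0 i))%:E =
  \prod_(i < n) \int[lebesgue_measure]_t (g i t)%:E.
Proof.
elim: n g => [|n IH] g mg g0.
  rewrite big_ord0 /= integral_dirac// ?diracT ?mul1e ?big_ord0//.
  by apply/measurable_EFinP; exact: measurable_rV_prod.
have mg' k : measurable_fun setT (g k.+1) by exact: mg.
rewrite ge0_integral_rVS//.
- rewrite big_ord_recl [X in _ * X](_ : _ = \int[lebesgue_rV n]_x (\prod_(i < n) g i.+1 (x ord0 i))%:E); last first.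
    by rewrite (IH (fun k => g k.+1)).
  
  have E t : \int[lebesgue_rV n]_y (\prod_(i < n.+1) g i ((@rV_cons R n (t, y)) ord0 i))%:E =
     (g 0%N t)%:E * \int[lebesgue_rV n]_y (\prod_(i < n) g i.+1 (y ord0 i))%:E.
    rewrite -ge0_integralZl//.
    + apply: eq_integral => y _; rewrite big_ord_recl EFinM.
      have rE := rV_consK (t, y).
      congr (_ * _); first by congr (g _ _)%:E; have /(congr1 fst) := rE.
      congr _%:E; apply: eq_bigr => i _; congr (g _ _).
      by have /(congr1 snd) /= := rE => /rowP /(_ i); rewrite mxE.
    + by apply/measurable_EFinP; exact: (measurable_rV_prod _ (g \o S)).
    + by move=> y _; rewrite lee_fin prodr_ge0.
    + by rewrite lee_fin.
  under eq_integral do rewrite E.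
  rewrite ge0_integralZr//.
  + by apply/measurable_EFinP; exact: mg.
  + by move=> t _; rewrite lee_fin.
  + by apply: integral_ge0 => y _; rewrite lee_fin prodr_ge0.
- by apply/measurable_EFinP; exact: measurable_rV_prod.
- by move=> x; rewrite lee_fin prodr_ge0.
Qed.

Lemma rV_coord0_negligible n (i : 'I_n) :
  (lebesgue_rV n).-negligible [set x : 'rV[R]_n | x ord0 i = 0%R].
Proof.
pose g (k : nat) (t : R) : R := if k == i then \1_[set 0%R] t else 1%R.
have mg k : measurable_fun setT (g k).
  rewrite /g; case: eqP => _; first by apply: measurable_indic; exact: measurable_set1.
  exact: measurable_cst.
have g0 k t : (0 <= g k t)%R by rewrite /g; case: eqP.
have mA : measurable [set x : 'rV[R]_n | x ord0 i = 0%R].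
  by rewrite -[X in measurable X]setTI; exact: (measurable_rV_coord i measurableT (measurable_set1 0%R)).
apply/negligibleP => //.
transitivity (\int[lebesgue_rV n]_x (\1_[set x : 'rV[R]_n | x ord0 i = 0%R] x)%:E).
  by rewrite integral_indic// setIT.
under eq_integral => x _.
  rewrite (_ : \1_ _ x = \prod_(k < n) g k (x ord0 k))%R; last first.
    rewrite (bigD1 i)//= big1 ?mulr1; last first.
      by move=> j ji; rewrite /g ifF//; exact/negbTE.
    by rewrite /g eqxx !indicE; congr (_%:R); congr nat_of_bool; apply/idP/idP; rewrite !inE.
  over.
rewrite ge0_integral_rV_prod// (bigD1 i)//=.
(* The other factors integrate to [+oo]; the convention 0 * +oo = 0 of the extended reals makes the
   product vanish all the same. *)
rewrite [X in X * _](_ : _ = 0) ?mul0e//.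
rewrite /g eqxx integral_indic// setIT; exact: lebesgue_measure_set1.
Qed.

Lemma ae_rV_coord_neq0 n :
  {ae lebesgue_rV n, forall x : 'rV[R]_n, forall i, x ord0 i != 0%R}.
Proof.
apply: (@negligibleS _ _ _ _ (\big[setU/set0]_(i < n) [set x : 'rV[R]_n | x ord0 i = 0%R])).
  move=> x /= /existsNP[i /negP]; rewrite negbK => /eqP xi.
  by rewrite -bigcup_seq; exists i => //=; rewrite mem_index_enum.
elim/big_ind: _ => //; first exact: negligible_set0.
- by move=> A B; exact: negligibleU.
- by move=> i _; exact: rV_coord0_negligible.
Qed.

(** A ball for the sup norm is a box, so its indicator is a product. This is what prevents a nonzero
    continuous function from vanishing almost everywhere. *)
Lemma lebesgue_rV_box_gt0 n (x : 'rV[R]_n) (e : R) : (0 < e)%R ->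
  0 < lebesgue_rV n (ball x e).
Proof.
move=> e0.
pose xk (k : nat) : R := if insub k is Some i then x ord0 i else 0%R.
pose g (k : nat) : R -> R := \1_(ball (xk k) e).
have mb k : measurable (ball (xk k) e) by apply: open_measurable; exact: ball_open.
have mg k : measurable_fun setT (g k) by exact: measurable_indic.
have mB : measurable (ball x e) by apply: open_measurable_rV; exact: ball_open.
rewrite (_ : lebesgue_rV n _ = \int[lebesgue_rV n]_y (\1_(ball x e) y)%:E); last first.
  by rewrite integral_indic// setIT.
under eq_integral => y _.
  rewrite (_ : \1_ _ y = \prod_(k < n) g k (y ord0 k))%R; last first.
    rewrite indicE; have [xy|xy] := pselect (ball x e y).
      rewrite mem_set// big1// => i _.
      by rewrite /g indicE mem_set//= /ball/= /xk valK; exact: ((rV_ballP _ _ _ e0).1 xy).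
    rewrite memNset//; have /existsNP[i iy] := contra_not (rV_ballP _ _ _ e0).2 xy.
    rewrite (bigD1 i)//= /g indicE memNset ?mul0r//= /ball/= /xk valK.
    exact: iy.
  over.
rewrite ge0_integral_rV_prod//.
apply: (big_ind (fun z : \bar R => 0 < z)) => //; first by move=> *; exact: mule_gt0.
move=> i _; rewrite /g integral_indic//; last exact: mb.
rewrite [X in _ < X](_ : _ = (e *+ 2)%:E) ?lte_fin ?pmulrn_rgt0//.
by rewrite -(lebesgue_measure_ball (xk i) (ltW e0)) -[in RHS](setIT (ball (xk i) e)).
Qed.

End product_integrable.

(** * Integrability of |x|^-4 at the origin *)

Section singular_weight.
Context {R : realType}.
Local Open Scope ereal_scope.

(** On each interval from 1 / (k + 1) to M, the value at M of the primitive t^(1 - al) / (1 - al)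
    bounds the integral, uniformly in k. Monotone convergence reaches 0, and evenness of the
    integrand gives the negative half-line. *)
Lemma integral_powRN_lty (al M : R) : (0 < al < 1)%R -> (0 < M)%R ->
  \int[lebesgue_measure]_t ((if `|t| <= M then `|t| `^ (- al) else 0)%R)%:E < +oo.
Proof.
move=> /andP[al0 al1] M0.
pose g (t : R) : R := (if `|t| <= M then `|t| `^ (- al) else 0)%R.
have g0 t : (0 <= g t)%R by rewrite /g; case: ifP => // _; exact: powR_ge0.
have mg : measurable_fun setT g.
  apply: measurable_fun_ifT => //.
    apply: measurable_fun_ler => //; exact: normr_measurable.
  by apply: (measurableT_comp (measurable_powR _)); exact: normr_measurable.
have meg D : measurable_fun D (fun t => (g t)%:E).
  by apply/measurable_EFinP; exact: measurable_funTS.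
have ge t : g (- t)%R = g t by rewrite /g normrN.
have al10 : (0 < 1 - al)%R by rewrite subr_gt0.
pose F (t : R) : R := (t `^ (1 - al) / (1 - al))%R.
have Hk (k : nat) : \int[lebesgue_measure]_(t in `[k.+1%:R^-1%R, M]) (g t)%:E <= (F M)%:E.
  have k0 : (0 < k.+1%:R^-1 :> R)%R by rewrite invr_gt0.
  have F0 t : (0 <= F t)%R by rewrite divr_ge0 ?powR_ge0// ltW.
  have [kM|Mk] := ltP (k.+1%:R^-1)%R M; last first.
    rewrite le_eqVlt in Mk; case/orP: Mk => [/eqP ->|Mk].
      by rewrite set_itv1 integral_set1 lee_fin.
    by rewrite set_itv_ge ?bnd_simp -?ltNge// integral_set0 lee_fin.
  have cont (p : R) (x : R) : (0 < x)%R -> {for x, continuous (fun t : R => t `^ p)%R}.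
    move=> x0; apply: differentiable_continuous; apply/derivable1_diffP.
    by apply: derivable_powR; rewrite in_itv/= andbT.
  have dF (x : R) : (0 < x)%R -> derivable F x 1%R /\ derive1 F x = (x `^ (- al))%R.
    move=> x0; have dp : derivable (fun t : R => t `^ (1 - al))%R x 1%R.
      by apply: derivable_powR; rewrite in_itv/= andbT.
    split; first by apply: derivableM.
    rewrite /F derive1Mr// powR_derive1 ?in_itv/= ?x0// addrAC subrr add0r.
    by rewrite mulrC mulrA mulVf ?mul1r// gt_eqF.
  rewrite [leLHS](_ : _ = \int[lebesgue_measure]_(t in `[k.+1%:R^-1%R, M]) (t `^ (- al))%R%:E); last first.
    apply: eq_integral => t; rewrite inE/= in_itv/= => /andP[t1 t2].
    have t0 : (0 < t)%R by exact: lt_le_trans t1.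
    by rewrite /g gtr0_norm// t2.
  have cF (x : R) : (0 < x)%R -> {for x, continuous F}.
    by move=> x0; apply: differentiable_continuous; apply/derivable1_diffP; exact: (dF x x0).1.
  rewrite (@continuous_FTC2 _ _ F)//.
  - by rewrite -EFinB lee_fin lerBlDr lerDl.
  - apply: continuous_in_subspaceT => x; rewrite inE/= in_itv/= => /andP[x1 _].
    by apply: cont; exact: lt_le_trans x1.
  - split.
    + by move=> x; rewrite in_itv/= => /andP[x1 _]; apply: (dF x _).1; exact: lt_trans x1.
    + by apply: cvg_at_right_filter; apply: cF.
    + by apply: cvg_at_left_filter; apply: cF.
  - by move=> x; rewrite in_itv/= => /andP[x1 _]; rewrite (dF x _).2//; exact: lt_trans x1.
have Hpos : \int[lebesgue_measure]_(t in `[0%R, +oo[) (g t)%:E <= (F M)%:E.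
  have -> : \int[lebesgue_measure]_(t in `[0%R, +oo[) (g t)%:E =
     \int[lebesgue_measure]_(t in \bigcup_k `[k.+1%:R^-1%R, M]%classic) (g t)%:E.
    rewrite [LHS]integral_mkcond [RHS]integral_mkcond; apply: eq_integral => t _.
    rewrite !patchE; case: ifPn => [|/negP].
      rewrite inE/= in_itv/= andbT le_eqVlt => /orP[/eqP <-|t0].
        (* A negative power of 0 is 0 by convention, so the point 0, absent from the union of
           intervals, contributes to neither side. *)
        rewrite (_ : g 0%R = 0%R); first by case: ifP.
        by rewrite /g normr0 (ltW M0) powR0// oppr_eq0 gt_eqF.
      case: ifPn => // /negP nt.
      rewrite /g gtr0_norm//; case: ifPn => // tM.
      exfalso; have [k _ /(_ k (leqnn k))/= kt] := near_infty_natSinv_lt (PosNum t0).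
      by apply: nt; rewrite inE; exists k => //=; rewrite in_itv/= tM ltW.
    rewrite inE/= in_itv/= andbT => t0.
    rewrite ifF//; apply/negP; rewrite inE => -[k _] /=; rewrite in_itv/= => /andP[kt _].
    by apply: t0; apply: le_trans kt; rewrite invr_ge0.
  have nd : nondecreasing_seq (fun k : nat => `[k.+1%:R^-1%R, M]%classic : set R).
    move=> m n mn; rewrite subsetEset => t /=; rewrite !in_itv/= => /andP[mt ->].
    rewrite andbT (le_trans _ mt)// lef_pV2 ?posrE//.
    by rewrite ler_nat.
  have mI (k : nat) : measurable (`[k.+1%:R^-1%R, M]%classic : set (measurableTypeR R)).
    exact: measurable_itv.
  have gI (k : nat) (x : R) : `[k.+1%:R^-1%R, M]%classic x -> 0 <= (g x)%:E.
    by rewrite lee_fin.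
  have := @ge0_nondecreasing_set_cvg_integral _ _ _ _ _ (@lebesgue_measure R) nd mI
    (fun k => meg _) gI.
  move=> /cvg_lim <-//; apply: lime_le; last by near=> k; exact: Hk.
  apply: ereal_nondecreasing_is_cvgn.
  exact: (@ge0_nondecreasing_set_nondecreasing_integral _ _ _ _ _ (@lebesgue_measure R) nd mI
    (fun k => meg _) gI).
have Hneg : \int[lebesgue_measure]_(t in `]-oo, 0%R]) (g t)%:E <= (F M)%:E.
  under eq_integral do rewrite -ge.
  rewrite -(@ge0_integration_by_substitution0 _ (fun t => (g t)%:E))//.
rewrite -/g -(setUv `]-oo, 0%R]%classic) .
have mN : measurable (~` `]-oo, 0%R] : set (measurableTypeR R)).
  by apply: measurableC; exact: measurable_itv.
have dN : [disjoint `]-oo, 0%R]%classic & ~` (`]-oo, 0%R]%classic : set R)].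
  by apply/disj_setPCl.
have gN (x : measurableTypeR R) : (`]-oo, 0%R] `|` ~` `]-oo, 0%R]) x -> 0 <= (g x)%:E.
  by rewrite lee_fin.
rewrite (@ge0_integral_setU _ _ _ _ _ _ _ mN (fun t => (g t)%:E) (meg _) gN dN)//.
apply: lte_add_pinfty; first exact: le_lt_trans Hneg (ltry _).
rewrite setCitvl; apply: le_lt_trans _ (ltry (F M)); apply: le_trans Hpos.
apply: ge0_subset_integral.
- exact: measurable_itv.
- exact: measurable_itv.
- exact: meg.
- by move=> x _; rewrite lee_fin; exact: g0.
- by apply: subset_itvr; rewrite bnd_simp.
Unshelve. all: by end_near. Qed.

Lemma ler_coord_enorm n (x : 'rV[R]_n) (i : 'I_n) : (`|x ord0 i| <= enorm x)%R.
Proof.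
rewrite /enorm -sqrtr_sqr ler_sqrt; last by apply: sumr_ge0 => j _; exact: sqr_ge0.
by rewrite (bigD1 i)//= lerDl; apply: sumr_ge0 => j _; exact: sqr_ge0.
Qed.

(** Every |x_i| is at most |x|, so |x|^-4, the product of n factors |x|^(-4/n), is at most the
    product of the |x_i|^(-4/n). The exponent 4/n is below 1 exactly when n >= 5, and each factor,
    truncated at M, is then integrable on the line. *)
Lemma integrable_enormN4 n (f : 'rV[R]_n -> R) (C M : R) :
  (5 <= n)%N -> (0 < M)%R -> measurable_fun setT f ->
  (forall x, (M < enorm x)%R -> f x = 0%R) ->
  (forall x, x != 0%R -> `|f x| <= C * (enorm x ^+ 4)^-1)%R ->
  (lebesgue_rV n).-integrable setT (fun x => (f x)%:E).
Proof.
move=> n5 M0 mf f0 fC.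
have n0 : (0 < n%:R :> R)%R by rewrite ltr0n (leq_trans _ n5).
pose al : R := (4 / n%:R)%R.
have al01 : (0 < al < 1)%R.
  by rewrite /al divr_gt0// ltr_pdivrMr// mul1r ltr_nat.
pose g (k : nat) (t : R) : R := (if `|t| <= M then `|t| `^ (- al) else 0)%R.
have g0 k t : (0 <= g k t)%R by rewrite /g; case: ifP => // _; exact: powR_ge0.
have mg k : measurable_fun setT (g k).
  apply: measurable_fun_ifT => //.
    apply: measurable_fun_ler => //; exact: normr_measurable.
  by apply: (measurableT_comp (measurable_powR _)); exact: normr_measurable.
have mP := measurable_rV_prod n g mg.
pose P (x : 'rV[R]_n) : R := (\prod_(i < n) g i (x ord0 i))%R.
have mF : measurable_fun setT (fun x => (f x)%:E) by apply/measurable_EFinP.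
have P0 x : (0 <= P x)%R by exact: prodr_ge0.
have key (x : 'rV[R]_n) : (forall i, x ord0 i != 0%R) -> (`|f x| <= `|C| * P x)%R.
  move=> x0; have [xM|xM] := ltP M (enorm x).
    by rewrite f0// normr0 mulr_ge0.
  have i0 : 'I_n by exact: (Ordinal (leq_trans (isT : 0 < 5)%N n5)).
  have r0 : (0 < enorm x)%R.
    by apply: lt_le_trans (ler_coord_enorm n x i0); rewrite normr_gt0.
  have xn0 : x != 0%R.
    by apply/eqP => xE; move: (x0 i0); rewrite xE mxE eqxx.
  apply: le_trans (fC x xn0) _.
  apply: (@le_trans _ _ (`|C| * (enorm x ^+ 4)^-1)%R).
    by apply: ler_wpM2r; [rewrite invr_ge0 exprn_ge0// ltW|exact: ler_norm].
  apply: ler_wpM2l => //.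
  have -> : ((enorm x ^+ 4)^-1 = \prod_(i < n) enorm x `^ (- al))%R.
    rewrite prodr_const card_ord -[RHS]powR_mulrn ?powR_ge0// -powRrM.
    have -> : (- al * n%:R = - 4%:R)%R by rewrite mulNr /al divfK// gt_eqF.
    by rewrite powR_invn// ltW.
  apply: ler_prod => i _; rewrite powR_ge0/= /g.
  have xi := ler_coord_enorm n x i.
  rewrite (le_trans xi xM) !powRN lef_pV2 ?posrE ?powR_gt0 ?normr_gt0//.
  apply: ge0_ler_powR => //; rewrite ?nnegrE//; last exact: ltW.
  by case/andP: al01 => /ltW.
apply/integrableP; split => //.
apply: (@le_lt_trans _ _ (\int[lebesgue_rV n]_x (`|C|%:E * (P x)%:E))).
  apply: ae_ge0_le_integral => //.
  - exact: measurableT_comp.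
  - by move=> x _; rewrite mule_ge0// lee_fin.
  - by apply: measurable_funeM; apply/measurable_EFinP.
  (* On the coordinate hyperplanes the convention on powers of 0 makes [P] vanish, so it need not
     dominate there; they are negligible. *)
  - have := ae_rV_coord_neq0 (R := R) n; apply: filterS => x x0 _.
    by rewrite -EFinM/= lee_fin; exact: key.
rewrite ge0_integralZl//; last 2 first.
- by apply/measurable_EFinP.
- by move=> x _; rewrite lee_fin.
apply: lte_mul_pinfty => //.
rewrite ge0_integral_rV_prod//.
suff /andP[_ ]: 0 <= \prod_(i < n) \int[lebesgue_measure]_t (g i t)%:E < +oo by [].
apply: (big_ind (fun z : \bar R => 0 <= z < +oo)).
- by rewrite lee01 ltry.
- move=> y z /andP[y0 yoo] /andP[z0 zoo]; rewrite mule_ge0//=.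
  by apply: lte_mul_pinfty => //; rewrite ge0_fin_numE.
- by move=> i _; rewrite integral_ge0 ?integral_powRN_lty// => x _; rewrite lee_fin.
Qed.

End singular_weight.

(** * Integration of a partial derivative along coordinate lines *)

Section line_integral.
Context {R : realType}.

Definition set_coord n (x : 'rV[R]_n) (i : 'I_n) (t : R) : 'rV[R]_n :=
  \row_j (if j == i then t else x ord0 j).

Lemma rV_consE0 n (t : R) (y : 'rV[R]_n) : (rV_cons (t, y)) ord0 ord0 = t.
Proof. by have /(congr1 fst) := rV_consK (t, y). Qed.

Lemma rV_consES n (t : R) (y : 'rV[R]_n) k : (rV_cons (t, y)) ord0 (lift ord0 k) = y ord0 k.
Proof. by have /(congr1 snd) /= /rowP /(_ k) := rV_consK (t, y); rewrite mxE. Qed.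

Lemma set_coord_cons0 n (t s : R) (y : 'rV[R]_n) :
  set_coord n.+1 (rV_cons (s, y)) ord0 t = rV_cons (t, y).
Proof.
apply/rowP => j; rewrite [LHS]mxE; case: (unliftP ord0 j) => [k ->|->].
  by rewrite lift_eqF !rV_consES.
by rewrite eqxx rV_consE0.
Qed.

Lemma set_coord_consS n (t s : R) (y : 'rV[R]_n) (i : 'I_n) :
  set_coord n.+1 (rV_cons (s, y)) (lift ord0 i) t = rV_cons (s, set_coord n y i t).
Proof.
apply/rowP => j; rewrite [LHS]mxE; case: (unliftP ord0 j) => [k ->|->].
  by rewrite !rV_consES (inj_eq (@lift_inj _ ord0)) [RHS]mxE.
by rewrite eq_liftF !rV_consE0.
Qed.

(** Fubini by induction on the dimension, arranged so that coordinate [i] is integrated innermost.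
    The line condition is restricted to nonzero fixed coordinates, which almost every line has; this
    is what tolerates a singularity at the origin. *)
Lemma integral_rV_line0 n (i : 'I_n) (f : 'rV[R]_n -> \bar R) :
  (lebesgue_rV n).-integrable setT f ->
  (forall x : 'rV[R]_n, (forall j, j != i -> x ord0 j != 0%R) ->
    \int[lebesgue_measure]_t f (set_coord n x i t) = 0)%E ->
  (\int[lebesgue_rV n]_x f x = 0)%E.
Proof.
elim: n i f => [[]//|n IH] i f fi line0.
have fi' := integrable_rVS _ _ fi.
rewrite integral_rVS//.
case: (unliftP ord0 i) => [k ik|i0].
  transitivity (\int[@lebesgue_measure R]_t (cst 0 t))%E; last by rewrite integral_cst// mul0e.
  apply: ae_eq_integral => //.
  - exact: (measurable_fubini_F fi').
  (* Two kinds of slices are discarded: [t = 0], where a fixed coordinate would be zero and [line0]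
     says nothing, and those on which [f] is not integrable. *)
  - have N0 : (@lebesgue_measure R).-negligible [set 0%R].
      by exists [set 0%R]; split; [exact: measurable_set1|exact: lebesgue_measure_set1|].
    apply: (negligibleS _ (negligibleU N0 (ae_integrable1 fi'))) => t /= nP.
    have [->|t0] := eqVneq t 0%R; [by left|right => ft; apply: nP => _].
    apply: (IH k) => // y y0.
    have := line0 (rV_cons (t, y)); rewrite ik.
    under eq_integral do rewrite set_coord_consS.
    apply=> j; case: (unliftP ord0 j) => [l ->|->]; last by rewrite rV_consE0.
    by rewrite (inj_eq (@lift_inj _ ord0)) rV_consES; exact: y0.
(* For the first coordinate the order of integration is exchanged, so that the line integral becomes
   the inner one. *)
rewrite (Fubini fi').
transitivity (\int[lebesgue_rV n]_y (@cst 'rV[R]_n (\bar R) 0%E y))%E; last by rewrite integral_cst// mul0e.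
apply: ae_eq_integral => //.
- exact: (measurable_fubini_G fi').
- have := ae_rV_coord_neq0 (R := R) n; apply: filterS => y y0 _ /=.
  have := line0 (rV_cons (0, y)); rewrite i0.
  under eq_integral do rewrite set_coord_cons0.
  apply=> j; case: (unliftP ord0 j) => [l -> _|->]; last by rewrite eqxx.
  by rewrite rV_consES.
Qed.

Lemma set_coord_shift n (x : 'rV[R]_n) i (t h : R) :
  set_coord n x i (h + t) = h *: delta_mx 0 i + set_coord n x i t.
Proof.
apply/rowP => j; rewrite !mxE eqxx /=; case: eqP => _; rewrite ?mulr1 ?mulr0 ?add0r//.
Qed.

Lemma is_derive_line n (x : 'rV[R]_n) i (t : R) (f : 'rV[R]_n -> R) (d : R) :
  is_derive (set_coord n x i t) (delta_mx 0 i) f d <->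
  is_derive t 1 (fun s => f (set_coord n x i s)) d.
Proof.
have E : (fun h : R => h^-1 *: ((fun s => f (set_coord n x i s)) (h *: (1 : R) + t) -
      f (set_coord n x i t))) =
  (fun h : R => h^-1 *: (f (h *: delta_mx 0 i + set_coord n x i t) - f (set_coord n x i t))).
  by apply/funext => h; rewrite -set_coord_shift [h *: (1 : R)]mulr1.
by split=> -[fd fE]; (split; [move: fd; rewrite /derivable|move: fE; rewrite /derive]); rewrite E.
Qed.

Lemma continuous_set_coord n (x : 'rV[R]_n) i : continuous (set_coord n x i).
Proof.
move=> t A /nbhs_ballP[e /= e0 eA]; apply/nbhs_ballP; exists e => //= s ts.
apply: eA; apply/rV_ballP => // j; rewrite !mxE; case: ifP => // _.
by rewrite subrr normr0.
Qed.

(** As [1 < n], a line parallel to axis [i] has a fixed coordinate; when the fixed coordinates are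
    nonzero it misses the origin. There [f] is continuously differentiable along the line, and the
    fundamental theorem applies between two points where [f] vanishes. *)
Lemma integral_partial0 n (i : 'I_n) (f df : 'rV[R]_n -> R) (M : R) :
  (1 < n)%N -> 0 < M ->
  (forall x : 'rV[R]_n, x != 0 -> is_derive x (delta_mx 0 i) f (df x)) ->
  (forall x : 'rV[R]_n, x != 0 -> {for x, continuous df}) ->
  (forall x, M < enorm x -> f x = 0) ->
  (forall x, M < enorm x -> df x = 0) ->
  (lebesgue_rV n).-integrable setT (fun x => (df x)%:E) ->
  (\int[lebesgue_rV n]_x (df x)%:E = 0)%E.
Proof.
move=> n1 M0 fdf cdf f0 df0 dfi; apply: (integral_rV_line0 _ i) => // x x0.
have x0t t : set_coord n x i t != 0.
  have [j ji] : exists j : 'I_n, j != i.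
    have := n1; rewrite -[n in (_ < n)%N]card_ord => /card_gt1P[a [b [_ _ ab]]].
    by have [ai|] := eqVneq a i; [exists b; rewrite -ai eq_sym|exists a].
  apply/eqP => /rowP /(_ j); rewrite !mxE (negbTE ji) => /eqP.
  by rewrite (negbTE (x0 j ji)).
have big (t : R) : M < `|t| -> M < enorm (set_coord n x i t).
  move=> Mt; apply: lt_le_trans Mt _.
  by apply: le_trans (ler_coord_enorm n _ i); rewrite mxE eqxx.
pose g (t : R) : R := f (set_coord n x i t).
pose dg (t : R) : R := df (set_coord n x i t).
have gdg (t : R) : is_derive t (1 : R) g (dg t) by apply/is_derive_line; exact: fdf.
have cdg : continuous dg.
  by move=> t; apply: continuous_comp; [exact: continuous_set_coord|exact: cdf].
have cg : continuous g.
  by move=> t; apply: differentiable_continuous; apply/derivable1_diffP.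
(* The hypotheses give [f = 0] only strictly beyond [M], so the endpoints are moved out by 1. *)
pose K := M + 1.
have MK : M < `|K| by rewrite gtr0_norm /K; lra.
transitivity (\int[lebesgue_measure]_(t in `[(- K)%R, K%R]) (dg t)%:E)%E.
  rewrite [RHS]integral_mkcond; apply: eq_integral => t _; rewrite patchE.
  case: ifPn => // /negP; rewrite inE/= in_itv/= => tK.
  rewrite df0//; apply: big; rewrite ltNge; apply/negP => tM.
  by apply: tK; rewrite -ler_norml (le_trans tM)// /K; lra.
rewrite (@continuous_FTC2 _ dg g).
- by rewrite /g !f0 ?subee//; apply: big; rewrite ?normrN.
- rewrite /K; lra.
- exact: continuous_subspaceT.
- split.
  + by move=> t _; exact: ex_derive.
  + by apply: cvg_at_right_filter; apply: cg.
  + by apply: cvg_at_left_filter; apply: cg.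
- by move=> t _; rewrite derive1E; exact: derive_val.
Qed.

End line_integral.

(** * C^k functions, smooth bumps and symmetry of second derivatives *)

Section Ck_general.
Context {R : realType} {E : normedModType R} {I : Type} (e : I -> E).
Implicit Types (U V : set E) (f g : E -> R).

(** One definition serves the line, with the single direction 1, and R^n, with the coordinate
    directions. The set [U] is there because the functions at hand are smooth only off the origin,
    or only for s < 0. *)
Fixpoint Ck (k : nat) U f : Prop :=
  (forall x, U x -> {for x, continuous f}) /\
  match k with
  | 0 => True
  | k'.+1 => forall i, (forall x, U x -> derivable f x (e i)) /\ Ck k' U (fun x => 'D_(e i) f x)
  end.

Lemma CkS k U f : Ck k.+1 U f -> Ck k U f.
Proof.
elim: k f => [|k IH] f [cf df]; first by split.
by split => // i; have [dfi Cdfi] := df i; split => //; exact: IH.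
Qed.

Lemma Ck_subset k U V f : V `<=` U -> Ck k U f -> Ck k V f.
Proof.
move=> VU; elim: k f => [|k IH] f [cf df]; split => //; try by move=> x /VU; exact: cf.
by move=> i; have [dfi Cdfi] := df i; split; [move=> x /VU; exact: dfi|exact: IH].
Qed.

Lemma Ck_setU k U V f : Ck k U f -> Ck k V f -> Ck k (U `|` V) f.
Proof.
elim: k f => [|k IH] f [cf df] [cf' df']; split => //; try by move=> x [/cf|/cf'].
move=> i; have [dfi Cdfi] := df i; have [dfi' Cdfi'] := df' i.
by split; [move=> x [/dfi|/dfi']|exact: IH].
Qed.

Lemma Ck_eq k U f g : open U -> (forall x, U x -> f x = g x) -> Ck k U f -> Ck k U g.
Proof.
move=> oU; have near_eq h h' : (forall x, U x -> h x = h' x) -> forall x, U x -> \near x, h x = h' x.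
  by move=> hh' x Ux; near=> y; apply: hh'; near: y; exact: open_nbhs_nbhs.
have cc h h' : (forall x, U x -> h x = h' x) -> (forall x, U x -> {for x, continuous h}) ->
    forall x, U x -> {for x, continuous h'}.
  move=> hh' ch x Ux; rewrite /prop_for/continuous_at -hh'//.
  by apply: (cvg_trans _ (ch x Ux)); apply: near_eq_cvg; exact: near_eq.
elim: k f g => [|k IH] f g fg [cf df]; split => //; try exact: cc fg cf.
move=> i; have [dfi Cdfi] := df i; split.
  by move=> x Ux; apply: near_eq_derivable (dfi x Ux); exact: near_eq.
by apply: IH Cdfi => x Ux; apply: near_eq_derive; exact: near_eq.
Unshelve. all: by end_near. Qed.

Lemma CkS_is_derive k U f (df : I -> E -> R) : open U ->
  (forall x, U x -> {for x, continuous f}) ->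
  (forall i x, U x -> is_derive x (e i) f (df i x)) ->
  (forall i, Ck k U (df i)) -> Ck k.+1 U f.
Proof.
move=> oU cf fdf Cdf; split => // i; split.
  by move=> x Ux; have [] := fdf i x Ux.
by apply: Ck_eq (Cdf i) => // x Ux; have [_ ->] := fdf i x Ux.
Qed.

Lemma Ck_cst k U (c : R) : open U -> Ck k U (fun=> c).
Proof.
move=> oU; elim: k c => [|k IH] c; first by split => // x _; exact: cvg_cst.
apply: (@CkS_is_derive _ _ _ (fun _ _ => 0)) => //.
by move=> x _; exact: cvg_cst.
Qed.

Lemma CkD k U f g : open U -> Ck k U f -> Ck k U g -> Ck k U (fun x => f x + g x).
Proof.
move=> oU; elim: k f g => [|k IH] f g [cf df] [cg dg].
  by split => // x Ux; apply: cvgD; [exact: cf|exact: cg].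
apply: (@CkS_is_derive _ _ _ (fun i x => 'D_(e i) f x + 'D_(e i) g x)) => //.
- by move=> x Ux; apply: cvgD; [exact: cf|exact: cg].
- move=> i x Ux; apply: is_deriveD; apply/derivableP.
    exact: (df i).1.
  exact: (dg i).1.
- by move=> i; apply: IH; [exact: (df i).2|exact: (dg i).2].
Qed.

Lemma CkM k U f g : open U -> Ck k U f -> Ck k U g -> Ck k U (fun x => f x * g x).
Proof.
move=> oU; elim: k f g => [|k IH] f g Cf Cg.
  by split => // x Ux; apply: cvgM; [exact: Cf.1|exact: Cg.1].
have [cf df] := Cf; have [cg dg] := Cg.
apply: (@CkS_is_derive _ _ _ (fun i x => f x * 'D_(e i) g x + g x * 'D_(e i) f x)) => //.
- by move=> x Ux; apply: cvgM; [exact: cf|exact: cg].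
- move=> i x Ux; apply: is_deriveM; apply/derivableP.
    exact: (df i).1.
  exact: (dg i).1.
- by move=> i; apply: CkD => //; apply: IH; (try exact: CkS);
    [exact: (dg i).2|exact: (df i).2].
Qed.

Lemma Ck_sum k U n (f : 'I_n -> E -> R) : open U ->
  (forall j, Ck k U (f j)) -> Ck k U (fun x => \sum_j f j x).
Proof.
move=> oU Cf; apply: (@Ck_eq _ _ (\sum_j f j)) => //; first by move=> x _; rewrite fct_sumE.
elim/big_ind: _ => //; first exact: Ck_cst.
by move=> g h Cg Ch; exact: CkD.
Qed.

Lemma Ck_prod k U (m n : nat) (f : nat -> E -> R) : open U ->
  (forall j, (m <= j < n)%N -> Ck k U (f j)) -> Ck k U (fun x => \prod_(m <= j < n) f j x).
Proof.
move=> oU; elim: n => [|n IH] Cf.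
  by apply: (Ck_eq _ _ (fun=> 1) _ oU _ (Ck_cst _ _ _ oU)) => x _; rewrite big_geq.
have [mn|nm] := leqP m n; last first.
  by apply: (Ck_eq _ _ (fun=> 1) _ oU _ (Ck_cst _ _ _ oU)) => x _; rewrite big_geq.
apply: (Ck_eq _ _ (fun x => \prod_(m <= j < n) f j x * f n x)) => //.
  by move=> x _; rewrite big_nat_recr.
apply: CkM => //; last by apply: Cf; rewrite mn leqnn.
by apply: IH => j /andP[mj jn]; apply: Cf; rewrite mj (leq_trans jn).
Qed.

(** Only a directional derivative of [g] is given, not a differential; restriction to the line t v +
    x reduces the claim to the chain rule in one variable. *)
Lemma is_derive_comp_dir (f : R -> R) g (x v : E) (a b : R) :
  is_derive (g x) 1 f a -> is_derive x v g b -> is_derive x v (fun y => f (g y)) (a * b).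
Proof.
have line (h : E -> R) d : is_derive x v h d <-> is_derive (0 : R) 1 (fun t => h (t *: v + x)) d.
  have D : (fun s : R => s^-1 *: ((fun t => h (t *: v + x)) (s *: (1 : R) + 0) - h (0 *: v + x))) =
           (fun s : R => s^-1 *: (h (s *: v + x) - h x)).
    by apply/funext => s; rewrite addr0 [s *: (1 : R)]mulr1 scale0r add0r.
  by split=> -[hd hE]; (split; [move: hd; rewrite /derivable|move: hE; rewrite /derive]); rewrite D.
move=> fa /line gb; apply/line; apply: (@is_derive1_comp _ f (fun t => g (t *: v + x))) => //.
by rewrite scale0r add0r.
Qed.

End Ck_general.

Definition C1k {R : realType} (k : nat) (U : set R) (f : R -> R) :=
  @Ck R R unit (fun=> 1) k U f.

Lemma Ck_comp {R : realType} {E : normedModType R} {I : Type} (e : I -> E) k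
    (U : set E) (V : set R) (f : R -> R) (g : E -> R) :
  open U -> open V -> (forall x, U x -> V (g x)) ->
  C1k k V f -> Ck e k U g -> Ck e k U (fun x => f (g x)).
Proof.
move=> oU oV gV; elim: k f => [|k IH] f Cf Cg.
  split => // x Ux; apply: continuous_comp; first exact: Cg.1.
  by apply: Cf.1; exact: gV.
have [cf /(_ tt)[df Cdf]] := Cf; have [cg dg] := Cg.
apply: (@CkS_is_derive _ _ _ _ _ _ _ (fun i x => 'D_1 f (g x) * 'D_(e i) g x)) => //.
- move=> x Ux; apply: continuous_comp; first exact: cg.
  by apply: cf; exact: gV.
- move=> i x Ux; apply: is_derive_comp_dir; apply/derivableP.
    by apply: df; exact: gV.
  exact: (dg i).1.
- move=> i; apply: CkM => //; last exact: (dg i).2.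
  by apply: (IH (fun y => 'D_1 f y)) => //; exact: CkS.
Qed.

Section C1k_examples.
Context {R : realType}.

Lemma C1kS_is_derive k (U : set R) (f df : R -> R) : open U ->
  (forall x, U x -> is_derive x 1 f (df x)) -> C1k k U df -> C1k k.+1 U f.
Proof.
move=> oU fdf Cdf; apply: (@CkS_is_derive _ _ _ _ _ _ _ (fun=> df)) => //.
  by move=> x Ux; apply: differentiable_continuous; apply/derivable1_diffP; have [] := fdf x Ux.
Qed.

Lemma C1k_id k (U : set R) : open U -> C1k k U id.
Proof.
move=> oU; apply: CkS; apply: (@C1kS_is_derive _ _ _ (fun=> 1)) => //.
exact: Ck_cst.
Qed.

Lemma C1k_inv k : C1k k [set x : R | 0 < x] (fun x => x^-1).
Proof.
have o : open [set x : R | 0 < x] by exact: open_gt.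
have D (x : R) : 0 < x -> is_derive x 1 (fun x => x^-1) (- (x^-1 * x^-1)).
  move=> x0; have := @is_deriveV R id x 1 1 (lt0r_neq0 x0) (is_derive_id _ _).
  by rewrite /= [_ *: _]mulr1 -exprVn expr2.
elim: k => [|k IH].
  split => // x x0; apply: differentiable_continuous; apply/derivable1_diffP.
  by have [] := D x x0.
apply: (@C1kS_is_derive _ _ _ (fun x => -1 * (x^-1 * x^-1))) => //.
  by move=> x x0; rewrite mulN1r; exact: D.
apply: CkM => //; [exact: Ck_cst|exact: CkM].
Qed.

Lemma C1k_ln k : C1k k [set x : R | 0 < x] (@ln R).
Proof.
apply: CkS; apply: (@C1kS_is_derive _ _ _ (fun x => x^-1)); first exact: open_gt.
- exact: C1k_inv.
Qed.

Lemma C1k_expR k (U : set R) : open U -> C1k k U (@expR R).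
Proof.
move=> oU; elim: k => [|k IH].
  by split => // x _; exact: continuous_expR.
exact: (@C1kS_is_derive _ _ _ (@expR R)).
Qed.

End C1k_examples.

Section Ck_rV.
Context {R : realType} {n : nat}.

Definition rV_dir (i : 'I_n) : 'rV[R]_n := delta_mx 0 i.

Lemma Ck_smooth (u : 'rV[R]_n -> R) : (forall k, Ck rV_dir k setT u) -> smooth u.
Proof.
move=> Cu s; suff H k : Ck rV_dir k setT (foldr partial u s).
  split; first by move=> x; exact: (H 0%N).1.
  by move=> i x; exact: ((H 1%N).2 i).1.
elim: s k => [|i s IH] k //=; exact: ((IH k.+1).2 i).2.
Qed.

Lemma is_derive_coord (x : 'rV[R]_n) (v : 'rV[R]_n) j :
  is_derive x v (fun y : 'rV[R]_n => y 0 j) (v 0 j).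
Proof.
have E : (fun h : R => h^-1 *: ((h *: v + x) 0 j - x 0 j)) @ 0^' --> v 0 j.
  apply: (@cvg_trans _ ((fun=> v 0 j) @ (0 : R)^')); last exact: cvg_cst.
  apply: near_eq_cvg; near=> h.
  have h0 : h != 0 by near: h; exact: nbhs_dnbhs_neq.
  by rewrite !mxE addrK [_ *: _]mulKf.
split; first by apply/cvg_ex; exists (v 0 j).
exact/cvg_lim.
Unshelve. all: by end_near. Qed.

Lemma Ck_coord k (U : set 'rV[R]_n) j : open U -> Ck rV_dir k U (fun x => x 0 j).
Proof.
move=> oU; apply: CkS; apply: (@CkS_is_derive _ _ _ _ _ _ _ (fun i _ => rV_dir i 0 j)) => //.
- by move=> x _; exact: coord_continuous.
- by move=> i x _; exact: is_derive_coord.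
- by move=> i; exact: Ck_cst.
Qed.

End Ck_rV.

(** * A smooth bump on [1, 2] *)

Section bump.
Context {R : realType}.

(** The family p(1/t) exp(-1/t) is closed under differentiation, p becoming X^2 (p - p'). Smoothness
    of exp(-1/t) across 0 is thus one induction over all [p] at once. *)
Definition expNinv (p : {poly R}) (t : R) : R :=
  if 0 < t then p.[t^-1] * expR (- t^-1) else 0.

(** With y = 1/t and m the size of p, the bound exp(y) >= y^(m+2) / (m+2)! beats p(y) by a factor
    t^2. The exponent 2 makes the difference quotient at 0 tend to 0. *)
Lemma expNinv_bound (p : {poly R}) : exists C : R, forall t, `|t| < 1 -> `|expNinv p t| <= C * t ^+ 2.
Proof.
pose m := size p; pose A := \sum_(i < size p) `|p`_i|.
have A0 : 0 <= A by exact: sumr_ge0.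
exists (A * (m.+2)`!%:R) => t t1.
have f0 : 0 <= (m.+2)`!%:R :> R by rewrite ler0n.
rewrite /expNinv; case: ifPn => [t0|_]; last first.
  by rewrite normr0; apply: mulr_ge0; [exact: mulr_ge0|exact: sqr_ge0].
rewrite gtr0_norm// in t1.
set y := t^-1; have y1 : 1 <= y by rewrite /y invf_ge1// ltW.
have y0 : 0 < y by exact: lt_le_trans y1.
have py : `|p.[y]| <= A * y ^+ m.
  rewrite horner_coef mulr_suml; apply: le_trans (ler_norm_sum _ _ _) _.
  apply: ler_sum => i _; rewrite normrM; apply: ler_wpM2l => //.
  by rewrite normrX gtr0_norm// ler_weXn2l// ltnW.
rewrite normrM (gtr0_norm (expR_gt0 _)) expRN -mulrA.
have ey : y ^+ m.+2 / (m.+2)`!%:R <= expR y.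
  by apply: le_trans (expR_ge1Dxn m.+1 (ltW y0)); rewrite lerDr.
rewrite ler_pdivrMr ?expR_gt0//; apply: le_trans py _.
rewrite -!mulrA; apply: ler_wpM2l => //.
have -> : y ^+ m = (m.+2)`!%:R * (t ^+ 2 * (y ^+ m.+2 / (m.+2)`!%:R)).
  have ty : t * y = 1 by rewrite /y mulfV// gt_eqF.
  have F0 : (m.+2)`!%:R != 0 :> R by rewrite pnatr_eq0 -lt0n fact_gt0.
  move: ((m.+2)`!%:R : R) F0 => F F0.
  have -> : F * (t ^+ 2 * (y ^+ m.+2 / F)) = y ^+ m * (t * y) ^+ 2 * (F / F) by rewrite !exprS; ring.
  by rewrite ty expr1n mulfV// !mulr1.
apply: ler_wpM2l => //; rewrite [leRHS]mulrA; exact: (ler_wpM2l (sqr_ge0 t) ey).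
Qed.

Lemma is_derive_expNinv (p : {poly R}) (t : R) :
  is_derive t 1 (expNinv p) (expNinv ('X^2 * (p - p^`())) t).
Proof.
have [t0|t0|->] := ltgtP t 0.
- apply: (@near_eq_is_derive _ _ _ (cst 0)).
    near=> s; rewrite /expNinv ifF//; apply/negbTE; rewrite -leNgt ltW//.
    by near: s; exact: lt_nbhsl.
  have -> : expNinv ('X^2 * (p - p^`())) t = 0 by rewrite /expNinv ltNge (ltW t0).
  exact: is_derive_cst.
- apply: (@near_eq_is_derive _ _ _ (fun s : R => p.[s^-1] * expR (- s^-1))).
    near=> s; rewrite /expNinv ifT//; near: s; exact: lt_nbhsr.
  have dV : is_derive t (1 : R) (fun s : R => s^-1) (- (t^-1 ^+ 2)).
    have := @is_deriveV R id t 1 1 (lt0r_neq0 t0) (is_derive_id _ _).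
    by rewrite /= [_ *: _]mulr1 -exprVn.
  have d1 : is_derive t 1 (fun s : R => p.[s^-1]) (p^`().[t^-1] * - (t^-1 ^+ 2)).
    exact: (is_derive1_comp (f := horner p) (g := fun s : R => s^-1)).
  have d2 : is_derive t 1 (fun s : R => expR (- s^-1)) (expR (- t^-1) * - - (t^-1 ^+ 2)).
    apply: (is_derive1_comp (f := @expR R) (g := fun s : R => - s^-1)).
  have D := is_deriveM d1 d2; apply: (is_derive_eq D).
  rewrite /expNinv t0 !hornerE /GRing.scale/=; ring.
- have [C HC] := expNinv_bound p.
  have E0 q : expNinv q 0 = 0 by rewrite /expNinv ltxx.
  have L : (fun h : R => h^-1 *: (expNinv p (h *: (1 : R) + 0) - expNinv p 0)) @ 0^' --> (0 : R).
    rewrite E0; apply/cvgr0Pnorm_lt => eps eps0; near=> h.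
    have h0 : h != 0 by near: h; exact: nbhs_dnbhs_neq.
    have h1 : `|h| < 1 by near: h; exact: dnbhs0_lt.
    have C1 : 0 < `|C| + 1 by exact: ltr_wpDl.
    have h2 : `|h| < eps / (`|C| + 1) by near: h; apply: dnbhs0_lt; exact: divr_gt0.
    rewrite subr0 addr0 [h *: 1]mulr1 /GRing.scale/= normrM normfV.
    rewrite ltr_pdivrMl ?normr_gt0//; apply: le_lt_trans (HC h h1) _.
    apply: (@le_lt_trans _ _ ((`|C| + 1) * `|h| * `|h|)).
      rewrite -mulrA -expr2 real_normK ?num_real// ler_wpM2r ?sqr_ge0//.
      by apply: le_trans (ler_norm _) _; rewrite lerDl.
    by rewrite mulrC ltr_pM2l ?normr_gt0// mulrC -ltr_pdivlMr.
  split; first by apply/cvg_ex; exists 0.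
  by rewrite E0; exact/cvg_lim.
Unshelve. all: by end_near. Qed.

Lemma C1k_expNinv k (p : {poly R}) : C1k k setT (expNinv p).
Proof.
have oT : open [set: R] by exact: openT.
elim: k p => [|k IH] p.
  split => // x _; apply: differentiable_continuous; apply/derivable1_diffP.
  by have [] := is_derive_expNinv p x.
by apply: (C1kS_is_derive _ _ _ _ oT) (IH ('X^2 * (p - p^`()))) => x _; exact: is_derive_expNinv.
Qed.

Definition bump (t : R) : R := expNinv 1 (t - 1) * expNinv 1 (2 - t).

Lemma C1k_bump k : C1k k setT bump.
Proof.
have oT : open [set: R] by exact: openT.
apply: CkM => //; apply: (Ck_comp _ _ _ setT (expNinv 1)) => //; try exact: C1k_expNinv.
  by apply: CkD => //; [exact: C1k_id|exact: Ck_cst].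
apply: CkD => //; first exact: Ck_cst.
apply: (@Ck_eq R R unit (fun=> 1) k _ (fun x : R => -1 * x)) => //; first by move=> x _; rewrite mulN1r.
by apply: CkM => //; [exact: Ck_cst|exact: C1k_id].
Qed.

Lemma bump_eq0 (t : R) : t <= 1 \/ 2 <= t -> bump t = 0.
Proof.
by rewrite /bump /expNinv !subr_gt0 => -[t1|t2]; [rewrite ltNge t1 mul0r|rewrite [t < 2]ltNge t2 mulr0].
Qed.

Lemma bump_neq0 (t : R) : 1 < t < 2 -> bump t != 0.
Proof.
have H s : 0 < s -> expNinv 1 s != 0.
  by move=> s0; rewrite /expNinv s0 hornerC mul1r gt_eqF// expR_gt0.
by case/andP => t1 t2; rewrite mulf_neq0// H// subr_gt0.
Qed.

Lemma antiderivative_ge1 (g : R -> R) : continuous g -> (forall t, t < 1 -> g t = 0) ->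
  exists G : R -> R, (forall t : R, is_derive t (1 : R) G (g t)) /\ (forall t, t <= 1 -> G t = 0).
Proof.
move=> cg g0; pose G (x : R) := \int[lebesgue_measure]_(t in `[0, x]) g t.
have G0 t : t <= 1 -> G t = 0.
  move=> t1; rewrite /G /Rintegral integral0_eq// => s /=; rewrite in_itv/= => /andP[_ st].
  have := le_trans st t1; rewrite le_eqVlt => /orP[/eqP ->|/g0 -> //].
  (* The hypothesis stops short of 1; continuity from the left settles the value there. *)
  suff -> : g 1 = 0 by [].
  have c1 : g x @[x --> 1^'-] --> g 1 by apply: cvg_at_left_filter; exact: cg.
  have c2 : g x @[x --> 1^'-] --> (0 : R).
    apply: (@cvg_trans _ ((fun=> 0 : R) @ (1 : R)^'-)); last exact: cvg_cst.
    by apply: near_eq_cvg; near=> x; rewrite g0.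
  exact: (cvg_unique _ c1 c2).
exists G; split => // t; have [t1|t1] := ltP t 1.
  apply: (@near_eq_is_derive _ _ _ (cst 0)).
    by near=> s; rewrite G0//; apply: ltW; near: s; exact: lt_nbhsl.
  by rewrite g0//; exact: is_derive_cst.
have t0 : 0 < t by exact: lt_le_trans t1.
have [dG GE] := @continuous_FTC1_closed R g 0 t (t + 1) ltac:(by rewrite ltrDl)
  (continuous_compact_integrable (@segment_compact _ _ _) (continuous_subspaceT cg)) t0 (cg t).
by split => //; rewrite -derive1E.
Unshelve. all: by end_near. Qed.

Lemma continuous_bump : continuous bump.
Proof. by move=> t; exact: (C1k_bump 0).1. Qed.

(** Here [m] is the quotient of the integrals of [psi] and of [bump ^+ 2], so the difference has
    integral 0 and its primitive vanishes again beyond 2. Taken at [bump_energy], [m] is the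
    constant C of the overview. *)
Lemma bump_antiderivative (psi : R -> R) : continuous psi ->
  (forall t, t < 1 \/ 2 < t -> psi t = 0) ->
  exists m : R, exists H : R -> R, (forall t : R, is_derive t (1 : R) H (psi t - m * bump t ^+ 2)) /\
    (forall t, t <= 1 \/ 2 <= t -> H t = 0).
Proof.
move=> cpsi psi0.
have [G1 [dG1 G10]] := antiderivative_ge1 psi cpsi (fun t t1 => psi0 t (or_introl t1)).
have cb2 : continuous (fun t => bump t ^+ 2).
  by move=> t; rewrite /continuous_at expr2; apply: cvgM; exact: continuous_bump.
have [] := antiderivative_ge1 _ cb2.
  by move=> t t1; rewrite bump_eq0 ?expr0n//; left; exact: ltW.
move=> G2 [dG2 G20].
have cont (F f : R -> R) (D : forall t : R, is_derive t (1 : R) F (f t)) : continuous F.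
  by move=> t; apply: differentiable_continuous; apply/derivable1_diffP; have [] := D t.
(* By the mean value theorem [G2 2] is a value of [bump ^+ 2] strictly between 1 and 2. *)
have G22 : G2 2 != 0.
  have [|c c12] := @MVT _ G2 _ 1 2 _ (fun t _ => dG2 t) (continuous_subspaceT (cont _ _ dG2)).
    by rewrite ltr1n.
  rewrite (G20 1 (lexx _)) subr0 => ->; apply: mulf_neq0; last by rewrite gt_eqF// subr_gt0 ltr1n.
  by rewrite expf_neq0// bump_neq0.
pose m := G1 2 / G2 2; pose H (t : R) : R := G1 t - m * G2 t.
have dH (t : R) : is_derive t (1 : R) H (psi t - m * bump t ^+ 2).
  apply: is_deriveB; exact: (is_deriveZ m).
exists m, H; split => // t [t1|t2]; first by rewrite /H G10// G20// mulr0 subr0.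
have H2 : H 2 = 0 by rewrite /H /m divfK// subrr.
move: t2; rewrite le_eqVlt => /orP[/eqP <- //|t2].
have [c c12] := @MVT _ H _ 2 t t2 (fun t _ => dH t) (continuous_subspaceT (cont _ _ dH)).
rewrite H2 subr0 => ->; move: c12; rewrite in_itv/= => /andP[c2 _].
rewrite psi0; last by right.
by rewrite bump_eq0 ?expr0n/= ?mulr0 ?subr0 ?mul0r//; right; exact: ltW.
Qed.

End bump.

(** * Symmetry of mixed second derivatives *)

Section schwarz.
Context {R : realType} {E : normedModType R}.
Implicit Types (f : E -> R) (v w x y z : E).

Lemma is_derive_affine f y v (t : R) : derivable f (t *: v + y) v ->
  is_derive t (1 : R) (fun s : R => f (s *: v + y)) ('D_v f (t *: v + y)).
Proof.
move=> df; have D : (fun h : R => h^-1 *: (f ((h *: (1 : R) + t) *: v + y) - f (t *: v + y))) =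
    (fun h : R => h^-1 *: (f (h *: v + (t *: v + y)) - f (t *: v + y))).
  by apply/funext => h; rewrite [h *: (1 : R)]mulr1 scalerDl addrA.
by split; [move: df; rewrite /derivable|rewrite /derive]; rewrite D.
Qed.

Lemma is_derive_translate f (c z v : E) : derivable f (c + z) v ->
  is_derive z v (fun y => f (c + y)) ('D_v f (c + z)).
Proof.
move=> df; have D : (fun h : R => h^-1 *: (f (c + (h *: v + z)) - f (c + z))) =
    (fun h : R => h^-1 *: (f (h *: v + (c + z)) - f (c + z))).
  by apply/funext => h; rewrite addrCA.
by split; [move: df; rewrite /derivable|rewrite /derive]; rewrite D.
Qed.

Lemma MVT_dir f y v (h : R) : 0 < h -> (forall z, derivable f z v) ->
  exists2 s : R, 0 < s < h & f (h *: v + y) - f y = h * 'D_v f (s *: v + y).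
Proof.
move=> h0 df.
have D (t : R) : is_derive t (1 : R) (fun s : R => f (s *: v + y)) ('D_v f (t *: v + y)).
  exact: is_derive_affine.
have cF : continuous (fun s : R => f (s *: v + y)).
  by move=> t; apply: differentiable_continuous; apply/derivable1_diffP; have [] := D t.
have [s] := @MVT _ _ _ 0 h h0 (fun t _ => D t) (continuous_subspaceT cF).
by rewrite in_itv/= => sh; rewrite scale0r add0r subr0 mulrC => E0; exists s.
Qed.

Lemma second_difference f x v w (h : R) : 0 < h ->
  (forall z, derivable f z v) -> (forall z, derivable (fun y => 'D_v f y) z w) ->
  exists s t : R, [/\ 0 < s < h, 0 < t < h &
    f (h *: w + (h *: v + x)) - f (h *: v + x) - (f (h *: w + x) - f x) =
    h * (h * 'D_w (fun y => 'D_v f y) (t *: w + (s *: v + x)))].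
Proof.
move=> h0 df ddf; pose F z := f (h *: w + z) - f z.
have DF z : is_derive z v F ('D_v f (h *: w + z) - 'D_v f z).
  apply: is_deriveB; last exact/derivableP.
  exact: is_derive_translate.
have [|s sh FE] := @MVT_dir F x v h h0; first by move=> z; have [] := DF z.
have [t th E2] := @MVT_dir (fun y => 'D_v f y) (s *: v + x) w h h0 ddf.
exists s, t; split => //; rewrite -E2; move: FE; rewrite /F => ->.
by have [_ ->] := DF (s *: v + x).
Qed.

(** The second difference of [f] over the parallelogram spanned by h v and h w is symmetric in v and
    w. It equals h^2 times either mixed derivative, each at some point of the parallelogram;
    continuity at [x] then identifies the two. *)
Lemma derive_comm f x v w :
  (forall z, derivable f z v) -> (forall z, derivable f z w) ->
  (forall z, derivable (fun y => 'D_v f y) z w) ->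
  (forall z, derivable (fun y => 'D_w f y) z v) ->
  {for x, continuous (fun z => 'D_w (fun y => 'D_v f y) z)} ->
  {for x, continuous (fun z => 'D_v (fun y => 'D_w f y) z)} ->
  'D_w (fun y => 'D_v f y) x = 'D_v (fun y => 'D_w f y) x.
Proof.
move=> dv dw dvw dwv c1 c2; apply/eqP; rewrite -subr_eq0 -normr_le0.
apply/ler_addgt0Pl => e e0; rewrite addr0.
have e20 : 0 < e / 2 by rewrite divr_gt0.
have /nbhs_ballP [d /= d0 dB] : \forall t \near x, `|'D_w (fun y => 'D_v f y) x - 'D_w (fun y => 'D_v f y) t| < e / 2.
  by move/cvgrPdist_lt : c1; exact.
have /nbhs_ballP [d' /= d'0 dB'] : \forall t \near x, `|'D_v (fun y => 'D_w f y) x - 'D_v (fun y => 'D_w f y) t| < e / 2.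
  by move/cvgrPdist_lt : c2; exact.
pose K := `|v| + `|w| + 1; have K0 : 0 < K by rewrite /K ltr_wpDl// addr_ge0.
(* With this [h] both intermediate points lie within [min d d'] of [x], where the two mixed
   derivatives vary by less than e / 2. *)
pose h := Num.min d d' / K.
have h0 : 0 < h by rewrite divr_gt0// lt_min d0 d'0.
have small (s t : R) : 0 < s < h -> 0 < t < h -> `|t *: w + (s *: v + x) - x| < Num.min d d'.
  move=> /andP[s0 sh] /andP[t0 th]; rewrite addrA addrK.
  apply: le_lt_trans (ler_normD _ _) _; rewrite !normrZ !gtr0_norm//.
  apply: (@le_lt_trans _ _ (h * (`|v| + `|w|))).
    by rewrite mulrDr addrC; apply: lerD; apply: ler_wpM2r => //; exact: ltW.
  have -> : Num.min d d' = h * K by rewrite /h divfK// gt_eqF.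
  by rewrite ltr_pM2l// /K ltrDl.
have [s [t [sh th E1]]] := second_difference f x v w h h0 dv dvw.
have [s' [t' [sh' th' E2]]] := second_difference f x w v h h0 dw dwv.
have EE : 'D_w (fun y => 'D_v f y) (t *: w + (s *: v + x)) =
          'D_v (fun y => 'D_w f y) (t' *: v + (s' *: w + x)).
  apply: (mulfI (lt0r_neq0 h0)); apply: (mulfI (lt0r_neq0 h0)); rewrite -E1 -E2.
  rewrite [h *: w + (h *: v + x)]addrCA; ring.
have B1 : `|'D_w (fun y => 'D_v f y) x - 'D_w (fun y => 'D_v f y) (t *: w + (s *: v + x))| < e / 2.
  by apply: dB; rewrite /= -ball_normE/= distrC; apply: lt_le_trans (small _ _ sh th) _; rewrite ge_min lexx.
have B2 : `|'D_v (fun y => 'D_w f y) x - 'D_v (fun y => 'D_w f y) (t' *: v + (s' *: w + x))| < e / 2.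
  apply: dB'; rewrite /= -ball_normE/= distrC [t' *: v + _]addrCA.
  by apply: lt_le_trans (small _ _ th' sh') _; rewrite ge_min lexx orbT.
rewrite EE in B1.
move: B1 B2; set A := 'D_w _ x; set B := 'D_v _ x; set C := 'D_v _ _.
move: A B C => A B C; move=> B1 B2.
apply: ltW; have -> : A - B = (A - C) + (C - B) by rewrite addrA subrK.
apply: le_lt_trans (ler_normD _ _) _; rewrite [ltRHS]splitr; apply: ltrD => //.
by rewrite distrC.
Qed.

End schwarz.

(** * Iterated logarithms and the divergence identity *)

Section iterated_log.
Context {R : realType}.
Implicit Types (s t : R).

(* The variable is s = ln (|x| / D). *)
Definition Xs (j : nat) s : R := Xlog j (expR s).
Definition Ps (k : nat) s : R := \prod_(1 <= j < k.+1) Xs j s.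
Definition Ss (k : nat) s : R := \sum_(1 <= j < k.+1) Ps j s.
Definition Vs (k : nat) s : R := \sum_(1 <= j < k.+1) Ps j s ^+ 2.

Lemma Xs0 s : Xs 0 s = expR s. Proof. by []. Qed.

Lemma XsS j s : Xs j.+1 s = (1 - ln (Xs j s))^-1. Proof. by []. Qed.

Lemma Ps0 s : Ps 0 s = 1. Proof. by rewrite /Ps big_geq. Qed.

Lemma PsS k s : Ps k.+1 s = Ps k s * Xs k.+1 s.
Proof. by rewrite /Ps big_nat_recr. Qed.

Lemma SsS k s : Ss k.+1 s = Ss k s + Ps k.+1 s.
Proof. by rewrite /Ss big_nat_recr. Qed.

Lemma VsS k s : Vs k.+1 s = Vs k s + Ps k.+1 s ^+ 2.
Proof. by rewrite /Vs big_nat_recr. Qed.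

Lemma Xs_itv j s : s < 0 -> 0 < Xs j s < 1.
Proof.
move=> s0; elim: j => [|j /andP[X0 X1]]; first by rewrite Xs0 expR_gt0 expR_lt1.
have L : ln (Xs j s) < 0 by rewrite -ln1 ltr_ln ?posrE.
have L1 : 1 < 1 - ln (Xs j s) by rewrite ltrDl oppr_gt0.
by rewrite XsS invr_gt0 (lt_trans _ L1)//= invf_lt1// (lt_trans _ L1).
Qed.

Lemma Xs_gt0 j s : s < 0 -> 0 < Xs j s. Proof. by move=> /(Xs_itv j)/andP[]. Qed.

Lemma Ps_gt0 k s : s < 0 -> 0 < Ps k s.
Proof. by move=> s0; apply: prodr_gt0 => j _; exact: Xs_gt0. Qed.

Lemma PsS_le k s : s < 0 -> Ps k.+1 s <= Ps k s.
Proof. by move=> s0; rewrite PsS ler_piMr ?ltW ?Ps_gt0//; case/andP: (Xs_itv k.+1 s s0). Qed.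

Lemma Ps_le1 k s : s < 0 -> Ps k s <= 1.
Proof. by move=> s0; elim: k => [|k]; [rewrite Ps0|exact/le_trans/PsS_le]. Qed.

Lemma Ps_leX1 k s : s < 0 -> Ps k.+1 s <= Xs 1 s.
Proof.
by move=> s0; elim: k => [|k]; [rewrite PsS Ps0 mul1r|exact/le_trans/PsS_le].
Qed.

Lemma Ss_bound k s : s < 0 -> 0 <= Ss k s <= k%:R.
Proof.
move=> s0; elim: k => [|k /andP[S0 Sk]]; first by rewrite /Ss big_geq// lexx.
rewrite SsS -natr1 lerD ?Ps_le1// andbT.
by apply: addr_ge0 => //; apply: ltW; exact: Ps_gt0.
Qed.

Lemma Vs_bound k s : s < 0 -> 0 <= Vs k s <= k%:R * Xs 1 s ^+ 2.
Proof.
move=> s0; elim: k => [|k /andP[S0 Sk]]; first by rewrite /Vs big_geq// mul0r lexx.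
rewrite VsS -natr1 mulrDl mul1r addr_ge0 ?sqr_ge0//= lerD//.
rewrite lerXn2r ?nnegrE ?(ltW (Ps_gt0 _ _ s0)) ?(ltW (Xs_gt0 _ _ s0)) ?Ps_leX1 //; exact: (ltW (Xs_gt0 1 s s0)).
Qed.

(** The left-hand side is the sum of P_i P_j over i <= j: half of the full square plus half of the
    diagonal. It is the derivative of S. *)
Lemma sum_PS k s : \sum_(1 <= j < k.+1) Ps j s * Ss j s = (Ss k s ^+ 2 + Vs k s) / 2.
Proof.
elim: k => [|k IH]; first by rewrite /Ss /Vs !big_geq// expr0n addr0 mul0r.
by rewrite big_nat_recr//= IH VsS SsS; field.
Qed.

(** From X_(j+1) = 1 / (1 - ln X_j) one gets X_(j+1)' = X_(j+1)^2 X_j' / X_j = X_(j+1)^2 P_j, and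
    X_(j+1) P_j = P_(j+1). The induction starts from the exponential, with empty product 1. *)
Lemma is_derive_Xs j s : s < 0 -> is_derive s (1 : R) (Xs j) (Ps j s * Xs j s).
Proof.
move=> s0; elim: j => [|j IH]; first by rewrite Ps0 mul1r; exact: is_derive_expR.
have X0 := Xs_gt0 j s s0.
have d1 : is_derive s (1 : R) (fun t => ln (Xs j t)) ((Xs j s)^-1 * (Ps j s * Xs j s)).
  by apply: (is_derive_comp_dir (@ln R)) => //; exact: is_derive1_ln.
have d2 : is_derive s (1 : R) (fun t => 1 - ln (Xs j t)) (0 - (Xs j s)^-1 * (Ps j s * Xs j s)).
  by apply: is_deriveB; exact: is_derive_cst.
have := Xs_gt0 j.+1 s s0; rewrite XsS invr_gt0 => L0.
have D := @is_deriveV R (fun t => 1 - ln (Xs j t)) s _ 1 (lt0r_neq0 L0) d2; apply: (is_derive_eq D).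
rewrite PsS XsS /GRing.scale/= sub0r mulrN mulNr opprK -exprVn.
by rewrite [(Xs j s)^-1 * _]mulrCA mulVf ?gt_eqF// mulr1; ring.
Qed.

Lemma is_derive_Ps k s : s < 0 -> is_derive s (1 : R) (Ps k) (Ps k s * Ss k s).
Proof.
move=> s0; elim: k => [|k IH].
  rewrite /Ss big_geq// mulr0 (_ : Ps 0 = cst 1); first exact: is_derive_cst.
  by apply/funext => t; rewrite Ps0.
rewrite (_ : Ps k.+1 = Ps k * Xs k.+1); last by apply/funext => t; rewrite PsS.
have D := is_deriveM IH (is_derive_Xs k.+1 s s0); apply: (is_derive_eq D).
by rewrite [(Ps k * _) s]/GRing.mul/= SsS !PsS /GRing.scale/=; ring.
Qed.

Lemma is_derive_Ss k s : s < 0 -> is_derive s (1 : R) (Ss k) ((Ss k s ^+ 2 + Vs k s) / 2).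
Proof.
move=> s0; rewrite -sum_PS; elim: k => [|k IH].
  rewrite big_geq// (_ : Ss 0 = cst 0); first exact: is_derive_cst.
  by apply/funext => t; rewrite /Ss big_geq.
rewrite (_ : Ss k.+1 = Ss k + Ps k.+1); last by apply/funext => t; rewrite SsS.
by rewrite big_nat_recr//=; apply: is_deriveD; exact: is_derive_Ps.
Qed.

Local Notation neg := [set s : R | s < 0].

Lemma C1k_Xs k j : C1k k neg (Xs j).
Proof.
have oN : open neg by exact: open_lt.
have oP : open [set t : R | 0 < t] by exact: open_gt.
elim: j => [|j IH]; first exact: C1k_expR.
apply: (Ck_comp _ _ _ _ (fun x : R => x^-1) (fun s => 1 - ln (Xs j s)) oN oP).
- by move=> s /= s0; rewrite -invr_gt0 -XsS Xs_gt0.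
- exact: C1k_inv.
apply: CkD => //; first exact: Ck_cst.
apply: (@Ck_eq _ _ _ _ _ _ (fun s => -1 * ln (Xs j s))) => //; first by move=> s _; rewrite mulN1r.
apply: CkM => //; first exact: Ck_cst.
by apply: (Ck_comp _ _ _ _ (@ln R) (Xs j) oN oP) => //; [move=> s; exact: Xs_gt0|exact: C1k_ln].
Qed.

Lemma C1k_Ps k j : C1k k neg (Ps j).
Proof. by apply: Ck_prod => [|i _]; [exact: open_lt|exact: C1k_Xs]. Qed.

Lemma continuous_Ps j s : s < 0 -> {for s, continuous (Ps j)}.
Proof. by move=> s0; exact: (C1k_Ps 0 j).1. Qed.

End iterated_log.

(** * The pointwise divergence identity *)

Section div_algebra.
Context {R : realFieldType}.

(* The left-hand side is the divergence of the field
   4 (u_i Y - y_i G / 2) + (4b - 2a) u u_i rho - (4 + 2a) y_i rho h u^2,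
   where y = x / |x|^2, rho = |x|^-2, Y = y . grad u, G = |grad u|^2,
   d_i y_j = delta_ij rho - 2 y_i y_j, d_i rho = - 2 y_i rho, d_i h = y_i h'. *)
Lemma divergence_algebra n (u rho h h' V : R) (y u1 : 'I_n -> R) (u2 : 'I_n -> 'I_n -> R) :
  let b : R := (n%:R - 4) / 2 in
  let a : R := n%:R * (n%:R - 4) / 4 in
  let Y := \sum_j y j * u1 j in let G := \sum_j u1 j ^+ 2 in let L := \sum_j u2 j j in
  (forall i j, u2 i j = u2 j i) -> \sum_i y i ^+ 2 = rho ->
  2 * b * h + h' - h ^+ 2 = b ^+ 2 + V / 4 ->
  \sum_i (4 * (u2 i i * Y + u1 i * (\sum_j (((i == j)%:R * rho - 2 * y i * y j) * u1 j + y j * u2 i j))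
        - ((rho - 2 * y i * y i) * G + y i * \sum_j (2 * u1 j * u2 i j)) / 2)
      + (4 * b - 2 * a) * (u1 i * u1 i * rho + u * u2 i i * rho + u * u1 i * (- 2 * y i * rho))
      - (4 + 2 * a) * ((rho - 2 * y i * y i) * rho * h * u ^+ 2 + y i * (- 2 * y i * rho) * h * u ^+ 2
         + y i * rho * (y i * h') * u ^+ 2 + y i * rho * h * (2 * u * u1 i)))
  = L ^+ 2 - (a ^+ 2 + (1 + a / 2) * V) * (u ^+ 2 * rho ^+ 2)
    - ((L - 2 * Y + (a - 2 * b) * u * rho) ^+ 2 + 2 * a * (rho * G - Y ^+ 2)
       + (4 + 2 * a) * (Y + h * u * rho) ^+ 2).
Proof.
move=> b a Y G L u2C yE hE.
(* Mixed second derivatives enter only through [W]. It occurs with coefficient 4 from u_i Y and, by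
   the symmetry of [u2], with -4 from y_i G / 2; after the cancellation only the Laplacian is
   left. *)
pose W := \sum_i \sum_j u1 i * y j * u2 i j.
have S1 i : \sum_j (((i == j)%:R * rho - 2 * y i * y j) * u1 j + y j * u2 i j) =
    rho * u1 i - 2 * y i * Y + \sum_j y j * u2 i j.
  rewrite big_split/=; congr (_ + _); rewrite /Y mulr_sumr -sumrN.
  rewrite (bigD1 i)//= eqxx mulr1n [in RHS](bigD1 i)//= [in RHS]addrA; congr (_ + _); first by ring.
  by apply: eq_bigr => j ji; rewrite eq_sym (negbTE ji) mulr0n; ring.
have W1 : \sum_i u1 i * \sum_j y j * u2 i j = W.
  by apply: eq_bigr => i _; rewrite mulr_sumr; apply: eq_bigr => j _; rewrite mulrA.
have W2 : \sum_i y i * \sum_j (2 * u1 j * u2 i j) = 2 * W.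
  rewrite /W exchange_big/= mulr_sumr; apply: eq_bigr => i _; rewrite !mulr_sumr.
  by apply: eq_bigr => j _; rewrite (u2C i j); ring.
have T1 : \sum_(i < n) rho = n%:R * rho by rewrite sumr_const card_ord mulr_natl.
have yE2 : \sum_i y i * y i = rho by rewrite -yE; apply: eq_bigr => i _; rewrite expr2.
have GE : \sum_i u1 i * u1 i = G by apply: eq_bigr => i _; rewrite expr2.
under eq_bigr do rewrite S1.
have -> : \sum_i (4 * (u2 i i * Y + u1 i * (rho * u1 i - 2 * y i * Y + \sum_j y j * u2 i j)
        - ((rho - 2 * y i * y i) * G + y i * \sum_j (2 * u1 j * u2 i j)) / 2)
      + (4 * b - 2 * a) * (u1 i * u1 i * rho + u * u2 i i * rho + u * u1 i * (- 2 * y i * rho))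
      - (4 + 2 * a) * ((rho - 2 * y i * y i) * rho * h * u ^+ 2 + y i * (- 2 * y i * rho) * h * u ^+ 2
         + y i * rho * (y i * h') * u ^+ 2 + y i * rho * h * (2 * u * u1 i)))
  = 4 * Y * (\sum_i u2 i i) + 4 * rho * (\sum_i u1 i * u1 i) - 8 * Y * (\sum_i y i * u1 i)
    + 4 * (\sum_i u1 i * \sum_j y j * u2 i j) - 2 * G * (\sum_(i < n) rho)
    + 4 * G * (\sum_i y i * y i) - 2 * (\sum_i y i * \sum_j (2 * u1 j * u2 i j))
    + (4 * b - 2 * a) * rho * (\sum_i u1 i * u1 i) + (4 * b - 2 * a) * u * rho * (\sum_i u2 i i)
    - 2 * (4 * b - 2 * a) * u * rho * (\sum_i y i * u1 i)
    - (4 + 2 * a) * rho * h * u ^+ 2 * (\sum_(i < n) rho)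
    + 4 * (4 + 2 * a) * rho * h * u ^+ 2 * (\sum_i y i * y i)
    - (4 + 2 * a) * rho * h' * u ^+ 2 * (\sum_i y i * y i)
    - 2 * (4 + 2 * a) * rho * h * u * (\sum_i y i * u1 i).
  move: Y G L {W W1 W2 T1 yE2 GE S1 u2C yE hE} => Y G L; rewrite !mulr_sumr -!sumrN -!big_split/=.
  by apply: eq_bigr => i _; field.
rewrite W1 W2 T1 yE2 GE -/Y -/L.
(* Once the Riccati equation has eliminated h', the claim is a polynomial identity in the sums, with
   a and b explicit in n. *)
have h'E : h' = b ^+ 2 + V / 4 + h ^+ 2 - 2 * b * h by rewrite -hE; ring.
rewrite h'E /b /a; move: (Y) (G) (L) (W) => Y1 G1 L1 W0; by field.
Qed.

End div_algebra.

(** * Derivatives of |x|^-2, x / |x|^2 and ln (|x| / D) *)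

Section radial.
Context {R : realType} {n : nat}.
Implicit Types x : 'rV[R]_n.

Definition sqn x : R := \sum_(i < n) x 0 i ^+ 2.
Definition rho x : R := (sqn x)^-1.
(** Off the origin these are the components of the gradient of ln |x|, hence of [sl] for every
    [D]. *)
Definition yc (j : 'I_n) x : R := x 0 j * rho x.

Lemma sqn_ge0 x : 0 <= sqn x.
Proof. by apply: sumr_ge0 => i _; exact: sqr_ge0. Qed.

Lemma sqn_gt0 x : x != 0 -> 0 < sqn x.
Proof.
move=> x0; rewrite lt0r sqn_ge0 andbT; apply: contra x0.
rewrite psumr_eq0; last by move=> i _; exact: sqr_ge0.
move=> /allP H; apply/eqP/rowP => i; rewrite mxE; apply/eqP.
by have := H i (mem_index_enum _); rewrite sqrf_eq0.
Qed.

Lemma enorm_ge0 x : 0 <= enorm x. Proof. exact: sqrtr_ge0. Qed.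

Lemma enorm_gt0 x : x != 0 -> 0 < enorm x.
Proof. by move=> x0; rewrite sqrtr_gt0 sqn_gt0. Qed.

Lemma enorm_sqr x : enorm x ^+ 2 = sqn x.
Proof. by rewrite sqr_sqrtr// sqn_ge0. Qed.

Lemma rhoE x : rho x = (enorm x ^+ 2)^-1. Proof. by rewrite enorm_sqr. Qed.

Lemma rho_sqr x : rho x ^+ 2 = (enorm x ^+ 4)^-1.
Proof. by rewrite rhoE exprVn -exprM. Qed.

Lemma sum_yc_sqr x : x != 0 -> \sum_i yc i x ^+ 2 = rho x.
Proof.
move=> x0; under eq_bigr do rewrite exprMn.
rewrite -mulr_suml -/(sqn x) /rho expr2 mulrA mulfV ?mul1r//.
by rewrite gt_eqF ?sqn_gt0.
Qed.

Lemma open_neq0 : open [set x : 'rV[R]_n | x != 0].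
Proof.
rewrite (_ : [set _ | _] = ~` [set 0]); last first.
  by apply/seteqP; split => x /= /eqP.
by rewrite openC; apply: accessible_closed_set1; apply: hausdorff_accessible; exact: norm_hausdorff.
Qed.

Lemma open_pos : open [set t : R | 0 < t].
Proof. exact: open_gt. Qed.

Lemma Ck_sqn k (U : set 'rV[R]_n) : open U -> Ck rV_dir k U sqn.
Proof.
move=> oU; apply: Ck_sum => // j.
apply: (@Ck_eq _ _ _ _ _ _ (fun x => x 0 j * x 0 j)) => //.
by apply: CkM => //; exact: Ck_coord.
Qed.

Lemma Ck_rho k : Ck rV_dir k [set x | x != 0] rho.
Proof.
apply: (Ck_comp _ _ _ _ (fun t : R => t^-1) sqn open_neq0 open_pos).
- by move=> x /= /sqn_gt0.
- exact: C1k_inv.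
- by apply: Ck_sqn; exact: open_neq0.
Qed.

Lemma Ck_yc k j : Ck rV_dir k [set x | x != 0] (yc j).
Proof.
apply: CkM; [exact: open_neq0| |exact: Ck_rho].
by apply: Ck_coord; exact: open_neq0.
Qed.

Lemma rV_dirE (i j : 'I_n) : (@rV_dir R n i) 0 j = (i == j)%:R.
Proof. by rewrite mxE eqxx eq_sym. Qed.

Lemma is_derive_sqn x i : is_derive x (rV_dir i) sqn (2 * x 0 i).
Proof.
have -> : sqn = \sum_(j < n) (fun y : 'rV[R]_n => y 0 j ^+ 2) by apply/funext => y; rewrite fct_sumE.
have D j : is_derive x (rV_dir i) (fun y : 'rV[R]_n => y 0 j ^+ 2) (2 * (i == j)%:R * x 0 j).
  have d := is_derive_coord x (rV_dir i) j.
  have := is_deriveM d d; rewrite rV_dirE => H; apply: (is_derive_eq H).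
  by rewrite /GRing.scale/=; ring.
apply: (is_derive_eq (is_derive_sum D)).
rewrite (bigD1 i)//= eqxx mulr1 big1 ?addr0// => j ji.
by rewrite eq_sym (negbTE ji) mulr0 mul0r.
Qed.

Lemma is_derive_rho x i : x != 0 -> is_derive x (rV_dir i) rho (- 2 * yc i x * rho x).
Proof.
move=> x0; have s0 := sqn_gt0 x x0.
have dV : is_derive (sqn x) (1 : R) (fun t : R => t^-1) (- ((sqn x)^-1 * (sqn x)^-1)).
  have := @is_deriveV R id (sqn x) 1 1 (lt0r_neq0 s0) (is_derive_id _ _).
  by rewrite /= [_ *: _]mulr1 -exprVn expr2.
have := is_derive_comp_dir _ _ _ _ _ _ dV (is_derive_sqn x i) => H; apply: (is_derive_eq H).
by rewrite /yc /rho; ring.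
Qed.

Lemma is_derive_yc x i j : x != 0 ->
  is_derive x (rV_dir i) (yc j) ((i == j)%:R * rho x - 2 * yc i x * yc j x).
Proof.
move=> x0; have := is_deriveM (is_derive_coord x (rV_dir i) j) (is_derive_rho x i x0).
rewrite rV_dirE => H; apply: (is_derive_eq H).
by rewrite /yc /GRing.scale/=; ring.
Qed.

Variable D : R.
Hypothesis D0 : 0 < D.

Definition sl x : R := ln (enorm x / D).

Lemma expR_sl x : x != 0 -> expR (sl x) = enorm x / D.
Proof. by move=> x0; rewrite lnK// posrE divr_gt0// enorm_gt0. Qed.

Lemma sl_lt0 x : x != 0 -> enorm x < D -> sl x < 0.
Proof.
move=> x0 xD; rewrite /sl -ln1 ltr_ln ?posrE// ?divr_gt0 ?enorm_gt0//.
by rewrite ltr_pdivrMr// mul1r.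
Qed.

(** Derivatives are taken through the squared norm, a polynomial, rather than through the square
    root. *)
Lemma slE x : x != 0 -> sl x = 2^-1 * ln (sqn x) - ln D.
Proof.
move=> x0; have e0 := enorm_gt0 x x0; rewrite /sl ln_div ?posrE//; congr (_ - _).
by rewrite -enorm_sqr lnXn// mulr2n; field.
Qed.

Lemma Ck_sl k : Ck rV_dir k [set x | x != 0] sl.
Proof.
have o := open_neq0.
apply: (@Ck_eq _ _ _ _ _ _ (fun x => 2^-1 * ln (sqn x) + - ln D) _ o).
  by move=> x /= x0; rewrite slE.
apply: CkD => //; last exact: Ck_cst.
apply: CkM => //; first exact: Ck_cst.
apply: (Ck_comp _ _ _ _ (@ln R) sqn open_neq0 open_pos).
- by move=> x /= /sqn_gt0.
- exact: C1k_ln.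
- exact: Ck_sqn.
Qed.

Lemma is_derive_sl x i : x != 0 -> is_derive x (rV_dir i) sl (yc i x).
Proof.
move=> x0; have s0 := sqn_gt0 x x0.
apply: (@near_eq_is_derive _ _ _ (fun y => 2^-1 * ln (sqn y) - ln D)).
  near=> y; rewrite slE//; near: y; apply: open_nbhs_nbhs; split => //; exact: open_neq0.
have d1 := is_derive_comp_dir _ _ _ _ _ _ (is_derive1_ln s0) (is_derive_sqn x i).
have := is_deriveB (is_deriveZ 2^-1 d1) (is_derive_cst (ln D) x (rV_dir i)) => H.
by apply: (is_derive_eq H); rewrite /yc /rho /GRing.scale/= subr0; field; rewrite gt_eqF.
Unshelve. all: by end_near. Qed.

End radial.

(** * Functions of controlled order at the origin *)

Section tame.
Context {R : realType} {n : nat} (D : R).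
Hypothesis D0 : 0 < D.
Implicit Types (f g : 'rV[R]_n -> R) (x : 'rV[R]_n).

Definition punctured_ball : set 'rV[R]_n := [set x | x != 0 /\ enorm x < D].

Lemma continuous_enorm : continuous (@enorm R n).
Proof.
move=> x; apply: continuous_comp; last exact: sqrt_continuous.
exact: (Ck_sqn 0 setT openT).1.
Qed.

Lemma open_punctured_ball : open punctured_ball.
Proof.
rewrite (_ : punctured_ball = [set x | x != 0] `&` (@enorm R n @^-1` [set t | t < D])) //.
apply: openI; first exact: open_neq0.
by apply: open_comp; [move=> x _; exact: continuous_enorm|exact: open_lt].
Qed.

(* [f] is continuous and [O(|x|^-m)] on the punctured ball; the ratio [D / |x|]
   is at least [1] there, so that these classes increase with [m]. *)
Definition tame (m : nat) f : Prop :=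
  Ck rV_dir 0 punctured_ball f /\
  exists C : R, 0 <= C /\ forall x, punctured_ball x -> `|f x| <= C * (D / enorm x) ^+ m.

Lemma ratio_ge1 x : punctured_ball x -> 1 <= D / enorm x.
Proof. by move=> [x0 xD]; rewrite ler_pdivlMr ?enorm_gt0// mul1r ltW. Qed.

Lemma tame_le m m' f : (m <= m')%N -> tame m f -> tame m' f.
Proof.
move=> mm [cf [C [C0 fC]]]; split => //; exists C; split => // x Ux.
by apply: le_trans (fC x Ux) _; rewrite ler_wpM2l// ler_weXn2l// ratio_ge1.
Qed.

Lemma tameM m m' f g : tame m f -> tame m' g -> tame (m + m') (fun x => f x * g x).
Proof.
move=> [cf [C [C0 fC]]] [cg [C' [C'0 gC]]]; split; first exact: CkM open_punctured_ball cf cg.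
exists (C * C'); split; first exact: mulr_ge0.
move=> x Ux; rewrite normrM exprD mulrACA; apply: ler_pM => //; [exact: fC|exact: gC].
Qed.

Lemma tameD m m' f g : tame m f -> tame m' g -> tame (maxn m m') (fun x => f x + g x).
Proof.
move=> /(tame_le _ _ _ (leq_maxl m m'))[cf [C [C0 fC]]].
move=> /(tame_le _ _ _ (leq_maxr m m'))[cg [C' [C'0 gC]]].
split; first exact: CkD open_punctured_ball cf cg.
exists (C + C'); split; first exact: addr_ge0.
move=> x Ux; apply: le_trans (ler_normD _ _) _; rewrite mulrDl.
by apply: lerD; [exact: fC|exact: gC].
Qed.

Lemma tame_cst (c : R) : tame 0 (fun=> c).
Proof.
split; first by apply: Ck_cst; exact: open_punctured_ball.
by exists `|c|; split => // x _; rewrite expr0 mulr1.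
Qed.

Lemma tameN m f : tame m f -> tame m (fun x => - f x).
Proof.
move=> [cf [C [C0 fC]]]; split; last by exists C; split => // x Ux; rewrite normrN; exact: fC.
split => // x Ux; exact: (@continuousN _ _ _ f x (cf.1 x Ux)).
Qed.

Lemma tameX2 m f : tame m f -> tame (m + m) (fun x => f x ^+ 2).
Proof. by move=> tf; have := tameM _ _ _ _ tf tf. Qed.

Lemma tame_sum m k (f : 'I_k -> 'rV[R]_n -> R) :
  (forall j, tame m (f j)) -> tame m (fun x => \sum_j f j x).
Proof.
move=> tf; split; first by apply: Ck_sum => [|j]; [exact: open_punctured_ball|exact: (tf j).1].
exists (\sum_j sval (cid (tf j).2)); split.
  by apply: sumr_ge0 => j _; case: cid => C /= [].
move=> x Ux; apply: le_trans (ler_norm_sum _ _ _) _; rewrite mulr_suml.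
by apply: ler_sum => j _; case: cid => C /= [_]; exact.
Qed.

Lemma tame_rho : tame 2 rho.
Proof.
split; first by apply: Ck_subset (Ck_rho 0) => x [].
exists (D ^- 2); split; first by rewrite invr_ge0 exprn_ge0// ltW.
move=> x [x0 _]; rewrite ger0_norm; last by rewrite invr_ge0 sqn_ge0.
by rewrite expr_div_n mulrA mulVf ?mul1r ?rhoE// expf_neq0// gt_eqF.
Qed.

Lemma tame_yc j : tame 1 (yc j).
Proof.
split; first by apply: Ck_subset (Ck_yc 0 j) => x [].
exists D^-1; split; first by rewrite invr_ge0 ltW.
move=> x [x0 _]; have e0 := enorm_gt0 x x0.
have r0 : 0 <= (enorm x ^+ 2)^-1 by rewrite invr_ge0 sqr_ge0.
rewrite expr1 mulrA mulVf ?mul1r ?gt_eqF// normrM rhoE (ger0_norm r0).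
by rewrite ler_pdivrMr ?exprn_gt0// expr2 mulrA mulVf ?mul1r ?gt_eqF// ler_coord_enorm.
Qed.

Lemma tame_bounded f (C : R) : continuous f -> (forall x, `|f x| <= C) -> tame 0 f.
Proof.
move=> cf fC; split; first by split => // x _; exact: cf.
by exists `|C|; split => // x _; rewrite expr0 mulr1 (le_trans (fC x)) ?ler_norm.
Qed.

Lemma tame_sl (g : R -> R) (C : R) : (forall s, s < 0 -> {for s, continuous g}) ->
  (forall s, s < 0 -> `|g s| <= C) -> tame 0 (fun x => g (sl D x)).
Proof.
move=> cg gC; split.
  split => // x [x0 xD]; apply: continuous_comp; last by apply: cg; exact: sl_lt0.
  exact: (Ck_sl _ D0 0).1.
exists `|C|; split => // x [x0 xD]; rewrite expr0 mulr1.
by apply: le_trans (gC _ _) (ler_norm _); exact: sl_lt0.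
Qed.

End tame.

(** The order is left as an existential variable and read off from the syntax of the function;
    [tame_le] then raises it to the order wanted. *)
Ltac tame_tac :=
  lazymatch goal with
  | |- tame _ _ (fun x => rho x) => eapply tame_rho; eassumption
  | |- tame _ _ (fun x => yc ?j x) => eapply tame_yc; eassumption
  | |- tame _ _ (fun x => @?f x + @?g x) => eapply (tameD _ _ _ f g); tame_tac
  | |- tame _ _ (fun x => @?f x * @?g x) => eapply (tameM _ _ _ f g); tame_tac
  | |- tame _ _ (fun x => - @?f x) => eapply (tameN _ _ f); tame_tac
  | |- tame _ _ (fun x => @?f x ^+ 2) => eapply (tameX2 _ _ f); tame_tac
  | _ => first
      [ eassumption
      | match goal with H : forall _ : _, tame _ _ _ |- _ => simple apply H end
      | match goal with H : forall _ _ : _, tame _ _ _ |- _ => simple apply H end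
      | eapply tame_cst ]
  end.

Section integral_EFin.
Context d {T : measurableType d} {R : realType} (mu : {measure set T -> \bar R}).
Implicit Types f g : T -> R.
Local Open Scope ereal_scope.

Lemma integral_EFinD f g : mu.-integrable setT (EFin \o f) -> mu.-integrable setT (EFin \o g) ->
  mu.-integrable setT (fun x => (f x + g x)%:E) /\
  \int[mu]_x (f x + g x)%:E = \int[mu]_x (f x)%:E + \int[mu]_x (g x)%:E.
Proof.
move=> fi gi; split; first by have := integrableD measurableT fi gi.
by have := integralD measurableT fi gi.
Qed.

Lemma integral_EFinZ (c : R) f : mu.-integrable setT (EFin \o f) ->
  mu.-integrable setT (fun x => (c * f x)%:E) /\
  \int[mu]_x (c * f x)%:E = c%:E * \int[mu]_x (f x)%:E.
Proof.
move=> fi; split; first by have := integrableZl measurableT c fi.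
by have := integralZl measurableT fi c.
Qed.

Lemma integral_EFin_sum k (f : 'I_k -> T -> R) :
  (forall i, mu.-integrable setT (EFin \o f i)) ->
  mu.-integrable setT (fun x => (\sum_i f i x)%:E) /\
  \int[mu]_x (\sum_i f i x)%:E = \sum_i \int[mu]_x (f i x)%:E.
Proof.
move=> fi; under eq_integral do rewrite -sumEFin.
split; last by rewrite integral_sum.
rewrite (_ : (fun x => _) = fun x => \sum_i (f i x)%:E); last first.
  by apply/funext => x; rewrite sumEFin.
by apply: integrable_sum => // i _; exact: fi.
Qed.

End integral_EFin.

Definition rellich_remainder {R : realType} {n : nat} (D : R) (m : nat)
    (u : 'rV[R]_n -> R) (x : 'rV[R]_n) : R :=
  let b : R := (n%:R - 4) / 2 in
  let a : R := n%:R * (n%:R - 4) / 4 in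
  let Y := \sum_j yc j x * partial j u x in
  (laplacian u x - 2 * Y + (a - 2 * b) * u x * rho x) ^+ 2
  + 2 * a * (rho x * (\sum_j partial j u x ^+ 2) - Y ^+ 2)
  + (4 + 2 * a) * (Y + (b + Ss m (sl D x) / 2) * u x * rho x) ^+ 2.

(** * The integrated energy identity *)

Section energy_identity.
Context {R : realType} {n : nat} (D : R) (K : set 'rV[R]_n) (u : 'rV[R]_n -> R) (m : nat).
Hypothesis n5 : (5 <= n)%N.
Hypothesis D0 : 0 < D.
Hypothesis cK : compact K.
Hypothesis KD : forall x, K x -> enorm x < D.
Hypothesis su : smooth u.
Hypothesis u0 : forall x, ~ K x -> u x = 0.

Implicit Types (x y z : 'rV[R]_n) (f g : 'rV[R]_n -> R).

Local Notation dir := (@rV_dir R n).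

Let b : R := (n%:R - 4) / 2.
Let a : R := n%:R * (n%:R - 4) / 4.

Let ui (i : 'I_n) : 'rV[R]_n -> R := partial i u.
Let uij (i j : 'I_n) : 'rV[R]_n -> R := partial i (partial j u).

Let n0 : (0 < n)%N. Proof. exact: leq_trans n5. Qed.

Let KC_open : open (~` K).
Proof. by rewrite openC; apply: compact_closed => //; exact: norm_hausdorff. Qed.

Let near_KC x : ~ K x -> \forall y \near x, ~ K y.
Proof. by move=> Kx; apply: open_nbhs_nbhs; split. Qed.

Let off_partial i f : (forall x, ~ K x -> f x = 0) -> forall x, ~ K x -> partial i f x = 0.
Proof.
move=> f0 x Kx; rewrite /partial (@near_eq_derive _ _ _ _ (cst 0)) ?derive_cst//.
by near=> y; apply: f0; near: y; exact: near_KC.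
Unshelve. all: by end_near. Qed.

Let ui0 i x : ~ K x -> ui i x = 0.
Proof. by move=> Kx; exact: off_partial. Qed.

Let uij0 i j x : ~ K x -> uij i j x = 0.
Proof. by move=> Kx; apply: off_partial => //; exact: off_partial. Qed.

Let cu : continuous u. Proof. exact: (su [::]).1. Qed.
Let cui i : continuous (ui i). Proof. exact: (su [:: i]).1. Qed.
Let cuij i j : continuous (uij i j). Proof. exact: (su [:: i; j]).1. Qed.

Let du x i : is_derive x (dir i) u (ui i x).
Proof. by apply/derivableP; exact: (su [::]).2. Qed.

Let dui x i j : is_derive x (dir i) (ui j) (uij i j x).
Proof. by apply/derivableP; exact: (su [:: j]).2. Qed.

Let partial_comm x i j : uij i j x = uij j i x.
Proof.
rewrite /uij /partial; apply: derive_comm.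
- by move=> z; exact: (su [::]).2.
- by move=> z; exact: (su [::]).2.
- by move=> z; exact: (su [:: j]).2.
- by move=> z; exact: (su [:: i]).2.
- exact: cuij.
- exact: cuij.
Qed.

Let bounded_off (f : 'rV[R]_n -> R) : continuous f -> (forall x, ~ K x -> f x = 0) ->
  exists C : R, forall x, `|f x| <= C.
Proof.
move=> cf f0; have : compact (f @` K) by apply: continuous_compact => //; exact: continuous_subspaceT.
move=> /compact_bounded [M [_ HM]]; exists (`|M| + 1) => x.
have [Kx|Kx] := pselect (K x); last by rewrite f0// normr0 addr_ge0.
by apply: HM; [rewrite ltr_pwDr// ler_norm|exists x].
Qed.

Let tame_off f : continuous f -> (forall x, ~ K x -> f x = 0) -> tame D 0 f.
Proof. by move=> cf f0; have [C fC] := bounded_off f cf f0; exact: tame_bounded fC. Qed.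

Let tu : tame D 0 u. Proof. exact: tame_off. Qed.
Let tui i : tame D 0 (ui i). Proof. by apply: tame_off => // x; exact: ui0. Qed.
Let tuij i j : tame D 0 (uij i j). Proof. by apply: tame_off => // x; exact: uij0. Qed.

(** Nonzero points of [K] lie in the punctured ball, where tameness gives continuity; the complement
    of [K] is open and [f] is 0 on it. *)
Lemma continuous_tame k f : tame D k f -> (forall x, ~ K x -> f x = 0) ->
  forall x, x != 0 -> {for x, continuous f}.
Proof.
move=> [[cf _] _] f0 x x0; have [Kx|Kx] := pselect (K x).
  by apply: cf; split => //; exact: KD.
have C0 : Ck dir 0 (~` K) f.
  by apply: (Ck_eq _ _ _ (fun=> 0)) => //; [move=> y Ky; rewrite f0|exact: Ck_cst].
exact: (C0.1 x Kx).
Qed.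

Lemma integrable_tame f : tame D 4 f -> (forall x, ~ K x -> f x = 0) ->
  (lebesgue_rV n).-integrable setT (fun x => (f x)%:E).
Proof.
move=> tf f0; have [_ [C [C0 fC]]] := tf.
apply: (integrable_enormN4 n f (C * D ^+ 4) D n5 D0).
- apply: measurable_fun_continuous_off0; exact: (continuous_tame 4 f tf f0).
- by move=> x xD; apply: f0 => /KD xD'; have := lt_trans xD xD'; rewrite ltxx.
- move=> x x0; have [Kx|Kx] := pselect (K x).
    apply: le_trans (fC x _) _; first by split => //; exact: KD.
    by rewrite expr_div_n mulrA.
  rewrite f0// normr0 mulr_ge0 ?invr_ge0 ?exprn_ge0 ?enorm_ge0//.
  by rewrite mulr_ge0// exprn_ge0// ltW.
Qed.

Let Y x : R := \sum_j yc j x * ui j x.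
Let G x : R := \sum_j ui j x ^+ 2.
Let h x : R := b + Ss m (sl D x) / 2.
Let h' x : R := (Ss m (sl D x) ^+ 2 + Vs m (sl D x)) / 4.
Let V x : R := Vs m (sl D x).

Let th : tame D 0 h.
Proof.
apply: (tame_sl D D0 (fun s => b + Ss m s / 2) (`|b| + m%:R)) => s s0.
  apply: cvgD; first exact: cvg_cst.
  apply: cvgM; last exact: cvg_cst.
  by apply: differentiable_continuous; apply/derivable1_diffP; have [] := is_derive_Ss m s s0.
have /andP[S0 Sm] := Ss_bound m s s0.
apply: le_trans (ler_normD _ _) _; rewrite lerD2l ger0_norm; last by rewrite divr_ge0.
by rewrite ler_pdivrMr// (le_trans Sm)// ler_peMr// ler1n.
Qed.

Let tPs j : tame D 0 (fun x => Ps j (sl D x)).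
Proof.
apply: (tame_sl D D0 (Ps j) 1) => s s0; first exact: continuous_Ps.
by rewrite ger0_norm ?Ps_le1// ltW// Ps_gt0.
Qed.

Let Vs_sum (s : R) : Vs m s = \sum_(j < m) Ps j.+1 s ^+ 2.
Proof. by rewrite /Vs big_add1/= big_mkord. Qed.

Let Ss_sum (s : R) : Ss m s = \sum_(j < m) Ps j.+1 s.
Proof. by rewrite /Ss big_add1/= big_mkord. Qed.

Let tV : tame D 0 V.
Proof.
rewrite /V (_ : (fun x => _) = fun x => \sum_(j < m) Ps j.+1 (sl D x) ^+ 2).
  by apply: tame_sum => // j; exact: (tameX2 D 0).
by apply/funext => x; exact: Vs_sum.
Qed.

Let th' : tame D 0 h'.
Proof.
rewrite /h' (_ : (fun x => _) = fun x =>
  ((\sum_(j < m) Ps j.+1 (sl D x)) ^+ 2 + V x) * 4^-1).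
  apply: (tameM D 0 0); last exact: tame_cst.
  apply: (tameD D 0 0) => //; apply: (tameX2 D 0).
  by apply: tame_sum => // j.
by apply/funext => x; rewrite Ss_sum.
Qed.

Let is_derive_h x i : x != 0 -> enorm x < D -> is_derive x (dir i) h (yc i x * h' x).
Proof.
move=> x0 xD; have s0 := sl_lt0 D D0 x x0 xD.
have d1 : is_derive (sl D x) (1 : R) (fun s => b + Ss m s / 2)
    (0 + ((Ss m (sl D x) ^+ 2 + Vs m (sl D x)) / 2) / 2).
  have d0 : is_derive (sl D x) (1 : R) (cst b) 0 by exact: is_derive_cst.
  have d2 := is_deriveM (is_derive_Ss m _ s0) (is_derive_cst (2^-1 : R) (sl D x) (1 : R)).
  apply: (is_derive_eq (is_deriveD d0 d2)).
  by rewrite /GRing.scale/= mulr0 add0r [2^-1 * _]mulrC.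
have := is_derive_comp_dir _ _ _ _ _ _ d1 (is_derive_sl D D0 x i x0) => H.
by apply: (is_derive_eq H); rewrite /h'; field.
Qed.

Let F i x : R := 4 * (ui i x * Y x - yc i x * G x / 2)
  + (4 * b - 2 * a) * (u x * ui i x * rho x)
  - (4 + 2 * a) * (yc i x * rho x * h x * u x ^+ 2).

Let dF i x : R := 4 * (uij i i x * Y x + ui i x *
       (\sum_j (((i == j)%:R * rho x - 2 * yc i x * yc j x) * ui j x + yc j x * uij i j x))
        - ((rho x - 2 * yc i x * yc i x) * G x + yc i x * \sum_j (2 * ui j x * uij i j x)) / 2)
      + (4 * b - 2 * a) * (ui i x * ui i x * rho x + u x * uij i i x * rho x
          + u x * ui i x * (- 2 * yc i x * rho x))
      - (4 + 2 * a) * ((rho x - 2 * yc i x * yc i x) * rho x * h x * u x ^+ 2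
         + yc i x * (- 2 * yc i x * rho x) * h x * u x ^+ 2
         + yc i x * rho x * (yc i x * h' x) * u x ^+ 2
         + yc i x * rho x * h x * (2 * u x * ui i x)).

Let Y0 x : ~ K x -> Y x = 0.
Proof. by move=> Kx; rewrite /Y big1// => j _; rewrite ui0// mulr0. Qed.

Let G0 x : ~ K x -> G x = 0.
Proof. by move=> Kx; rewrite /G big1// => j _; rewrite ui0// expr0n. Qed.

Let F0 i x : ~ K x -> F i x = 0.
Proof. by move=> Kx; rewrite /F Y0// G0// ui0// u0// expr0n/=; ring. Qed.

Let dF0 i x : ~ K x -> dF i x = 0.
Proof.
move=> Kx; rewrite /dF Y0// G0// ui0// u0// uij0// expr0n/=.
by rewrite [\sum_j (2 * _ * _)]big1; [ring|move=> j _; rewrite ui0// mulr0 mul0r].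
Qed.

Let is_derive_F i x : x != 0 -> is_derive x (dir i) (F i) (dF i x).
Proof.
move=> x0; have [Kx|Kx] := pselect (K x); last first.
  apply: (@near_eq_is_derive _ _ _ (cst 0)).
    by near=> y; rewrite F0//; near: y; exact: near_KC.
  by rewrite dF0//; exact: is_derive_cst.
have dMf f g (df dg : R) : is_derive x (dir i) f df -> is_derive x (dir i) g dg ->
    is_derive x (dir i) (fun z => f z * g z) (df * g x + f x * dg).
  by move=> d1 d2; apply: (is_derive_eq (is_deriveM d1 d2)); rewrite /GRing.scale/=; ring.
have dBf f g (df dg : R) : is_derive x (dir i) f df -> is_derive x (dir i) g dg ->
    is_derive x (dir i) (fun z => f z - g z) (df - dg).
  by move=> d1 d2; exact: is_deriveB.
have dDf f g (df dg : R) : is_derive x (dir i) f df -> is_derive x (dir i) g dg ->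
    is_derive x (dir i) (fun z => f z + g z) (df + dg).
  by move=> d1 d2; exact: is_deriveD.
have dXf f (df : R) : is_derive x (dir i) f df -> is_derive x (dir i) (fun z => f z ^+ 2) (2 * f x * df).
  by move=> d1; apply: (is_derive_eq (dMf _ _ _ _ d1 d1)); ring.
have dCf (c : R) f (df : R) : is_derive x (dir i) f df -> is_derive x (dir i) (fun z => c * f z) (c * df).
  by move=> d1; exact: is_deriveZ.
have dSf (f : 'I_n -> 'rV[R]_n -> R) (df : 'I_n -> R) : (forall j, is_derive x (dir i) (f j) (df j)) ->
    is_derive x (dir i) (fun z => \sum_j f j z) (\sum_j df j).
  move=> d1; have := is_derive_sum d1.
  by rewrite (_ : \sum_j f j = fun z => \sum_j f j z)//; apply/funext => z; rewrite fct_sumE.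
have dy j := is_derive_yc x i j x0.
have dr := is_derive_rho x i x0.
have dh := is_derive_h x i x0 (KD x Kx).
have dY : is_derive x (dir i) Y
    (\sum_j (((i == j)%:R * rho x - 2 * yc i x * yc j x) * ui j x + yc j x * uij i j x)).
  by apply: dSf => j; apply: dMf.
have dG : is_derive x (dir i) G (\sum_j (2 * ui j x * uij i j x)).
  by apply: dSf => j; apply: dXf.
have d1 := dBf _ _ _ _ (dMf _ _ _ _ (dui x i i) dY) (dMf _ _ _ _ (dMf _ _ _ _ (dy i) dG) (is_derive_cst (2^-1 : R) x (dir i))).
have d2 := dMf _ _ _ _ (dMf _ _ _ _ (du x i) (dui x i i)) dr.
have d3 := dMf _ _ _ _ (dMf _ _ _ _ (dMf _ _ _ _ (dy i) dr) dh) (dXf _ _ (du x i)).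
have := dBf _ _ _ _ (dDf _ _ _ _ (dCf 4 _ _ d1) (dCf (4 * b - 2 * a) _ _ d2)) (dCf (4 + 2 * a) _ _ d3) => H.
apply: (is_derive_eq H); rewrite /dF eqxx mulr1n.
move: (\sum_j (_ + _)) (\sum_j (2 * _ * _)) => s1 s2; rewrite !mul1r; rewrite /cst; ring.
Unshelve. all: by end_near. Qed.

Let tY : tame D 1 Y.
Proof. by apply: tame_sum => j; eapply tame_le; last tame_tac. Qed.

Let tG : tame D 0 G.
Proof. by apply: tame_sum => j; apply: (tameX2 _ 0). Qed.

Let tL : tame D 0 (laplacian u).
Proof. by apply: tame_sum => j; exact: tuij. Qed.

Let tdY i : tame D 2 (fun x => \sum_j (((i == j)%:R * rho x - 2 * yc i x * yc j x) * ui j x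
  + yc j x * uij i j x)).
Proof. by apply: tame_sum => j; eapply tame_le; last tame_tac. Qed.

Let tdG i : tame D 0 (fun x => \sum_j (2 * ui j x * uij i j x)).
Proof. by apply: tame_sum => j; eapply tame_le; last tame_tac. Qed.

Let tdF i : tame D 4 (dF i).
Proof. by rewrite /dF; eapply tame_le; last tame_tac. Qed.

Let integral_dF i : (\int[lebesgue_rV n]_x (dF i x)%:E = 0)%E.
Proof.
apply: (integral_partial0 n i (F i) (dF i) D) => //.
- by apply: leq_trans n5.
- by move=> x x0; exact: is_derive_F.
- exact: continuous_tame (tdF i) (dF0 i).
- by move=> x xD; apply: F0 => /KD xD'; have := lt_trans xD xD'; rewrite ltxx.
- by move=> x xD; apply: dF0 => /KD xD'; have := lt_trans xD xD'; rewrite ltxx.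
- exact: integrable_tame (tdF i) (dF0 i).
Qed.

Let Q := rellich_remainder D m u.

Let QE x : Q x = (laplacian u x - 2 * Y x + (a - 2 * b) * u x * rho x) ^+ 2
  + 2 * a * (rho x * G x - Y x ^+ 2) + (4 + 2 * a) * (Y x + h x * u x * rho x) ^+ 2.
Proof. by []. Qed.

Let tQ : tame D 4 Q.
Proof. by rewrite (funext QE); eapply tame_le; last tame_tac. Qed.

Lemma laplacian_off x : ~ K x -> laplacian u x = 0.
Proof. by move=> Kx; rewrite /laplacian big1// => i _; exact: uij0. Qed.

Lemma rellich_remainder_off x : ~ K x -> rellich_remainder D m u x = 0.
Proof. by move=> Kx; rewrite -/Q QE Y0// G0// laplacian_off// u0//; ring. Qed.

Let f2 x : R := u x ^+ 2 / enorm x ^+ 4.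
Let f3 k x : R := u x ^+ 2 / enorm x ^+ 4 * \prod_(1 <= j < k.+1) Xlog j (enorm x / D) ^+ 2.

Let f3E k x : f3 k x = u x ^+ 2 * rho x ^+ 2 * Ps k (sl D x) ^+ 2.
Proof.
rewrite /f3 rho_sqr; have [->|x0] := eqVneq x 0.
  (* At the origin [expR (sl D x)] is 1 and not [enorm x / D]; both sides vanish there because the
     inverse of 0 is 0. *)
  have -> : enorm (0 : 'rV[R]_n) = 0.
    by rewrite /enorm big1 ?sqrtr0// => i _; rewrite mxE expr0n.
  by rewrite expr0n/= invr0 mulr0 !mul0r.
by rewrite /Ps -prodrXl; under [in RHS]eq_bigr do rewrite /Xs expR_sl//.
Qed.

Let pointwise x : x != 0 -> laplacian u x ^+ 2 =
  a ^+ 2 * f2 x + (1 + n%:R * (n%:R - 4) / 8) * (\sum_(j < m) f3 j.+1 x)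
  + Q x + \sum_i dF i x.
Proof.
move=> x0.
have hE : 2 * b * h x + h' x - h x ^+ 2 = b ^+ 2 + V x / 4.
  by rewrite /h /h' /V; move: (Ss _ _) (Vs _ _) => S0 V0; field.
have H := divergence_algebra n (u x) (rho x) (h x) (h' x) (V x) (fun j => yc j x)
  (fun j => ui j x) (fun i j => uij i j x) (partial_comm x) (sum_yc_sqr x x0) hE.
rewrite /dF H -/b -/a -/(Y x) -/(G x) -/(laplacian u x) QE.
have -> : \sum_(j < m) f3 j.+1 x = u x ^+ 2 * rho x ^+ 2 * V x.
  by rewrite /V Vs_sum mulr_sumr; apply: eq_bigr => j _; rewrite f3E.
rewrite /f2 -rho_sqr.
have -> : n%:R * (n%:R - 4) / 8 = a / 2 :> R by rewrite /a; field.
move: (laplacian u x) (Y x) (G x) (V x) => L1 Y1 G1 V1; ring.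
Qed.

Lemma rellich_remainder_ge0 x : x != 0 -> 0 <= rellich_remainder D m u x.
Proof.
move=> x0; rewrite -/Q QE.
have a0 : 0 <= a.
  by rewrite /a divr_ge0// mulr_ge0// subr_ge0 ler_nat (leq_trans _ n5).
have r0 : 0 < rho x by rewrite /rho invr_gt0 sqn_gt0.
apply: addr_ge0; last by rewrite mulr_ge0 ?sqr_ge0// addr_ge0// mulr_ge0.
apply: addr_ge0; first exact: sqr_ge0.
apply: mulr_ge0; first by rewrite mulr_ge0.
(* This is Cauchy-Schwarz for y and grad u: since |y|^2 = rho, a further factor [rho] exhibits a sum
   of squares. *)
rewrite -(pmulr_rge0 _ r0).
have -> : rho x * (rho x * G x - Y x ^+ 2) = \sum_i (rho x * ui i x - Y x * yc i x) ^+ 2.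
  have E i : (rho x * ui i x - Y x * yc i x) ^+ 2 = rho x ^+ 2 * ui i x ^+ 2
    + (- 2 * rho x * Y x) * (yc i x * ui i x) + Y x ^+ 2 * yc i x ^+ 2 by ring.
  rewrite (eq_bigr _ (fun i _ => E i)) !big_split/= -!mulr_sumr (sum_yc_sqr x x0).
  by rewrite -/(G x) -/(Y x); ring.
by apply: sumr_ge0 => i _; exact: sqr_ge0.
Qed.

Lemma energy_identity :
  [/\ (lebesgue_rV n).-integrable setT (fun x => (laplacian u x ^+ 2)%:E),
      (lebesgue_rV n).-integrable setT (fun x => (u x ^+ 2 / enorm x ^+ 4)%:E),
      forall k, (lebesgue_rV n).-integrable setT (fun x => (u x ^+ 2 / enorm x ^+ 4 *
        \prod_(1 <= j < k.+1) Xlog j (enorm x / D) ^+ 2)%:E),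
      (lebesgue_rV n).-integrable setT (fun x => (rellich_remainder D m u x)%:E) &
  (\int[lebesgue_rV n]_x (laplacian u x ^+ 2)%:E =
   (a ^+ 2)%:E * \int[lebesgue_rV n]_x (u x ^+ 2 / enorm x ^+ 4)%:E +
   (1 + n%:R * (n%:R - 4) / 8)%:E * (\sum_(1 <= k < m.+1) \int[lebesgue_rV n]_x
      (u x ^+ 2 / enorm x ^+ 4 * \prod_(1 <= j < k.+1) Xlog j (enorm x / D) ^+ 2)%:E) +
   \int[lebesgue_rV n]_x (rellich_remainder D m u x)%:E)%E].
Proof.
have i1 : (lebesgue_rV n).-integrable setT (fun x => (laplacian u x ^+ 2)%:E).
  apply: integrable_tame => [|x Kx]; last by rewrite laplacian_off// expr0n.
  by eapply tame_le; last tame_tac.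
have i2 : (lebesgue_rV n).-integrable setT (fun x => (f2 x)%:E).
  apply: integrable_tame => [|x Kx]; last by rewrite /f2 u0// expr0n mul0r.
  rewrite (_ : f2 = fun x => u x ^+ 2 * rho x ^+ 2); last first.
    by apply/funext => x; rewrite rho_sqr.
  by eapply tame_le; last tame_tac.
have i3 k : (lebesgue_rV n).-integrable setT (fun x => (f3 k x)%:E).
  apply: integrable_tame => [|x Kx]; last by rewrite f3E u0// expr0n !mul0r.
  rewrite (funext (f3E k)); eapply tame_le; last tame_tac; by [].
have i4 : (lebesgue_rV n).-integrable setT (fun x => (Q x)%:E).
  exact: integrable_tame tQ rellich_remainder_off.
have i5 i : (lebesgue_rV n).-integrable setT (fun x => (dF i x)%:E).
  exact: integrable_tame (tdF i) (dF0 i).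
split => //.
set c : R := 1 + _.
have [j2 E2] := integral_EFinZ _ (lebesgue_rV n) (a ^+ 2) f2 i2.
have [j3 E3] := integral_EFin_sum _ (lebesgue_rV n) m (fun j x => f3 j.+1 x) (fun j => i3 j.+1).
have [j3' E3'] := integral_EFinZ _ (lebesgue_rV n) c _ j3.
have [j5 E5] := integral_EFin_sum _ (lebesgue_rV n) n dF i5.
have [k1 G1] := integral_EFinD _ (lebesgue_rV n) _ _ j2 j3'.
have [k2 G2] := integral_EFinD _ (lebesgue_rV n) _ _ k1 i4.
have [k3 G3] := integral_EFinD _ (lebesgue_rV n) _ _ k2 j5.
transitivity (\int[lebesgue_rV n]_x (a ^+ 2 * f2 x + c * (\sum_(j < m) f3 j.+1 x)
  + Q x + \sum_i dF i x)%:E)%E.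
  apply: ae_eq_integral => //.
  - by case/integrableP: i1.
  - by case/integrableP: k3.
  - have := ae_rV_coord_neq0 (R := R) n; apply: filterS => x x0 _; rewrite pointwise//.
    apply/eqP => xE; have := x0 (Ordinal n0).
    by rewrite xE mxE eqxx.
have Z : (\sum_i \int[lebesgue_rV n]_x (dF i x)%:E = 0)%E.
  by rewrite big1// => i _; exact: integral_dF.
rewrite G3 G2 G1 E2 E3' E3 E5 Z adde0.
by rewrite big_add1/= big_mkord.
Qed.

End energy_identity.

(** * The improved Rellich inequality *)

Section inequality.
Context {R : realType} {N : nat} (Omega : set 'rV[R]_N) (D : R).
Hypothesis N5 : (5 <= N)%N.
Hypothesis oO : open Omega.
Hypothesis bO : bounded_set Omega.
Hypothesis O0 : Omega 0.
Hypothesis sD : sup [set enorm x | x in Omega] <= D.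
Implicit Types (u : 'rV[R]_N -> R) (x : 'rV[R]_N).

Let a : R := N%:R * (N%:R - 4) / 4.
Let c : R := 1 + N%:R * (N%:R - 4) / 8.

Lemma c_gt0 : 0 < c.
Proof.
rewrite /c ltr_pwDl// divr_ge0// mulr_ge0// subr_ge0 ler_nat.
exact: leq_trans N5.
Qed.

Lemma enorm0 : enorm (0 : 'rV[R]_N) = 0.
Proof. by rewrite /enorm big1 ?sqrtr0// => i _; rewrite mxE expr0n. Qed.

Lemma enormZ (t : R) x : 0 <= t -> enorm (t *: x) = t * enorm x.
Proof.
move=> t0; rewrite -[t in RHS]ger0_norm// -sqrtr_sqr -sqrtrM ?sqr_ge0// mulr_sumr.
by congr Num.sqrt; apply: eq_bigr => i _; rewrite mxE exprMn.
Qed.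

Lemma enorm_ub x : Omega x -> enorm x <= D.
Proof.
move=> Ox; apply: le_trans sD; apply: ub_le_sup; last by exists x.
(* The supremum is an upper bound only if the set has one: |M| + 1 bounds the sup norm on [Omega],
   and sqrt(N) times it bounds the Euclidean norm. *)
have [M [_ HM]] := bO; exists (Num.sqrt (N%:R * (`|M| + 1) ^+ 2)) => _ [z Oz <-].
apply: ler_wsqrtr; rewrite mulr_natl -[N in leRHS]card_ord -sumr_const.
apply: ler_sum => i _; rewrite -(real_normK (num_real (z 0 i))).
rewrite lerXn2r ?nnegrE ?addr_ge0//.
have zM : `|z| <= `|M| + 1 by apply: HM => //; rewrite ltr_pwDr// ler_norm.
apply: le_trans zM; rewrite [leRHS]/Num.Def.normr/= mx_normrE.
by apply/bigmax_geP; right => /=; exists (0, i).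
Qed.

(** As [Omega] is open, [x] can be pushed outwards within it, so the supremum is not attained at
    [x]. Strictness is what gives s < 0, where X_j and its derivatives are under control. *)
Lemma enorm_lt x : Omega x -> x != 0 -> enorm x < D.
Proof.
move=> Ox x0.
have : \forall t \near (1 : R), Omega (t *: x).
  have ct : {for (1 : R), continuous (fun t : R => t *: x)}.
    by move=> /=; apply: scalel_continuous.
  by apply: ct; rewrite scale1r; apply: open_nbhs_nbhs.
move=> /nbhs_ballP[e /= e0 He].
have Ot : Omega ((1 + e / 2) *: x).
  apply: He; rewrite /ball/= opprD addrA subrr sub0r normrN gtr0_norm ?divr_gt0//.
  by rewrite ltr_pdivrMr// ltr_pMr// ltr1n.
apply: lt_le_trans (enorm_ub _ Ot); rewrite enormZ; last by rewrite addr_ge0// divr_ge0// ltW.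
by rewrite mulrDl mul1r ltrDl mulr_gt0 ?divr_gt0// enorm_gt0.
Qed.

Lemma D_gt0 : 0 < D.
Proof.
have /nbhs_ballP[e /= e0 He] : nbhs (0 : 'rV[R]_N) Omega by exact: open_nbhs_nbhs.
have i0 : 'I_N := Ordinal (leq_trans (isT : (0 < 5)%N) N5).
pose z : 'rV[R]_N := (e / 2) *: delta_mx 0 i0.
have Oz : Omega z.
  apply: He; apply/rV_ballP => // i; rewrite !mxE sub0r normrN eqxx/=.
  rewrite normrM gtr0_norm ?divr_gt0//; case: eqP => _; rewrite ?normr1 ?mulr1 ?normr0 ?mulr0//.
  by rewrite ltr_pdivrMr// ltr_pMr// ltr1n.
apply: lt_le_trans (enorm_ub _ Oz); apply: enorm_gt0; apply/eqP => /rowP/(_ i0).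
by rewrite !mxE !eqxx mulr1 => /eqP; rewrite gt_eqF// divr_gt0.
Qed.

Let supp u := closure [set x | u x != 0].

Let supp0 u x : ~ supp u x -> u x = 0.
Proof. by move=> ux; apply/eqP/negPn/negP => u0; apply: ux; exact: subset_closure. Qed.

Let suppD u : test_function Omega u -> forall x, supp u x -> enorm x < D.
Proof.
case=> _ _ sO x /sO Ox; have [->|x0] := eqVneq x 0; last exact: enorm_lt.
by rewrite enorm0 D_gt0.
Qed.

Let off u (g : 'rV[R]_N -> R) : test_function Omega u -> (forall x, ~ supp u x -> g x = 0) ->
  (\int[lebesgue_rV N]_(x in Omega) (g x)%:E = \int[lebesgue_rV N]_x (g x)%:E)%E.
Proof.
case=> _ _ sO g0; rewrite integral_mkcond; apply: eq_integral => x _; rewrite patchE.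
by case: ifPn => // /negP; rewrite inE => Ox; rewrite g0// => /sO.
Qed.

(** All integrals are finite for a test function, so the identity is carried over to real numbers,
    where linear arithmetic is available. *)
Lemma rellich_identity m u : test_function Omega u ->
  [/\ (forall i, log_term Omega D i u \is a fin_num),
      (lebesgue_rV N).-integrable setT (fun x => (rellich_remainder D m u x)%:E) &
  [/\ bilaplace_energy Omega u \is a fin_num, rellich_term Omega u \is a fin_num &
   fine (bilaplace_energy Omega u) = a ^+ 2 * fine (rellich_term Omega u)
   + c * (\sum_(1 <= i < m.+1) fine (log_term Omega D i u))
   + fine (\int[lebesgue_rV N]_x (rellich_remainder D m u x)%:E)]].
Proof.
move=> tu; have [su cK sO] := tu.
have [i1 i2 i3 i4 E] := energy_identity D (supp u) u m N5 D_gt0 cK (suppD u tu) su (supp0 u).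
have f1 : bilaplace_energy Omega u = (\int[lebesgue_rV N]_x (laplacian u x ^+ 2)%:E)%E.
  apply: (off u) => // x Kx.
  by rewrite (laplacian_off _ _ cK (supp0 u) x Kx) expr0n.
have f2 : rellich_term Omega u = (\int[lebesgue_rV N]_x (u x ^+ 2 / enorm x ^+ 4)%:E)%E.
  by apply: (off u) => // x Kx; rewrite supp0// expr0n mul0r.
have f3 i : log_term Omega D i u = (\int[lebesgue_rV N]_x (u x ^+ 2 / enorm x ^+ 4 *
        \prod_(1 <= j < i.+1) Xlog j (enorm x / D) ^+ 2)%:E)%E.
  by apply: (off u) => // x Kx; rewrite supp0// expr0n !mul0r.
have g1 : bilaplace_energy Omega u \is a fin_num by rewrite f1; exact: integrable_fin_num.
have g2 : rellich_term Omega u \is a fin_num by rewrite f2; exact: integrable_fin_num.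
have g3 i : log_term Omega D i u \is a fin_num.
  by rewrite f3; apply: integrable_fin_num => //; exact: i3.
have g4 : (\int[lebesgue_rV N]_x (rellich_remainder D m u x)%:E)%E \is a fin_num.
  exact: integrable_fin_num.
split => //; split => //; apply: EFin_inj.
rewrite !EFinD !EFinM -sumEFin !fineK// f1 E f2; congr (_ + _ * _ + _)%E.
by apply: eq_bigr => i _; rewrite fineK// f3.
Qed.

Lemma remainder_integral_ge0 m u : test_function Omega u ->
  (0 <= \int[lebesgue_rV N]_x (rellich_remainder D m u x)%:E)%E.
Proof.
move=> tu; have [_ iQ _] := rellich_identity m u tu; have [su cK sO] := tu.
(* The sign is established off the origin only, so the integrand is exchanged for its absolute value
   almost everywhere. *)
rewrite (_ : (\int[_]_x _ = \int[lebesgue_rV N]_x `|(rellich_remainder D m u x)%:E|)%E).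
  by apply: integral_ge0.
apply: ae_eq_integral => //.
- by case/integrableP: iQ.
- by apply: measurableT_comp => //; case/integrableP: iQ.
- have := ae_rV_coord_neq0 (R := R) N; apply: filterS => x x0 _.
  rewrite gee0_abs// lee_fin; apply: (rellich_remainder_ge0 D u m N5).
  apply/eqP => xE; have := x0 (Ordinal (leq_trans (isT : (0 < 5)%N) N5)).
  by rewrite xE mxE eqxx.
Qed.

Lemma log_term_ge0 i u : (0 <= log_term Omega D i u)%E.
Proof.
apply: integral_ge0 => x _; rewrite lee_fin mulr_ge0//.
  by rewrite divr_ge0 ?sqr_ge0// exprn_ge0// enorm_ge0.
by apply: prodr_ge0 => j _; exact: sqr_ge0.
Qed.

Lemma rellich_log_inequality_fine m u : test_function Omega u ->
  a ^+ 2 * fine (rellich_term Omega u) + c * (\sum_(1 <= i < m.+1) fine (log_term Omega D i u))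
  <= fine (bilaplace_energy Omega u).
Proof.
move=> tu; have [_ _ [_ _ ->]] := rellich_identity m u tu.
by rewrite lerDl fine_ge0// remainder_integral_ge0.
Qed.

Lemma sum_log_termE m n u : test_function Omega u ->
  (\sum_(m <= i < n) log_term Omega D i u = (\sum_(m <= i < n) fine (log_term Omega D i u))%:E)%E.
Proof.
move=> tu; have [fT _ _] := rellich_identity 0 u tu.
by rewrite -sumEFin; apply: eq_bigr => i _; rewrite fineK.
Qed.

Lemma rellich_log_inequality u : test_function Omega u ->
  (bilaplace_energy Omega u >= (a ^+ 2)%:E * rellich_term Omega u +
     c%:E * \sum_(1 <= i <oo) log_term Omega D i u)%E.
Proof.
move=> tu; have [_ _ [fE fR _]] := rellich_identity 0 u tu.
have c0 := c_gt0; rewrite -(fineK fE) -(fineK fR).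
set e := fine (bilaplace_energy _ _); set r := fine (rellich_term _ _).
(* The other two terms are finite and [c] is positive, so the inequality can be solved for the
   series, which is then bounded through its partial sums. *)
suff H : (\sum_(1 <= i <oo) log_term Omega D i u <= ((e - a ^+ 2 * r) / c)%:E)%E.
  rewrite -EFinM addeC -leeBrDr// -EFinB.
  have -> : (e - a ^+ 2 * r)%:E = (c%:E * ((e - a ^+ 2 * r) / c)%:E)%E.
    by rewrite -EFinM [c * _]mulrC divfK// gt_eqF.
  by apply: lee_wpmul2l => //; rewrite lee_fin ltW.
apply: lime_le.
  by apply: is_cvg_nneseries => i _ _; exact: log_term_ge0.
(* The partial sum stops before [m], hence the finite inequality is used at [m.-1]. *)
near=> m; have m0 : (0 < m)%N by near: m; exact: nbhs_infty_gt.
rewrite sum_log_termE// lee_fin ler_pdivlMr// lerBrDl [_ * c]mulrC.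
by have := rellich_log_inequality_fine m.-1 u tu; rewrite prednK.
Unshelve. all: by end_near. Qed.

(** If the integral were 0, the integrand would vanish almost everywhere. Off the coordinate
    hyperplanes it vanishes only where [u] does, so the set where [u] is nonzero would be
    negligible; but by continuity it contains a box. *)
Lemma log_term_gt0 k u : test_function Omega u -> u <> (fun=> 0) -> (0 < log_term Omega D k u)%E.
Proof.
move=> tu un0; rewrite lt_neqAle log_term_ge0 andbT; apply/negP => /eqP T0.
have [su cK sO] := tu.
have [i1 i2 i3 i4 E] := energy_identity D (supp u) u 0 N5 D_gt0 cK (suppD u tu) su (supp0 u).
pose g x := u x ^+ 2 / enorm x ^+ 4 * \prod_(1 <= j < k.+1) Xlog j (enorm x / D) ^+ 2.
have g0 x : 0 <= g x.
  rewrite mulr_ge0//; last by apply: prodr_ge0 => j _; exact: sqr_ge0.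
  by rewrite divr_ge0 ?sqr_ge0// exprn_ge0// enorm_ge0.
have I0 : (\int[lebesgue_rV N]_x `|(g x)%:E| = 0)%E.
  rewrite [RHS]T0 /log_term (off u)//; last by move=> x Kx; rewrite supp0// expr0n !mul0r.
  by apply: eq_integral => x _; rewrite gee0_abs// lee_fin.
have mg : measurable_fun setT (fun x => (g x)%:E) by case/integrableP: (i3 k).
have /= A := (ae_eq_integral_abs (lebesgue_rV N) measurableT mg).1 I0.
have Nu : (lebesgue_rV N).-negligible [set x | u x != 0].
  apply: (negligibleS _ (negligibleU A (ae_rV_coord_neq0 N))) => x /= ux.
  apply: contrapT => /not_orP[/contrapT /(_ Logic.I) gx /contrapT xi].
  have x0 : x != 0.
    apply/eqP => xE; have := xi (Ordinal (leq_trans (isT : (0 < 5)%N) N5)).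
    by rewrite xE mxE eqxx.
  have xD : enorm x < D.
    by apply: (suppD u tu); apply: contrapT => /supp0 /eqP; rewrite (negbTE ux).
  have s0 := sl_lt0 D D_gt0 x x0 xD.
  suff : 0 < g x by move: gx => [->]; rewrite ltxx.
  rewrite /g mulr_gt0//.
    by apply: divr_gt0; [rewrite exprn_even_gt0|rewrite exprn_gt0 ?enorm_gt0].
  apply: prodr_gt0 => j _; rewrite exprn_gt0//.
  by rewrite -expR_sl ?D_gt0//; exact: Xs_gt0.
have [x ux] : exists x, u x != 0.
  by apply: contrapT => /forallNP u0; apply: un0; apply/funext => x; apply/eqP/negPn/negP/u0.
have : nbhs x [set y | u y != 0].
  have cu : {for x, continuous u} by exact: (su [::]).1.
  by apply: (cu [set t : R | t != 0]); apply: open_nbhs_nbhs; split => //; exact: open_neq.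
move=> /nbhs_ballP[d /= d0 dB].
have := lebesgue_rV_box_gt0 N x d d0.
have mB : measurable (ball x d) by apply: open_measurable_rV; exact: ball_open.
by rewrite (measure_negligible mB (negligibleS dB Nu)) ltxx.
Qed.

Lemma rellich_quotient_ge k u : (1 <= k)%N -> test_function Omega u -> u <> (fun=> 0) ->
  (c%:E <= (bilaplace_energy Omega u - (a ^+ 2)%:E * rellich_term Omega u
             - c%:E * \sum_(1 <= i < k) log_term Omega D i u) / log_term Omega D k u)%E.
Proof.
move=> k1 tu un0; have [fT _ [fE fR _]] := rellich_identity 0 u tu.
have := log_term_gt0 k u tu un0; rewrite sum_log_termE// -(fineK fE) -(fineK fR) -(fineK (fT k)).
rewrite lte_fin => T0; rewrite inver gt_eqF//.
suff H : (c%:E <= ((fine (bilaplace_energy Omega u) - a ^+ 2 * fine (rellich_term Omega u)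
    - c * (\sum_(1 <= i < k) fine (log_term Omega D i u))) / fine (log_term Omega D k u))%:E)%E.
  exact: H.
rewrite lee_fin ler_pdivlMr//.
have := rellich_log_inequality_fine k u tu; rewrite big_nat_recr//=.
by set s := \sum_(1 <= i < k) _; set t := fine (log_term _ _ _ _); lra.
Qed.

End inequality.

(** * Near-extremal functions *)

Section iterated_log_asymptotics.
Context {R : realType}.
Implicit Types (s t : R).

Lemma Xs_lt j s t : s < t -> t < 0 -> Xs j s < Xs j t.
Proof.
move=> st t0; have s0 := lt_trans st t0.
elim: j => [|j IH]; first by rewrite !Xs0 ltr_expR.
have := Xs_gt0 j.+1 s s0; have := Xs_gt0 j.+1 t t0; rewrite !XsS !invr_gt0 => h1 h2.
by rewrite ltf_pV2 ?posrE// ltrD2l ltrN2 ltr_ln ?posrE ?Xs_gt0.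
Qed.

(** This is the inequality 1 + y <= exp y at y = - ln X_j. *)
Lemma Xs_leS j s : s < 0 -> Xs j s <= Xs j.+1 s.
Proof.
move=> s0; have X0 := Xs_gt0 j s s0; have := Xs_gt0 j.+1 s s0.
rewrite XsS invr_gt0 => h; rewrite -[leLHS]invrK lef_pV2 ?posrE ?invr_gt0//.
by rewrite -[leRHS]lnK ?posrE ?invr_gt0// lnV ?posrE// expR_ge1Dx.
Qed.

Lemma Xs_le i j s : s < 0 -> (i <= j)%N -> Xs i s <= Xs j s.
Proof.
move=> s0; elim: j => [|j IH]; first by rewrite leqn0 => /eqP ->.
rewrite leq_eqVlt => /orP[/eqP -> //|]; rewrite ltnS => /IH ij.
exact: le_trans ij (Xs_leS j s s0).
Qed.

(** The recursion is inverted: 1 / X_(j+1) = y means 1 / X_j = exp (y - 1). It provides points at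
    which the argument of the bump has a prescribed value. *)
Lemma Xs_surj j (y : R) : 1 < y -> exists2 s, s < 0 & (Xs j s)^-1 = y.
Proof.
elim: j y => [|j IH] y y1.
  have y0 : 0 < y by exact: lt_trans y1.
  exists (- ln y); first by rewrite oppr_lt0 -ln1 ltr_ln ?posrE.
  by rewrite Xs0 expRN invrK lnK.
have [|s s0 sE] := IH (expR (y - 1)); first by rewrite expR_gt1 subr_gt0.
exists s => //; rewrite XsS invrK -[Xs j s]invrK sE lnV ?posrE ?expR_gt0//.
by rewrite opprK expRK addrC subrK.
Qed.

Lemma Xs1E s : s < 0 -> Xs 1 s = expR (1 - (Xs 2 s)^-1).
Proof.
move=> s0; rewrite (XsS 1) invrK opprB addrC subrK lnK// posrE; exact: Xs_gt0.
Qed.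

Lemma Ps_ge p s : s < 0 -> Xs 1 s * Xs 2 s ^+ p <= Ps p.+1 s.
Proof.
move=> s0; elim: p => [|p IH]; first by rewrite PsS Ps0 expr0 mulr1 mul1r.
rewrite PsS exprSr mulrA; apply: ler_pM => //.
- by rewrite mulr_ge0 ?exprn_ge0// ltW// Xs_gt0.
- by rewrite ltW// Xs_gt0.
- exact: Xs_le.
Qed.

(* The first factor decays exponentially in [(Xs 2 s)^-1], the others
   are bounded below by [Xs 2 s]. *)
Lemma Xs1_sqr_le_Ps p (eps : R) : 0 < eps -> exists2 L : R, 0 < L &
  forall s, s < 0 -> L <= (Xs p.+2 s)^-1 -> Xs 1 s ^+ 2 <= eps * Ps p.+1 s.
Proof.
move=> eps0; pose F : R := expR 1 * (p.+2)`!%:R.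
have F0 : 0 < F by rewrite mulr_gt0 ?expR_gt0// ltr0n fact_gt0.
exists (F / eps); first exact: divr_gt0.
move=> s s0 Ls; set v := (Xs 2 s)^-1.
have v0 : 0 < v by rewrite invr_gt0 Xs_gt0.
have Lv : F / eps <= v.
  by apply: le_trans Ls _; rewrite lef_pV2 ?posrE ?Xs_gt0//; exact: Xs_le.
have X1 : Xs 1 s <= eps * Xs 2 s ^+ p.
  rewrite Xs1E// -/v -[Xs 2 s]invrK -/v exprVn ler_pdivlMr ?exprn_gt0//.
  rewrite expRD expRN mulrAC ler_pdivrMr ?expR_gt0//.
  have := expR_ge1Dxn p.+1 (ltW v0) => ev.
  have {}ev : v ^+ p.+2 / (p.+2)`!%:R <= expR v by apply: le_trans ev; rewrite lerDr.
  apply: (@le_trans _ _ (eps * (v ^+ p.+2 / (p.+2)`!%:R))); last by rewrite ler_pM2l.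
  have vv : 1 <= v.
    by have /andP[X0 X1] := Xs_itv 2 s s0; rewrite /v invf_ge1// ltW.
  rewrite mulrA ler_pdivlMr ?ltr0n ?fact_gt0// mulrAC -/F.
  rewrite [v ^+ p.+2]exprS mulrA; apply: ler_pM => //.
  - exact: ltW.
  - by rewrite exprn_ge0// ltW.
  - by rewrite -ler_pdivrMl// mulrC.
  - by rewrite exprS ler_peMl// exprn_ge0// ltW.
rewrite expr2; apply: (@le_trans _ _ (Xs 1 s * (eps * Xs 2 s ^+ p))).
  by apply: ler_wpM2l => //; rewrite ltW// Xs_gt0.
by rewrite mulrCA ler_pM2l//; exact: Ps_ge.
Qed.

End iterated_log_asymptotics.

(** * The radial profile of the near-extremal functions *)

Section profile.
Context {R : realType}.
Variables (k : nat) (L b : R).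
Implicit Types (s : R).

(* [height' = - Ps k], so the derivatives of [pull g], for a fixed [g], are
   smaller than [Ps k] by a factor [L]. *)
Definition height s : R := (Xs k.+1 s)^-1.
(** For s < 0 this is P_k^(-1/2); the exponential form yields psi' = - (S / 2) psi by the chain
    rule. *)
Definition psi s : R := expR (- 2^-1 * ln (Ps k s)).
(** The factor r^-b of the overview up to the constant D^b, since s = ln (r / D). *)
Definition expw s : R := expR (- b * s).

Lemma psi_gt0 s : 0 < psi s. Proof. exact: expR_gt0. Qed.

Lemma psi_sqr s : s < 0 -> psi s ^+ 2 = (Ps k s)^-1.
Proof.
move=> s0; rewrite /psi -expRM_natl mulrA mulrN mulfV// mulN1r expRN lnK//.
by rewrite posrE Ps_gt0.
Qed.

Lemma is_derive_height s : s < 0 -> is_derive s (1 : R) height (- Ps k s).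
Proof.
move=> s0; rewrite (_ : height = fun s => 1 - ln (Xs k s)); last first.
  by apply/funext => t; rewrite /height XsS invrK.
have d1 := is_derive_comp_dir _ _ _ _ _ _ (is_derive1_ln (Xs_gt0 k s s0)) (is_derive_Xs k s s0).
apply: (is_derive_eq (is_deriveB (is_derive_cst (1 : R) s (1 : R)) d1)).
by rewrite sub0r mulrCA mulVf ?mulr1// gt_eqF// Xs_gt0.
Qed.

Lemma is_derive_psi s : s < 0 -> is_derive s (1 : R) psi (- 2^-1 * Ss k s * psi s).
Proof.
move=> s0; have P0 := Ps_gt0 k s s0.
have d1 := is_derive_comp_dir _ _ _ _ _ _ (is_derive1_ln P0) (is_derive_Ps k s s0).
have d2 := is_derive_comp_dir (@expR R) (fun t => - 2^-1 * ln (Ps k t)) s (1 : R) _ _ (is_derive_expR _) (is_deriveZ (- 2^-1) d1).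
apply: (is_derive_eq d2); rewrite /GRing.scale/= -/(psi s).
by rewrite [(Ps k s)^-1 * _]mulrA mulVf ?gt_eqF//; ring.
Qed.

Lemma is_derive_expw s : is_derive s (1 : R) expw (- b * expw s).
Proof.
have d := is_derive_comp_dir (@expR R) (fun t => - b * t) s (1 : R) _ _ (is_derive_expR _) (is_deriveZ (- b) (is_derive_id s (1 : R))).
by apply: (is_derive_eq d); rewrite /GRing.scale/= mulr1 mulrC.
Qed.

Local Notation neg := [set s : R | s < 0].
Let oN : open neg. Proof. exact: open_lt. Qed.
Let oP : open [set t : R | 0 < t]. Proof. exact: open_gt. Qed.

Lemma C1k_height j : C1k j neg height.
Proof.
apply: (Ck_comp _ _ _ _ (fun x : R => x^-1) (Xs k.+1) oN oP).
- by move=> s; exact: Xs_gt0.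
- exact: C1k_inv.
- exact: C1k_Xs.
Qed.

Lemma C1k_psi j : C1k j neg psi.
Proof.
apply: (Ck_comp _ _ _ _ (@expR R) (fun s => - 2^-1 * ln (Ps k s)) oN openT) => //.
  by apply: C1k_expR; exact: openT.
apply: CkM => //; first exact: Ck_cst.
apply: (Ck_comp _ _ _ _ (@ln R) (Ps k) oN oP).
- by move=> s; exact: Ps_gt0.
- exact: C1k_ln.
- exact: C1k_Ps.
Qed.

Lemma C1k_expw j : C1k j neg expw.
Proof.
apply: (Ck_comp _ _ _ _ (@expR R) (fun s => - b * s) oN openT) => //.
  by apply: C1k_expR; exact: openT.
by apply: CkM => //; [exact: Ck_cst|exact: C1k_id].
Qed.

Definition pull (g : R -> R) s : R := g (L^-1 * height s).

Lemma is_derive_pull (g : R -> R) (dg : R -> R) s : s < 0 ->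
  (forall t : R, is_derive t (1 : R) g (dg t)) ->
  is_derive s (1 : R) (pull g) (- Ps k s * (L^-1 * pull dg s)).
Proof.
move=> s0 gdg.
have d := is_derive_comp_dir g (fun t => L^-1 * height t) s (1 : R) _ _ (gdg _) (is_deriveZ L^-1 (is_derive_height s s0)).
by apply: (is_derive_eq d); rewrite /pull /GRing.scale/=; ring.
Qed.

Lemma C1k_pull (g : R -> R) j : C1k j setT g -> C1k j neg (pull g).
Proof.
move=> Cg; apply: (Ck_comp _ _ _ _ g (fun s => L^-1 * height s) oN openT) => //.
by apply: CkM => //; [exact: Ck_cst|exact: C1k_height].
Qed.

Definition profile s : R := expw s * (psi s * pull bump s).

Lemma C1k_profile j : C1k j neg profile.
Proof.
apply: CkM => //; first exact: C1k_expw.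
by apply: CkM => //; [exact: C1k_psi|apply: C1k_pull; exact: C1k_bump].
Qed.

Definition dbump : R -> R := fun t => 'D_(1 : R) (@bump R) t.
Definition ddbump : R -> R := fun t => 'D_(1 : R) dbump t.

Lemma is_derive_bump (t : R) : is_derive t (1 : R) bump (dbump t).
Proof. by apply/derivableP; exact: ((C1k_bump 1).2 tt).1. Qed.

Lemma is_derive_dbump (t : R) : is_derive t (1 : R) dbump (ddbump t).
Proof. by apply/derivableP; exact: ((((C1k_bump 2).2 tt).2).2 tt).1. Qed.

Definition profile1 s : R := expw s * (psi s *
  (- b * pull bump s - 2^-1 * (Ss k s * pull bump s) - Ps k s * (L^-1 * pull dbump s))).

(** Arranged so that f'' + 2 b f' + b^2 f, for f the profile, is the leading product. In it S^2
    cancels because psi'' = - (V / 4) psi, and the terms in [dbump] cancel between 2 psi' z' and psi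
    z'', with z the pulled-back bump. *)
Definition profile2 s : R := expw s * (psi s * (Ps k s ^+ 2 * (L^-1 * (L^-1 * pull ddbump s))
    - Vs k s / 4 * pull bump s)) - 2 * b * profile1 s - b ^+ 2 * profile s.

Lemma is_derive_profile s : s < 0 -> is_derive s (1 : R) profile (profile1 s).
Proof.
move=> s0; have d1 := is_deriveM (is_derive_psi s s0) (is_derive_pull _ _ s s0 is_derive_bump).
have d2 := is_deriveM (is_derive_expw s) d1.
apply: (is_derive_eq d2); rewrite /GRing.scale/= /profile1 [(psi * _) s]/GRing.mul/=; ring.
Qed.

Lemma is_derive_profile1 s : s < 0 -> is_derive s (1 : R) profile1 (profile2 s).
Proof.
move=> s0.
have dp0 := is_derive_pull _ _ s s0 is_derive_bump.
have dp1 := is_derive_pull _ _ s s0 is_derive_dbump.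
have e1 := is_deriveM (is_derive_Ss k s s0) dp0.
have e2 := is_deriveM (is_derive_Ps k s s0) (is_deriveZ L^-1 dp1).
have e3 := is_deriveB (is_deriveB (is_deriveZ (- b) dp0) (is_deriveZ 2^-1 e1)) e2.
have e4 := is_deriveM (is_derive_expw s) (is_deriveM (is_derive_psi s s0) e3).
apply: (is_derive_eq e4); rewrite /GRing.scale/= /profile2 /profile1 /profile.
have fM (f g : R -> R) : (f * g) s = f s * g s by [].
have fB (f g : R -> R) : (f - g) s = f s - g s by [].
have fZ (q : R) (f : R -> R) : (q \*: f) s = q * f s by [].
rewrite !(fB, fM, fZ) /GRing.scale/=.
move: (expw s) (psi s) (Ps k s) (Ss k s) (Vs k s) (pull bump s) (pull dbump s)
  (pull ddbump s) (L^-1) => E0 p0 P0 S0 V0 z0 z1 z2 l; by field.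
Qed.

End profile.

(** * Radial functions supported in an annulus *)

Section radial_functions.
Context {R : realType} {n : nat} (D s0 s1 : R).
Hypothesis n5 : (5 <= n)%N.
Hypothesis D0 : 0 < D.
Hypothesis s10 : s1 < 0.
Implicit Types (x : 'rV[R]_n) (g : R -> R).

Local Notation dir := (@rV_dir R n).

Definition annulus : set 'rV[R]_n := [set x | D * expR s0 <= enorm x <= D * expR s1].

Lemma annulus_neq0 x : annulus x -> x != 0.
Proof.
move=> /andP[xs _]; apply/eqP => xE; move: xs.
by rewrite xE enorm0 leNgt mulr_gt0// expR_gt0.
Qed.

Lemma annulus_lt x : annulus x -> enorm x < D.
Proof.
by move=> /andP[_ xs]; apply: le_lt_trans xs _; rewrite gtr_pMr// expR_lt1.
Qed.

Lemma annulusP x : (s0 <= sl D x <= s1) -> annulus x.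
Proof.
have [->|x0] := eqVneq x 0.
  (* At the origin [sl] is ln 0 = 0 by convention, which exceeds the negative [s1]. *)
  by rewrite /sl enorm0 mul0r ln0// => /andP[_]; rewrite leNgt s10.
have e0 : 0 < enorm x / D by rewrite divr_gt0// enorm_gt0.
rewrite /sl -ler_expR -[X in _ && X]ler_expR lnK ?posrE// => /andP[h1 h2].
by apply/andP; split; rewrite mulrC -?ler_pdivlMr// -ler_pdivrMr.
Qed.

Lemma compact_annulus : compact annulus.
Proof.
apply: bounded_closed_compact.
  exists (D * expR s1); split; first exact: num_real.
  move=> M DM x /= /andP[_ xD]; apply: le_trans (ltW DM); apply: le_trans xD.
  rewrite [leLHS]/Num.Def.normr/= mx_normrE; apply/bigmax_leP => /=; split; first exact: enorm_ge0.
  by move=> [i j] _ /=; rewrite ord1; exact: ler_coord_enorm.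
rewrite (_ : annulus = (@enorm R n) @^-1` `[D * expR s0, D * expR s1]%classic).
  by apply: closed_comp; [move=> x _; exact: continuous_enorm|exact: itv_closed].
by apply/seteqP; split => x /=; rewrite in_itv.
Qed.

Definition compact_profile g : Prop :=
  (forall s, s < 0 -> {for s, continuous g}) /\ (forall s, ~~ (s0 <= s <= s1) -> g s = 0).

Lemma compact_profile_bounded g : compact_profile g -> exists C : R, forall s, `|g s| <= C.
Proof.
move=> [cg g0]; have : compact (g @` `[s0, s1]%classic).
  apply: continuous_compact; last exact: segment_compact.
  apply: continuous_in_subspaceT => s; rewrite inE/= in_itv/= => /andP[_ ss1].
  by apply: cg; exact: le_lt_trans s10.
move=> /compact_bounded [M [_ HM]]; exists (`|M| + 1) => s.
have [s01|s01] := boolP (s0 <= s <= s1); last by rewrite g0// normr0 addr_ge0.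
by apply: HM; [rewrite ltr_pwDr// ler_norm|exists s].
Qed.

Lemma compact_profile_tame g : compact_profile g -> tame D 0 (fun x : 'rV[R]_n => g (sl D x)).
Proof.
move=> cg; have [C gC] := compact_profile_bounded g cg.
by apply: (tame_sl D D0 g C) => // s; exact: cg.1.
Qed.

Lemma compact_profile_off g : compact_profile g -> forall x, ~ annulus x -> g (sl D x) = 0.
Proof. by move=> [_ g0] x Kx; apply: g0; apply/negP => /annulusP. Qed.

Lemma integrable_radial g : compact_profile g ->
  (lebesgue_rV n).-integrable setT (fun x => (rho x ^+ 2 * g (sl D x))%:E).
Proof.
move=> cg; have tg := compact_profile_tame g cg.
apply: (integrable_tame D annulus n5 D0 compact_annulus annulus_lt (fun x => rho x ^+ 2 * g (sl D x))).
  by eapply tame_le; last tame_tac.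
by move=> x Kx; rewrite compact_profile_off// mulr0.
Qed.

Lemma is_derive_radial g (g1 : R -> R) x i : x != 0 -> enorm x < D ->
  (forall s : R, s < 0 -> is_derive s (1 : R) g (g1 s)) ->
  is_derive x (dir i) (fun z => g (sl D z)) (yc i x * g1 (sl D x)).
Proof.
move=> x0 xD dg; rewrite mulrC.
by apply: (is_derive_comp_dir g) (is_derive_sl D D0 x i x0); apply: dg; exact: sl_lt0.
Qed.

(** The integrand is the divergence of the field y rho g(s). This replaces integration by parts in
    polar coordinates: the factor n - 4 is what the weight |x|^-4 leaves of the Jacobian r^(n-1). *)
Lemma integral_radial_derivative g (g1 : R -> R) :
  (forall s : R, s < 0 -> is_derive s (1 : R) g (g1 s)) -> compact_profile g -> compact_profile g1 ->
  (\int[lebesgue_rV n]_x (rho x ^+ 2 * ((n%:R - 4) * g (sl D x) + g1 (sl D x)))%:E = 0)%E.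
Proof.
move=> dg cg cg1.
have tg := compact_profile_tame g cg; have tg1 := compact_profile_tame g1 cg1.
pose F i x : R := yc i x * rho x * g (sl D x).
pose dF i x : R := (rho x - 2 * yc i x * yc i x) * rho x * g (sl D x)
  + yc i x * (- 2 * yc i x * rho x) * g (sl D x) + yc i x * rho x * (yc i x * g1 (sl D x)).
have F0 i x : ~ annulus x -> F i x = 0.
  by move=> Kx; rewrite /F compact_profile_off// mulr0.
have dF0 i x : ~ annulus x -> dF i x = 0.
  by move=> Kx; rewrite /dF !compact_profile_off// !mulr0 !addr0.
have tdF i : tame D 4 (dF i) by rewrite /dF; eapply tame_le; last tame_tac.
have off x : D < enorm x -> ~ annulus x.
  by move=> xD /annulus_lt xD'; have := lt_trans xD xD'; rewrite ltxx.
have idF i : (lebesgue_rV n).-integrable setT (fun x => (dF i x)%:E).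
  exact: (integrable_tame D annulus n5 D0 compact_annulus annulus_lt (dF i) (tdF i) (dF0 i)).
have Z i : (\int[lebesgue_rV n]_x (dF i x)%:E = 0)%E.
  apply: (integral_partial0 n i (F i) (dF i) D) => //.
  - by apply: leq_trans n5.
  - move=> x x0; have [Kx|Kx] := pselect (annulus x); last first.
      apply: (@near_eq_is_derive _ _ _ (cst 0)); last by rewrite dF0//; exact: is_derive_cst.
      have oK : open (~` annulus).
        by rewrite openC; apply: compact_closed; [exact: norm_hausdorff|exact: compact_annulus].
      by near=> z; rewrite F0//; near: z; exact: open_nbhs_nbhs.
    have d1 := is_deriveM (is_deriveM (is_derive_yc x i i x0) (is_derive_rho x i x0))
      (is_derive_radial g g1 x i x0 (annulus_lt x Kx) dg).
    apply: (is_derive_eq d1); rewrite /dF eqxx /GRing.scale/= [(yc i * rho) x]/GRing.mul/=.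
    by rewrite mulr1n; ring.
  - exact: (continuous_tame D annulus compact_annulus annulus_lt 4 (dF i) (tdF i) (dF0 i)).
  - by move=> x xD; apply: F0; exact: off.
  - by move=> x xD; apply: dF0; exact: off.
have [_ E] := integral_EFin_sum _ (lebesgue_rV n) n dF idF.
transitivity (\int[lebesgue_rV n]_x (\sum_i dF i x)%:E)%E; last by rewrite E big1.
apply: eq_integral => x _; congr _%:E.
have [->|x0] := eqVneq x 0.
  have r0 : rho (0 : 'rV[R]_n) = 0 by rewrite rhoE enorm0 expr0n invr0.
  rewrite r0 expr0n mul0r big1// => i _; rewrite /dF r0.
  by rewrite /yc r0 !mulr0 !mul0r !addr0.
rewrite /dF; have yE := sum_yc_sqr x x0.
rewrite (eq_bigr (fun i => rho x ^+ 2 * g (sl D x) + (rho x * (g1 (sl D x) - 4 * g (sl D x))) * yc i x ^+ 2)).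
  rewrite big_split/= sumr_const card_ord -mulr_sumr yE -mulr_natl; ring.
by move=> i _; ring.
Unshelve. all: by end_near. Qed.

Lemma partial_radial g (g1 : R -> R) x i : x != 0 -> enorm x < D ->
  (forall s : R, s < 0 -> is_derive s (1 : R) g (g1 s)) ->
  partial i (fun z => g (sl D z)) x = yc i x * g1 (sl D x).
Proof. by move=> x0 xD dg; have [_ ] := is_derive_radial g g1 x i x0 xD dg. Qed.

Lemma laplacian_radial g (g1 g2 : R -> R) x : x != 0 -> enorm x < D ->
  (forall s : R, s < 0 -> is_derive s (1 : R) g (g1 s)) ->
  (forall s : R, s < 0 -> is_derive s (1 : R) g1 (g2 s)) ->
  laplacian (fun z : 'rV[R]_n => g (sl D z)) x = rho x * (g2 (sl D x) + (n%:R - 2) * g1 (sl D x)).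
Proof.
move=> x0 xD dg dg1; rewrite /laplacian.
have E i : partial i (partial i (fun z : 'rV[R]_n => g (sl D z))) x =
    rho x * g1 (sl D x) + (g2 (sl D x) - 2 * g1 (sl D x)) * yc i x ^+ 2.
  rewrite [LHS]/partial (@near_eq_derive _ _ _ _ (fun z => yc i z * g1 (sl D z))); last first.
    near=> z; have [z0 zD] : punctured_ball D z.
      by near: z; apply: open_nbhs_nbhs; split; [exact: open_punctured_ball|].
    exact: partial_radial.
  have d1 := is_deriveM (is_derive_yc x i i x0) (is_derive_radial g1 g2 x i x0 xD dg1).
  have [_ ->] := d1; rewrite /GRing.scale/= eqxx mulr1n; ring.
rewrite (eq_bigr _ (fun i _ => E i)) big_split/= sumr_const card_ord -mulr_sumr.
by rewrite (sum_yc_sqr x x0) -mulr_natl; ring.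
Unshelve. all: by end_near. Qed.

End radial_functions.

Section bump_energy.
Context {R : realType}.

Definition bump_energy (t : R) : R := bump t ^+ 2 + dbump t ^+ 2 + ddbump t ^+ 2.

Lemma bump0 (t : R) : t < 1 \/ 2 < t -> bump t = 0.
Proof. by move=> H; apply: bump_eq0; case: H => /ltW; [left|right]. Qed.

Let derive_out (t : R) (h : R -> R) : (forall t, t < 1 \/ 2 < t -> h t = 0) ->
  t < 1 \/ 2 < t -> 'D_(1 : R) h t = 0.
Proof.
move=> h0 H; rewrite (@near_eq_derive _ _ _ _ (cst 0)) ?derive_cst//.
by case: H => H; near=> z; apply: h0; [left|right]; near: z; [exact: lt_nbhsl|exact: lt_nbhsr].
Unshelve. all: by end_near. Qed.

Lemma dbump0 (t : R) : t < 1 \/ 2 < t -> dbump t = 0.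
Proof. exact: (derive_out t _ bump0). Qed.

Lemma ddbump0 (t : R) : t < 1 \/ 2 < t -> ddbump t = 0.
Proof. exact: (derive_out t _ dbump0). Qed.

Lemma continuous_dbump : continuous (@dbump R).
Proof. by move=> t; exact: ((C1k_bump 1).2 tt).2.1. Qed.

Lemma continuous_ddbump : continuous (@ddbump R).
Proof. by move=> t; exact: ((((C1k_bump 2).2 tt).2).2 tt).2.1. Qed.

Lemma bump_energy_out (t : R) : t < 1 \/ 2 < t -> bump_energy t = 0.
Proof. by move=> Ht; rewrite /bump_energy bump0// dbump0// ddbump0// expr0n/= !addr0. Qed.

Lemma continuous_bump_energy : continuous bump_energy.
Proof.
have sqc (h : R -> R) : continuous h -> continuous (fun t => h t ^+ 2).
  by move=> ch t; apply: cvgM; exact: ch.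
move=> t; apply: cvgD; [apply: cvgD|]; apply: sqc.
- exact: continuous_bump.
- exact: continuous_dbump.
- exact: continuous_ddbump.
Qed.

End bump_energy.

(** * The near-extremal functions and their remainder *)

Section near_extremal.
Context {R : realType} {N : nat} (Omega : set 'rV[R]_N) (D : R).
Hypothesis N5 : (5 <= N)%N.
Hypothesis oO : open Omega.
Hypothesis bO : bounded_set Omega.
Hypothesis O0 : Omega 0.
Hypothesis sD : sup [set enorm x | x in Omega] <= D.

Let D0 : 0 < D. Proof. exact: (D_gt0 Omega D N5 oO bO O0 sD). Qed.

Variables (k : nat) (L e1 s0 : R).
(** The bump lives where [L < height < 2 L]. The inner end is exactly [s0]. At the outer end,
    [height] is at most 1 / X_1 = 1 - s, so that s <= 1 - L: an explicit bound which moves the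
    support towards the origin as [L] grows. *)
Let s1 : R := 1 - L.
Hypothesis L1 : 1 < L.
Hypothesis heightL : height k s0 = 2 * L.
Hypothesis s00 : s0 < 0.
Hypothesis e10 : 0 < e1.
Hypothesis asympt : forall s : R, s < 0 -> L <= height k s -> Xs 1 s ^+ 2 <= e1 * Ps k s.
Hypothesis kpos : (0 < k)%N.
Hypothesis annO : forall x : 'rV[R]_N, enorm x <= D * expR s1 -> Omega x.

Implicit Types (s : R) (x : 'rV[R]_N) (h : R -> R).

Let b : R := (N%:R - 4) / 2.
Let a : R := N%:R * (N%:R - 4) / 4.

Let s10 : s1 < 0. Proof. by rewrite /s1 subr_lt0. Qed.
Let L0 : 0 < L. Proof. exact: lt_trans L1. Qed.
Let a0 : 0 <= a.
Proof. by rewrite /a divr_ge0// mulr_ge0// subr_ge0 ler_nat (leq_trans _ N5). Qed.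

(** Where |x| >= D, and at the origin because ln 0 = 0, [sl] is not negative and the formulas for
    the profile mean nothing; truncation makes them vanish there. *)
Definition cut (g : R -> R) s : R := if s < 0 then g s else 0.

Lemma near_cut (g : R -> R) s : s < 0 -> \forall t \near s, g t = cut g t.
Proof. by move=> s0'; near=> t; rewrite /cut ifT//; near: t; exact: lt_nbhsl. Unshelve. all: by end_near. Qed.

Lemma is_derive_cut (g g1 : R -> R) s : s < 0 -> is_derive s (1 : R) g (g1 s) ->
  is_derive s (1 : R) (cut g) (cut g1 s).
Proof.
by move=> s0'; rewrite /cut s0'; apply: near_eq_is_derive; exact: near_cut.
Qed.

Let pull_eq0 h s : s < 0 -> (forall t, t < 1 \/ 2 < t -> h t = 0) ->
  ~~ (s0 <= s <= s1) -> pull k L h s = 0.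
Proof.
move=> sn h0; rewrite negb_and -!ltNge => H; apply: h0.
rewrite ltr_pdivrMl// mulr1 ltr_pdivlMl// [L * 2]mulrC -heightL.
case/orP: H => [ss|ss]; [right|left].
  by rewrite /height ltf_pV2 ?posrE ?Xs_gt0//; exact: Xs_lt.
apply: (@le_lt_trans _ _ (1 - s)); last by move: ss; rewrite /s1; lra.
have -> : 1 - s = (Xs 1 s)^-1 by rewrite XsS invrK Xs0 expRK.
by rewrite /height lef_pV2 ?posrE ?Xs_gt0//; exact: Xs_le.
Qed.

Local Notation neg := [set s : R | s < 0].
Let oN : open neg. Proof. exact: open_lt. Qed.

Lemma compact_profile_cut h (f : R -> R) : continuous h -> (forall t, t < 1 \/ 2 < t -> h t = 0) ->
  C1k 0 neg f -> compact_profile s0 s1 (cut (fun s => f s * pull k L h s)).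
Proof.
move=> ch h0 cf; split.
  have C0 : C1k 0 neg (cut (fun s => f s * pull k L h s)).
    apply: (Ck_eq _ _ _ (fun s => f s * pull k L h s)) => //.
      by move=> s /= sn; rewrite /cut sn.
    have Ch : C1k 0 setT h by split => // t _; exact: ch.
    by apply: CkM => //; exact: (C1k_pull k L h 0 Ch).
  by move=> s sn; exact: (C0.1 s sn).
by move=> s sn; rewrite /cut; case: ifPn => // s0'; rewrite pull_eq0// mulr0.
Qed.

Let G := cut (profile k L b).
Let G1 := cut (profile1 k L b).
Let G2 := cut (profile2 k L b).
Definition near_extremal x : R := G (sl D x).
Local Notation u := near_extremal.

Let dG s : s < 0 -> is_derive s (1 : R) G (G1 s).
Proof. by move=> sn; exact: (is_derive_cut _ _ s sn (is_derive_profile k L b s sn)). Qed.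

Let dG1 s : s < 0 -> is_derive s (1 : R) G1 (G2 s).
Proof. by move=> sn; exact: (is_derive_cut _ _ s sn (is_derive_profile1 k L b s sn)). Qed.

Let cpG : compact_profile s0 s1 G.
Proof.
have -> : G = cut (fun s => (expw b s * psi k s) * pull k L bump s).
  by apply/funext => s; rewrite /G /cut /profile mulrA.
apply: compact_profile_cut; [exact: continuous_bump|exact: bump0|].
by apply: CkM => //; [exact: (C1k_expw b 0)|exact: (C1k_psi k 0)].
Qed.

Let K := @annulus R N D s0 s1.
Let cK : compact K. Proof. exact: compact_annulus. Qed.
Let KD x : K x -> enorm x < D. Proof. exact: annulus_lt. Qed.
Let u0 x : ~ K x -> u x = 0. Proof. exact: (compact_profile_off _ _ _ D0 s10 _ cpG). Qed.

Let oKC : open (~` K).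
Proof. by rewrite openC; apply: compact_closed; [exact: norm_hausdorff|exact: cK]. Qed.

Let su : smooth u.
Proof.
apply: Ck_smooth => j.
(* Two open sets cover the space: on the punctured ball [u] is a composition of smooth functions,
   off the annulus it is 0. *)
have UV : [set: 'rV[R]_N] `<=` punctured_ball D `|` ~` K.
  move=> x _; have [Kx|Kx] := pselect (K x); [left|by right].
  by split; [exact: annulus_neq0 Kx|exact: KD].
apply: (Ck_subset _ _ _ _ _ UV); apply: Ck_setU; last first.
  apply: (Ck_eq _ _ _ (fun=> 0)) => //; first by move=> x Kx; rewrite u0.
  exact: Ck_cst.
have oU := @open_punctured_ball R N D.
apply: (Ck_eq _ _ _ (fun x => profile k L b (sl D x))) => //.
  by move=> x [x0 xD]; rewrite /u /G /cut sl_lt0.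
apply: (Ck_comp _ _ _ neg (profile k L b) (sl D) oU oN).
- by move=> x [x0 xD]; exact: sl_lt0.
- exact: C1k_profile.
- by apply: Ck_subset (Ck_sl D D0 j) => x [].
Qed.

Lemma test_function_near_extremal : test_function Omega u.
Proof.
have cl : closure [set x | u x != 0] `<=` K.
  rewrite (closure_id K).1; last by apply: compact_closed; [exact: norm_hausdorff|exact: cK].
  apply: closure_subset => x /= ux; apply: contrapT => /u0 /eqP; by rewrite (negbTE ux).
split => //.
  by apply: (subclosed_compact _ cK cl); exact: closed_closure.
by move=> x /cl /andP[_ xs]; exact: annO.
Qed.

Lemma near_extremal_neq0 : u <> (fun=> 0).
Proof.
(* At height 3/2 L the bump is evaluated at 3/2, inside (1, 2). *)
have [|s sn sE] := Xs_surj k.+1 (3 / 2 * L); first by move: L1; lra.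
pose i0 : 'I_N := Ordinal (leq_trans (isT : (0 < 5)%N) N5).
pose x : 'rV[R]_N := (D * expR s) *: delta_mx 0 i0.
have xE : enorm x = D * expR s.
  rewrite enormZ ?mulr_ge0 ?expR_ge0 ?ltW// -[RHS]mulr1; congr (_ * _).
  rewrite /enorm (bigD1 i0)//= big1 ?addr0; last first.
    by move=> j ji; rewrite mxE (negbTE ji) andbF expr0n.
  by rewrite mxE !eqxx expr1n sqrtr1.
move=> /(congr1 (fun f => f x)); apply/eqP.
rewrite /u /sl xE mulrAC (mulfV (lt0r_neq0 D0)) mul1r expRK /G /cut sn /profile.
apply: mulf_neq0; first exact: lt0r_neq0 (expR_gt0 _).
apply: mulf_neq0; first exact: lt0r_neq0 (psi_gt0 _ _).
rewrite /pull /height sE mulrCA (mulVf (lt0r_neq0 L0)) mulr1 bump_neq0//.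
by apply/andP; split; lra.
Qed.

Let w s : R := expw b s ^+ 2 * Ps k s.
(** Up to the constant D^(N-4), the integrand of the functional I of the overview: rho^2 exp (-2 b
    s) is a multiple of r^-N, as 2 b = N - 4. *)
Let J h x : R := rho x ^+ 2 * cut (fun s => w s * pull k L h s) (sl D x).

Let Cw : C1k 0 neg w.
Proof.
apply: CkM => //; last exact: (C1k_Ps 0 k).
apply: (Ck_eq _ _ _ (fun s => expw b s * expw b s)) => //.
by apply: CkM => //; exact: (C1k_expw b 0).
Qed.

Let iJ h : continuous h -> (forall t, t < 1 \/ 2 < t -> h t = 0) ->
  (lebesgue_rV N).-integrable setT (fun x => (J h x)%:E).
Proof.
by move=> ch h0; apply: (integrable_radial D s0 s1 N5 D0 s10); exact: compact_profile_cut.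
Qed.

(** Apply the divergence formula to exp (-2 b s) H (height / L): the derivative of the exponential
    cancels (N - 4) g, and height' = - P_k produces the weight of [J] with the factor -1 / L. *)
Let integral_J_derive (H dH : R -> R) : (forall t : R, is_derive t (1 : R) H (dH t)) ->
  continuous dH -> (forall t, t < 1 \/ 2 < t -> H t = 0) -> (forall t, t < 1 \/ 2 < t -> dH t = 0) ->
  (\int[lebesgue_rV N]_x (J dH x)%:E = 0)%E.
Proof.
move=> HdH cdH H0 dH0.
have cH : continuous H.
  by move=> t; apply: differentiable_continuous; apply/derivable1_diffP; have [] := HdH t.
pose g := cut (fun s => expw b s ^+ 2 * pull k L H s).
pose g1 s := - (2 * b) * g s + - L^-1 * cut (fun s => w s * pull k L dH s) s.
have Ce : C1k 0 neg (fun s => expw b s ^+ 2).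
  apply: (Ck_eq _ _ _ (fun s => expw b s * expw b s)) => //.
  by apply: CkM => //; exact: (C1k_expw b 0).
have cg : compact_profile s0 s1 g by exact: compact_profile_cut.
have cJ := compact_profile_cut dH w cdH dH0 Cw.
have cg1 : compact_profile s0 s1 g1.
  split; last by move=> s ss; rewrite /g1 cg.2// cJ.2// !mulr0 addr0.
  move=> s sn; apply: cvgD; (apply: cvgM; first exact: cvg_cst); [exact: cg.1|exact: cJ.1].
have dg s : s < 0 -> is_derive s (1 : R) g (g1 s).
  move=> sn.
  have -> : g1 s = cut (fun s => - (2 * b) * (expw b s ^+ 2 * pull k L H s)
      + - L^-1 * (w s * pull k L dH s)) s by rewrite /g1 /g /cut sn.
  apply: (is_derive_cut (fun s => expw b s ^+ 2 * pull k L H s) (fun s => - (2 * b) * (expw b s ^+ 2 * pull k L H s)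
      + - L^-1 * (w s * pull k L dH s)) s sn).
  have de := is_deriveM (is_derive_expw b s) (is_derive_expw b s).
  have d := is_deriveM de (is_derive_pull k L H dH s sn HdH).
  have -> : (fun s => expw b s ^+ 2 * pull k L H s) = (expw b * expw b) * pull k L H.
    by apply/funext => t; rewrite expr2.
  apply: (is_derive_eq d); rewrite /GRing.scale/= [(expw b * expw b) s]/GRing.mul/= /w; ring.
have Z := integral_radial_derivative D s0 s1 N5 D0 s10 g g1 dg cg cg1.
have [_ ] := integral_EFinZ _ (lebesgue_rV N) (- L^-1) _ (iJ dH cdH dH0).
rewrite (_ : (\int[_]_x (_ * J dH x)%:E)%E = 0%E); last first.
  rewrite -[RHS]Z; apply: eq_integral => x _; congr _%:E.
  rewrite /J /g1; have -> : N%:R - 4 = 2 * b by rewrite /b; field.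
  by ring.
move=> /esym /eqP; rewrite mule_eq0 => /orP[|/eqP //].
by rewrite eqe oppr_eq0 invr_eq0 gt_eqF.
Qed.

Lemma log_term_near_extremal : log_term Omega D k u =
  (\int[lebesgue_rV N]_x (J (fun t => bump t ^+ 2) x)%:E)%E.
Proof.
have [_ _ sO] := test_function_near_extremal.
rewrite /log_term integral_mkcond; apply: eq_integral => x _; rewrite patchE.
have JE : u x ^+ 2 / enorm x ^+ 4 * \prod_(1 <= j < k.+1) Xlog j (enorm x / D) ^+ 2 =
   J (fun t => bump t ^+ 2) x.
  rewrite /J /u /G -rho_sqr /cut; case: ifPn => [sn|_]; last by rewrite expr0n !mul0r mulr0.
  have x0 : x != 0.
    by apply/eqP => xE; move: sn; rewrite xE /sl enorm0 mul0r ln0// ltxx.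
  rewrite prodrXl (_ : \prod_(1 <= j < k.+1) Xlog j (enorm x / D) = Ps k (sl D x)); last first.
    by rewrite /Ps /Xs expR_sl.
  (* The square of [psi] is 1 / P_k, so u^2 P_k^2 keeps a single P_k, the one in [w]. *)
  rewrite /profile /w /pull !exprMn psi_sqr//.
  have P0 := Ps_gt0 k (sl D x) sn; move: (Ps k (sl D x)) P0 => P0 P00.
  by field; rewrite gt_eqF.
case: ifPn => [_|/negP]; first by rewrite JE.
rewrite inE => Ox; rewrite -JE u0 ?expr0n ?mul0r// => Kx.
by apply: Ox; apply: annO; case/andP: Kx.
Qed.

(** The first summand controls the first square of the remainder, through P_k^2 and V; the second
    one controls the last square, through P_k / L. The middle term vanishes on radial functions. *)
Let eta : R := e1 ^+ 2 * (2 + 2 * k%:R ^+ 2) + (4 + 2 * a) / L ^+ 2.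

Let profile_le s : s < 0 ->
  (G2 s + 2 * b * G1 s + b ^+ 2 * G s) ^+ 2 + (4 + 2 * a) * (G1 s + (b + Ss k s / 2) * G s) ^+ 2
  <= eta * (w s * pull k L bump_energy s).
Proof.
move=> sn; have P0 := Ps_gt0 k s sn.
have A0 : 0 <= 4 + 2 * a by rewrite addr_ge0// mulr_ge0.
have -> : G2 s + 2 * b * G1 s + b ^+ 2 * G s = expw b s * (psi k s *
    (Ps k s ^+ 2 * (L^-1 * (L^-1 * pull k L ddbump s)) - Vs k s / 4 * pull k L bump s)).
  by rewrite /G2 /G1 /G /cut sn /profile2/=; ring.
have -> : G1 s + (b + Ss k s / 2) * G s = expw b s * (psi k s * - (Ps k s * (L^-1 * pull k L dbump s))).
  by rewrite /G1 /G /cut sn /profile1 /profile/=; field; exact: lt0r_neq0.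
have -> : pull k L bump_energy s = pull k L bump s ^+ 2 + pull k L dbump s ^+ 2 + pull k L ddbump s ^+ 2 by [].
have out : height k s < L -> [/\ pull k L bump s = 0, pull k L dbump s = 0 & pull k L ddbump s = 0].
  move=> hL; have o (h : R -> R) : (forall t, t < 1 \/ 2 < t -> h t = 0) -> pull k L h s = 0.
    by apply; left; rewrite ltr_pdivrMl// mulr1.
  by split; apply: o; [exact: bump0|exact: dbump0|exact: ddbump0].
move: (pull k L bump s) (pull k L dbump s) (pull k L ddbump s) out => z d dd out.
rewrite !exprMn (psi_sqr k s sn) /w.
(* The smallness hypothesis holds only for [height >= L]; below that the bump and its derivatives
   are 0. *)
have [/out[-> -> ->]|hL {out}] := ltP (height k s) L.
  by rewrite le_eqVlt; apply/orP; left; apply/eqP; ring.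
have X1 := asympt s sn hL; have /andP[V0 V1] := Vs_bound k s sn.
(* Both P_k^2 and V / k are at most X_1^2, hence at most e1 P_k. *)
have PX : Ps k s <= Xs 1 s by rewrite -(prednK kpos); exact: Ps_leX1.
have P2 : Ps k s ^+ 2 <= e1 * Ps k s.
  by apply: le_trans X1; rewrite lerXn2r ?nnegrE// ltW// Xs_gt0.
have {V1}V2 : Vs k s <= k%:R * (e1 * Ps k s).
  by apply: le_trans V1 _; rewrite ler_wpM2l.
have l0 : 0 <= L^-1 by rewrite invr_ge0 ltW.
have l1 : L^-1 <= 1 by rewrite invf_le1 ?ltW.
rewrite /eta -exprVn.
move: (Ps k s) (Vs k s) (expw b s) (L^-1) P0 {X1 PX} P2 V0 V2 l0 l1 => P V E0 l P0 P2 V0 V2 l0 l1.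
set T := e1 * P in P2 V2; have T0 : 0 <= T by rewrite mulr_ge0// ltW.
have k0 : 0 <= k%:R :> R by [].
have B1 : (P ^+ 2 * (l * (l * dd))) ^+ 2 <= T ^+ 2 * dd ^+ 2.
  rewrite (_ : (P ^+ 2 * (l * (l * dd))) ^+ 2 = (P ^+ 2 * (l * l)) ^+ 2 * dd ^+ 2); last by ring.
  apply: ler_wpM2r; first exact: sqr_ge0.
  rewrite lerXn2r// ?nnegrE; first by apply: mulr_ge0; [exact: sqr_ge0|exact: mulr_ge0].
  apply: le_trans P2; rewrite ler_piMr ?sqr_ge0//.
  by rewrite mulr_ile1.
have B2 : (V / 4 * z) ^+ 2 <= k%:R ^+ 2 * T ^+ 2 * z ^+ 2.
  rewrite -exprMn [(V / 4 * z) ^+ 2]exprMn; apply: ler_wpM2r; first exact: sqr_ge0.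
  have kT0 : 0 <= k%:R * T by exact: mulr_ge0.
  rewrite lerXn2r// ?nnegrE; first exact: divr_ge0.
  by apply: le_trans V2; rewrite ler_pdivrMr// ler_peMr// ler1n.
have B3 : (P ^+ 2 * (l * (l * dd)) - V / 4 * z) ^+ 2 <=
    2 * (T ^+ 2 * dd ^+ 2) + 2 * (k%:R ^+ 2 * T ^+ 2 * z ^+ 2).
  have H (p q : R) : (p - q) ^+ 2 <= 2 * p ^+ 2 + 2 * q ^+ 2.
    by rewrite -subr_ge0 (_ : _ - _ = (p + q) ^+ 2) ?sqr_ge0//; ring.
  by apply: le_trans (H _ _) _; apply: lerD; rewrite ler_wpM2l.
have S0 := sqr_ge0 z; have S1 := sqr_ge0 d; have S2 := sqr_ge0 dd.
have K2 := sqr_ge0 (k%:R : R).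
have B4 : (P ^+ 2 * (l * (l * dd)) - V / 4 * z) ^+ 2 <=
    T ^+ 2 * ((2 + 2 * k%:R ^+ 2) * (z ^+ 2 + d ^+ 2 + dd ^+ 2)).
  apply: le_trans B3 _.
  have -> : 2 * (T ^+ 2 * dd ^+ 2) + 2 * (k%:R ^+ 2 * T ^+ 2 * z ^+ 2) =
    T ^+ 2 * (2 * dd ^+ 2 + 2 * (k%:R ^+ 2 * z ^+ 2)) by ring.
  apply: ler_wpM2l; first exact: sqr_ge0.
  rewrite -subr_ge0.
  have -> : (2 + 2 * k%:R ^+ 2) * (z ^+ 2 + d ^+ 2 + dd ^+ 2) - (2 * dd ^+ 2 + 2 * (k%:R ^+ 2 * z ^+ 2)) =
    2 * (z ^+ 2 + d ^+ 2) + 2 * (k%:R ^+ 2 * (d ^+ 2 + dd ^+ 2)) by ring.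
  by apply: addr_ge0; apply: mulr_ge0 => //; [exact: addr_ge0|apply: mulr_ge0 => //; exact: addr_ge0].
have B5 : (4 + 2 * a) * (P * (l * d)) ^+ 2 <= (4 + 2 * a) * l ^+ 2 * P ^+ 2 * (z ^+ 2 + d ^+ 2 + dd ^+ 2).
  have -> : (4 + 2 * a) * (P * (l * d)) ^+ 2 = (4 + 2 * a) * l ^+ 2 * P ^+ 2 * d ^+ 2 by ring.
  apply: ler_wpM2l; first by apply: mulr_ge0; [apply: mulr_ge0 => //|]; exact: sqr_ge0.
  by lra.
have := lerD B4 B5; set q := _ - _ * z; set Sg := _ + _ + dd ^+ 2 => B6.
have -> : E0 ^+ 2 * (P^-1 * q ^+ 2) + (4 + 2 * a) * (E0 ^+ 2 * (P^-1 * (- (P * (l * d))) ^+ 2)) =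
   (E0 ^+ 2 / P) * (q ^+ 2 + (4 + 2 * a) * (P * (l * d)) ^+ 2) by ring.
have -> : (e1 ^+ 2 * (2 + 2 * k%:R ^+ 2) + (4 + 2 * a) * l ^+ 2) * (E0 ^+ 2 * P * Sg) =
   (E0 ^+ 2 / P) * (T ^+ 2 * ((2 + 2 * k%:R ^+ 2) * Sg) + (4 + 2 * a) * l ^+ 2 * P ^+ 2 * Sg).
  by rewrite /T; field; exact: lt0r_neq0.
by apply: ler_wpM2l => //; rewrite divr_ge0 ?sqr_ge0// ltW.
Qed.

Let remainder_le x : rellich_remainder D k u x <= eta * J bump_energy x.
Proof.
have off0 : ~ K x -> ~ sl D x < 0 -> rellich_remainder D k u x <= eta * J bump_energy x.
  move=> Kx /negP sn; rewrite (rellich_remainder_off D K u k cK u0 x Kx) /J /cut.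
  by rewrite (negbTE sn) !mulr0.
have [xE|x0] := eqVneq x 0.
  apply: off0; first by move=> Kx; have := annulus_neq0 D s0 s1 D0 x Kx; rewrite xE eqxx.
  by rewrite xE /sl enorm0 mul0r ln0// ltxx.
have [xD|xD] := ltP (enorm x) D; last first.
  apply: off0; first by move=> /KD; rewrite ltNge xD.
  by apply/negP; rewrite -leNgt /sl ln_ge0// ler_pdivlMr// mul1r.
have sn := sl_lt0 D D0 x x0 xD.
have uiE i : partial i u x = yc i x * G1 (sl D x).
  exact: (partial_radial D D0 G G1 x i x0 xD dG).
have LE : laplacian u x = rho x * (G2 (sl D x) + (N%:R - 2) * G1 (sl D x)).
  exact: (laplacian_radial D D0 G G1 G2 x x0 xD dG dG1).
have YE : \sum_j yc j x * partial j u x = rho x * G1 (sl D x).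
  by rewrite -(sum_yc_sqr x x0) mulr_suml; apply: eq_bigr => j _; rewrite uiE; ring.
have GE : \sum_j partial j u x ^+ 2 = rho x * G1 (sl D x) ^+ 2.
  by rewrite -(sum_yc_sqr x x0) mulr_suml; apply: eq_bigr => j _; rewrite uiE; ring.
rewrite /rellich_remainder YE GE LE -[u x]/(G (sl D x)) -/b -/a.
have bE : N%:R = 2 * b + 4 :> R by rewrite /b; field.
(* With N - 4 = 2 b, this makes -b a double root of the radial operator in the first square, which
   becomes f'' + 2 b f' + b^2 f. *)
have aE : a - 2 * b = b ^+ 2 by rewrite /a bE; field.
rewrite aE bE; set A := _ + _.
have -> : A = rho x ^+ 2 * ((G2 (sl D x) + 2 * b * G1 (sl D x) + b ^+ 2 * G (sl D x)) ^+ 2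
   + (4 + 2 * a) * (G1 (sl D x) + (b + Ss k (sl D x) / 2) * G (sl D x)) ^+ 2).
  by rewrite /A; ring.
rewrite /J (mulrCA eta); apply: ler_wpM2l; first exact: sqr_ge0.
by rewrite /cut sn; exact: profile_le.
Qed.

(** Since the integral of [J] vanishes on the derivative of [H], those of [bump_energy] and of m
    bump^2 agree exactly; [m] does not depend on [L], so only [eta] has to be made small. *)
Lemma integral_remainder_near_extremal (m : R) (H : R -> R) :
  (forall t : R, is_derive t (1 : R) H (bump_energy t - m * bump t ^+ 2)) ->
  (forall t, t <= 1 \/ 2 <= t -> H t = 0) ->
  (\int[lebesgue_rV N]_x (rellich_remainder D k u x)%:E <=
   (eta * m)%:E * log_term Omega D k u)%E.
Proof.
move=> HdH H0.
have cb2 : continuous (fun t : R => bump t ^+ 2).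
  by move=> t; apply: cvgM; exact: continuous_bump.
have cE := @continuous_bump_energy R; have E0 := @bump_energy_out R.
have b20 (t : R) : t < 1 \/ 2 < t -> bump t ^+ 2 = 0 by move=> Ht; rewrite bump0// expr0n.
pose dH t : R := bump_energy t - m * bump t ^+ 2.
have cdH : continuous dH.
  move=> t; apply: cvgB; first exact: cE.
  by apply: cvgM; [exact: cvg_cst|exact: cb2].
have dH0 t : t < 1 \/ 2 < t -> dH t = 0 by move=> Ht; rewrite /dH E0// b20// mulr0 subrr.
have Z := integral_J_derive H dH HdH cdH _ dH0.
have i1 := iJ _ cdH dH0; have i2 := iJ _ cb2 b20; have i3 := iJ _ cE E0.
have [j2 Z2] := integral_EFinZ _ (lebesgue_rV N) m _ i2.
have [_ Z3] := integral_EFinD _ (lebesgue_rV N) _ _ i1 j2.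
have [j4 Z4] := integral_EFinZ _ (lebesgue_rV N) eta _ i3.
have iQ : (lebesgue_rV N).-integrable setT (fun x => (rellich_remainder D k u x)%:E).
  by have [] := rellich_identity Omega D N5 oO bO O0 sD k u test_function_near_extremal.
apply: (@le_trans _ _ (\int[lebesgue_rV N]_x (eta * J bump_energy x)%:E)%E).
  by apply: le_integral => // x _; rewrite lee_fin; exact: remainder_le.
rewrite Z4 EFinM -muleA log_term_near_extremal -Z2.
rewrite (_ : (\int[_]_x (J bump_energy x)%:E)%E = (\int[lebesgue_rV N]_x (m * J (fun t => bump t ^+ 2) x)%:E)%E)//.
rewrite -[RHS]add0e -Z -?Z3; last by move=> t Ht; apply: H0; case: Ht => /ltW; [left|right].
apply: eq_integral => x _; congr _%:E; rewrite /J /cut; case: ifP => _; last by rewrite !mulr0 addr0.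
by rewrite /dH /pull; ring.
Qed.

End near_extremal.

(** * Choice of parameters and sharpness *)

Section sharpness.
Context {R : realType} {N : nat} (Omega : set 'rV[R]_N) (D : R).
Hypothesis N5 : (5 <= N)%N.
Hypothesis oO : open Omega.
Hypothesis bO : bounded_set Omega.
Hypothesis O0 : Omega 0.
Hypothesis sD : sup [set enorm x | x in Omega] <= D.

Let a : R := N%:R * (N%:R - 4) / 4.
Let c : R := 1 + N%:R * (N%:R - 4) / 8.
Let D0 : 0 < D. Proof. exact: (D_gt0 Omega D N5 oO bO O0 sD). Qed.

Lemma exists_enorm_ball : exists2 d : R, 0 < d & forall x, enorm x < d -> Omega x.
Proof.
have /nbhs_ballP[d /= d0 Hd] : nbhs (0 : 'rV[R]_N) Omega by exact: open_nbhs_nbhs.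
exists d => // x xd; apply: Hd; apply/rV_ballP => // i.
by rewrite mxE sub0r normrN; apply: le_lt_trans (ler_coord_enorm _ _ _) xd.
Qed.

Lemma exists_small_remainder (k : nat) (eps : R) : (0 < k)%N -> 0 < eps ->
  exists u, [/\ test_function Omega u, u <> (fun=> 0) &
   (\int[lebesgue_rV N]_x (rellich_remainder D k u x)%:E <= eps%:E * log_term Omega D k u)%E].
Proof.
move=> k0 eps0.
have [m [H [dH H0]]] := bump_antiderivative _ (@continuous_bump_energy R) (@bump_energy_out R).
have [d d0 dO] := exists_enorm_ball.
(* A positive upper bound for [m], whose sign is not recorded. *)
pose M := `|m| + 1; have M0 : 0 < M by rewrite ltr_wpDl.
pose B : R := 2 + 2 * k%:R ^+ 2.
have B0 : 0 < B by rewrite ltr_pwDl// mulr_ge0// sqr_ge0.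
pose A := 4 + 2 * a.
have A0 : 0 < A.
  rewrite /A /a ltr_pwDl// mulr_ge0// divr_ge0// mulr_ge0// subr_ge0 ler_nat.
  exact: leq_trans N5.
have BM : 0 < B * M by exact: mulr_gt0.
have AM : 0 < A * M by exact: mulr_gt0.
(* This is at most 1 and at most eps / (2 B M), so [e1 ^+ 2 * (B * M) <= eps / 2]. *)
pose e1 := eps / (eps + 2 * (B * M)).
have den0 : 0 < eps + 2 * (B * M) by rewrite addr_gt0// mulr_gt0.
have e10 : 0 < e1 by exact: divr_gt0.
have e11 : e1 <= 1 by rewrite ler_pdivrMr// mul1r lerDl mulr_ge0// ltW.
(* At [k.-1] the bound is on P_k, under a condition on 1 / X_(k+1), which is [height k]. *)
have [L0 L00 HL0] := Xs1_sqr_le_Ps k.-1 e1 e10.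
(* Each summand meets one demand: 1 gives L > 1, [L0] the asymptotic range, 2 A M / eps the bound A
   M / L^2 <= eps / 2, and D / d a support inside the ball of radius [d]. *)
pose L := 1 + L0 + 2 * (A * M) / eps + D / d.
have q1 : 0 < 2 * (A * M) / eps by rewrite divr_gt0// mulr_gt0.
have q2 : 0 < D / d by exact: divr_gt0.
have L1 : 1 < L by rewrite /L; lra.
have LL0 : L0 <= L by rewrite /L; lra.
have LA : 2 * (A * M) / eps <= L by rewrite /L; lra.
have LD : D / d < L by rewrite /L; lra.
have Lp : 0 < L by exact: lt_trans L1.
have [|s0 s00 heightL] := Xs_surj k.+1 (2 * L); first by lra.
have asympt s : s < 0 -> L <= height k s -> Xs 1 s ^+ 2 <= e1 * Ps k s.
  move=> sn Ls; have := HL0 s sn; rewrite (prednK k0); apply.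
  exact: le_trans LL0 Ls.
have annO x : enorm x <= D * expR (1 - L) -> Omega x.
  move=> xL; apply: dO; apply: le_lt_trans xL _.
  (* The outer radius D exp (1 - L) is below [d] because D / d < L <= exp (L - 1). *)
  rewrite -(opprB L 1) expRN ltr_pdivrMr ?expR_gt0// mulrC -ltr_pdivrMr//.
  by apply: lt_le_trans LD _; have := expR_ge1Dx (L - 1); rewrite addrC subrK.
exists (near_extremal D k L).
have tu := test_function_near_extremal Omega D N5 oO bO O0 sD k L s0 L1 heightL s00 annO.
split => //; first exact: (near_extremal_neq0 Omega D N5 oO bO O0 sD k L L1).
apply: le_trans (integral_remainder_near_extremal Omega D N5 oO bO O0 sD k L e1 s0
  L1 heightL s00 e10 asympt k0 annO m H dH H0) _.
apply: lee_wpmul2r; first exact: log_term_ge0.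
rewrite lee_fin -/a -/A -/B.
apply: (@le_trans _ _ ((e1 ^+ 2 * B + A / L ^+ 2) * M)).
  apply: ler_wpM2l; last by rewrite /M; have := ler_norm m; lra.
  apply: addr_ge0; first by apply: mulr_ge0; [exact: sqr_ge0|exact: ltW].
  by apply: divr_ge0; [exact: ltW|exact: sqr_ge0].
have h1 : e1 ^+ 2 * (B * M) <= eps / 2.
  apply: (@le_trans _ _ (e1 * (B * M))).
    by apply: ler_wpM2r; [exact: ltW|rewrite expr2 ler_piMl// ltW].
  rewrite /e1 mulrAC ler_pdivrMr// -subr_ge0.
  rewrite (_ : _ - _ = eps ^+ 2 / 2); last by field.
  by apply: divr_ge0 => //; exact: sqr_ge0.
have h2 : A * M / L ^+ 2 <= eps / 2.
  apply: (@le_trans _ _ (A * M / L)).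
    rewrite ler_pM2l// lef_pV2 ?posrE ?exprn_gt0// expr2.
    by rewrite ler_peMl// ltW.
  rewrite ler_pdivrMr//; move: LA; rewrite ler_pdivrMr//.
  by rewrite (_ : eps / 2 * L = L * eps / 2); [lra|ring].
rewrite (_ : (e1 ^+ 2 * B + A / L ^+ 2) * M = e1 ^+ 2 * (B * M) + A * M / L ^+ 2); last by ring.
by rewrite [leRHS]splitr lerD.
Qed.

(** By the identity with m = k, the quotient is [c] plus the ratio of the remainder to the k-th
    logarithmic term. *)
Lemma rellich_quotient_near k (eps : R) : (1 <= k)%N -> 0 < eps ->
  exists u, [/\ test_function Omega u, u <> (fun=> 0) &
  ((bilaplace_energy Omega u - (a ^+ 2)%:E * rellich_term Omega u
    - c%:E * \sum_(1 <= i < k) log_term Omega D i u) / log_term Omega D k u <= (c + eps)%:E)%E].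
Proof.
move=> k1 eps0; have [u [tu un0 Hu]] := exists_small_remainder k eps k1 eps0.
exists u; split => //.
have [fT iQ [fE fR Eq]] := rellich_identity Omega D N5 oO bO O0 sD k u tu.
have fQ := integrable_fin_num measurableT iQ.
move: Hu; rewrite -(fineK fQ) -[X in (_ * X)%E](fineK (fT k)) lee_fin => Hu.
have := log_term_gt0 Omega D N5 oO bO O0 sD k u tu un0.
rewrite sum_log_termE// -(fineK fE) -(fineK fR) -(fineK (fT k)).
rewrite lte_fin => T0; rewrite inver gt_eqF//.
suff H : (((fine (bilaplace_energy Omega u) - a ^+ 2 * fine (rellich_term Omega u)
    - c * (\sum_(1 <= i < k) fine (log_term Omega D i u))) / fine (log_term Omega D k u))%:E
    <= (c + eps)%:E)%E.
  exact: H.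
rewrite lee_fin ler_pdivrMr//; move: Eq; rewrite big_nat_recr//= -/a -/c => ->.
by move: Hu; set s := \sum_(1 <= i < k) _; set t := fine (log_term _ _ _ _); lra.
Qed.

End sharpness.

Theorem theorem1p4 (R : realType) (N : nat) (Omega : set 'rV[R]_N) (D : R) :
  (5 <= N)%N ->
  open Omega -> connected Omega -> bounded_set Omega -> Omega 0 ->
  sup [set enorm x | x in Omega] <= D ->
  let a : R := N%:R * (N%:R - 4) / 4 in
  let c : R := 1 + N%:R * (N%:R - 4) / 8 in
  (forall u, test_function Omega u ->
    (bilaplace_energy Omega u >=
     (a ^+ 2)%:E * rellich_term Omega u +
     c%:E * \sum_(1 <= i <oo) log_term Omega D i u)%E) /\
  (forall k, (1 <= k)%N ->
    c%:E = ereal_inf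
      [set ((bilaplace_energy Omega u
             - (a ^+ 2)%:E * rellich_term Omega u
             - c%:E * \sum_(1 <= i < k) log_term Omega D i u)
            / log_term Omega D k u)%E
      | u in [set u | test_function Omega u /\ u <> (fun=> 0)]]).
Proof.
move=> N5 oO _ bO O0 sD a c; split; first exact: rellich_log_inequality.
move=> k k1; apply/eqP; rewrite eq_le; apply/andP; split.
  by apply: le_ereal_inf_tmp => _ [u [tu un0] <-]; exact: rellich_quotient_ge.
apply/lee_addgt0Pr => e e0.
have [u [tu un0 ue]] := rellich_quotient_near Omega D N5 oO bO O0 sD k e k1 e0.
by apply: le_trans ue; apply: ereal_inf_lbound; exists u.
Qed.
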